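(* The closure $\mathcal B$ of the family of Bethe subalgebras $\{B(C)\}$ in $\mathrm Y(\mathfrak{gl}_2)$, where $[C]$ runs over $\mathbb{CP}^3\setminus\{[I]\}$ with $\mathbb{CP}^3=\mathbb P(\mathrm{Mat}_2(\mathbb C))$ and $I=\left(\begin{smallmatrix}1&0\\0&1\end{smallmatrix}\right)$, is parametrized by the points of the blow-up of $\mathbb{CP}^3$ at the point $[I]$.
   Context: **Yangian.** $\mathrm Y(\mathfrak{gl}_2)$ is the associative unital $\mathbb C$-algebra generated by $t_{ij}^{(r)}$, $1\le i,j\le 2$, $r\ge 0$, $t_{ij}^{(0)}=\delta_{ij}$, with relations $[t_{ij}^{(r+1)},t_{kl}^{(s)}]-[t_{ij}^{(r)},t_{kl}^{(s+1)}]=t_{kj}^{(r)}t_{il}^{(s)}-t_{kj}^{(s)}t_{il}^{(r)}$. Put $t_{ij}(u)=\sum_{r\ge0}t_{ij}^{(r)}u^{-r}$ and $T(u)=(t_{ij}(u))_{i,j}$. The filtration $F^\bullet\mathrm Y(\mathfrak{gl}_2)$ is defined by $\deg t_{ij}^{(r)}=r$. **Bethe subalgebras.** For $C=(c_{ij})\in \mathrm{Mat}_2(\mathbb C)$, $B(C)\subset \mathrm Y(\mathfrak{gl}_2)$ is the (commutative) subalgebra generated by all coefficients of $\operatorname{qdet}T(u)=t_{11}(u)t_{22}(u-1)-t_{21}(u)t_{12}(u-1)$ (expanded in $u^{-1}$) and of $\operatorname{tr}CT(u)=c_{11}t_{11}(u)+c_{12}t_{21}(u)+c_{21}t_{12}(u)+c_{22}t_{22}(u)$.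 It depends only on $[C]\in\mathbb{CP}^3=\mathbb P(\mathrm{Mat}_2)$. **Families and closures.** Let $A$ be an algebra with filtration $F^\bullet A$. A family of subalgebras of $A$ parametrized by a variety $X$ is an assignment $x\mapsto \mathcal A(x)\subset A$ such that for each $N$ the number $d_N=\dim(\mathcal A(x)\cap F^NA)$ is independent of $x$ and $X\to \mathbb G(d_N,F^NA)$, $x\mapsto\mathcal A(x)\cap F^NA$, is a morphism of varieties to the Grassmannian of $d_N$-dimensional subspaces. Its closure is defined as follows: $Z_N\subset\prod_{N'\le N}\mathbb G(d_{N'},F^{N'}A)$ is the closure of the image of $X$; the parameter space of the closure is $\varprojlim Z_N\subset\prod_{N\ge 0}\mathbb G(d_N,F^NA)$ (under the surjective restriction maps $Z_N\to Z_M$, $N>M$). Each point $z$ of it gives a graded subspace of the Rees algebra $\bigoplus_{N\ge0}F^NA$ with $N$-th component of dimension $d_N$; this is a graded subalgebra, and its image under the natural projection to $A$ (identity on each $F^NA$) is the subalgebra of $A$ attached to $z$. The family of Bethe subalgebras is $[C]\mapsto B(C)$ over $\mathbb{CP}^3\setminus\{[I]\}$. *)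

(* Defs.v *)
From HB Require Import structures.
From mathcomp Require Import all_boot all_order all_algebra.
From mathcomp Require Import all_classical all_reals.
From mathcomp Require Import complex ring.
(* Loading the notations of monalg fails: their levels clash with those of
   classical_sets. *)
From mathcomp Require Import -(notations) monalg.
From mathcomp Require Import generic_quotient.

Set Implicit Arguments.
Unset Strict Implicit.
Unset Printing Implicit Defensive.

Import GRing.Theory.
Local Open Scope classical_set_scope.
Local Open Scope ring_scope.

Section LinearAlgebra.
Variable K : fieldType.

Definition lspan (V : lmodType K) (S : set V) : set V :=
  smallest (fun W : set V => GRing.submod_closed (mem W)) S.

Definition is_subalgebra (A : algType K) (S : set A) : Prop :=
  GRing.subalg_closed (mem S).

Definition subalgebra_gen (A : algType K) (S : set A) : set A :=
  smallest (@is_subalgebra A) S.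

Definition two_sided_ideal (A : lalgType K) (J : set A) : Prop :=
  GRing.submod_closed (mem J) /\ forall a x, J x -> J (a * x) /\ J (x * a).

Definition ideal_gen (A : lalgType K) (S : set A) : set A :=
  smallest (@two_sided_ideal A) S.

Definition frame (V : lmodType K) (E : set V) (d : nat) (v : 'I_d -> V) : Prop :=
  (forall i, E (v i)) /\
  (forall c : 'I_d -> K, \sum_i c i *: v i = 0 -> forall i, c i = 0).

End LinearAlgebra.

(* Varieties are treated as spaces with functions: a set with a topology and,
   on each open set U, a class of regular K-valued functions.  Functions are
   total; [kreg U f] only depends on the values of f on U. *)
Section Spaces.
Variable K : fieldType.

Record kspace := Space {
  carrier :> Type;
  kopen : set (set carrier);
  kreg : set carrier -> set (carrier -> K) }.

Definition kmorphism (X Y : kspace) (f : X -> Y) : Prop :=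
  forall U : set Y, kopen U ->
    kopen (f @^-1` U) /\ forall g, kreg U g -> kreg (f @^-1` U) (g \o f).

Definition kisomorphism (X Y : kspace) (f : X -> Y) : Prop :=
  kmorphism f /\ exists g : Y -> X, [/\ kmorphism g, cancel f g & cancel g f].

Definition kclosure (X : kspace) (A : set X) : set X :=
  [set x | forall U, kopen U -> U x -> U `&` A !=set0].

Inductive polyfun (T : Type) (G : set (T -> K)) : (T -> K) -> Prop :=
| polyfun_gen f of G f : polyfun G f
| polyfun_cst c : polyfun G (fun=> c)
| polyfun_add f g of polyfun G f & polyfun G g : polyfun G (fun x => f x + g x)
| polyfun_mul f g of polyfun G f & polyfun G g : polyfun G (fun x => f x * g x).

(* The Zariski topology and the locally rational functions on a subset T of
   an affine space with coordinate functions G. *)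
Definition quasi_affine (T : Type) (G : set (T -> K)) : kspace := {|
  carrier := T;
  kopen := [set U | forall x, U x -> exists p,
    [/\ polyfun G p, p x != 0 & forall y, p y != 0 -> U y]];
  kreg := fun U => [set f | forall x, U x -> exists p q,
    [/\ polyfun G p, polyfun G q, q x != 0 &
        forall y, U y -> q y != 0 -> f y = p y / q y]] |}.

Definition kquotient (X : kspace) (T : Type) (q : X -> T) : kspace := {|
  carrier := T;
  kopen := [set U | kopen (q @^-1` U)];
  kreg := fun U => [set f : T -> K | kreg (q @^-1` U) (f \o q)] |}.

(* The coarsest structure on T making all maps [pr i] morphisms.  For the
   inclusion of a subset it is the induced structure, for the projections of
   a product it is the product of varieties.  Locally, its regular functions
   are quotients of sums of products of functions pulled back by the pr i. *)
Section Initial.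
Variables (T I : Type) (X : I -> kspace) (pr : forall i, T -> X i).

Definition is_kbox (U : forall i, set (X i)) : Prop :=
  (forall i, kopen (U i)) /\ finite_set [set i | U i <> setT].

Definition kbox (U : forall i, set (X i)) : set T :=
  [set t | forall i, U i (pr i t)].

Definition kbox_fun (U : forall i, set (X i)) : set (T -> K) :=
  polyfun [set h | exists i g, kreg (U i) g /\ h = g \o pr i].

Definition kinitial : kspace := {|
  carrier := T;
  kopen := [set W | forall t, W t -> exists U p,
    [/\ is_kbox U, kbox U t, kbox_fun U p, p t != 0 &
        forall y, kbox U y -> p y != 0 -> W y]];
  kreg := fun W => [set f | forall t, W t -> exists U p q,
    [/\ is_kbox U /\ kbox U t, kbox_fun U p, kbox_fun U q, q t != 0 &
        forall y, W y -> kbox U y -> q y != 0 -> f y = p y / q y]] |}.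
End Initial.

Definition ksubspace (X : kspace) (A : set X) : kspace :=
  kinitial (fun (_ : unit) (x : {x : X | A x}) => sval x : X).

Definition kprod (X Y : kspace) : kspace :=
  @kinitial (X * Y)%type bool (fun b => if b then X else Y)
    (fun b => if b return X * Y -> (if b then X else Y) then fst else snd).

Definition kpi (I : Type) (X : I -> kspace) : kspace :=
  @kinitial (forall i, X i) I X (fun i x => x i).

End Spaces.

Section Grassmannian.
Variables (K : fieldType) (V : lmodType K) (E : set V) (d : nat).

Definition frame_space : kspace K :=
  quasi_affine [set h | exists (l : {scalar V}) (i : 'I_d),
                        h = fun v : {v : 'I_d -> V | frame E v} => l (sval v i)].

Definition subspace_pt : Type :=
  {W : set V | exists2 v : 'I_d -> V, frame E v & W = lspan (range v)}.

Definition frame_span (v : frame_space) : subspace_pt :=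
  exist _ (lspan (range (sval v)))
    (ex_intro2 _ _ (sval v) (svalP v) (erefl (lspan (range (sval v))))).

(* The Grassmannian of d-dimensional subspaces of V contained in the subspace
   E (finite-dimensional in all uses), as the quotient of the variety of
   d-frames in E by GL_d. *)
Definition grass : kspace K := kquotient frame_span.

End Grassmannian.

Definition proj_space (K : fieldType) (V : lmodType K) : kspace K :=
  grass [set: V] 1.

Section Families.
Variables (K : fieldType) (A : algType K) (F : nat -> set A).

Record subalg_family (X : kspace K) := Family {
  fam_alg : X -> set A;
  fam_subalg : forall x, is_subalgebra (fam_alg x);
  fam_dim : nat -> nat;
  fam_pt : forall N, X -> grass (F N) (fam_dim N);
  fam_ptE : forall N x, sval (fam_pt N x) = fam_alg x `&` F N;
  fam_morphism : forall N, kmorphism (fam_pt N) }.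

Variables (X : kspace K) (B : subalg_family X).

Definition tower_space : kspace K :=
  kpi (fun N => grass (F N) (fam_dim B N)).

Definition truncated_tower_space (N : nat) : kspace K :=
  kpi (fun i : 'I_N.+1 => grass (F i) (fam_dim B i)).

Definition truncate_tower N (z : tower_space) : truncated_tower_space N :=
  fun i => z i.
Arguments truncate_tower : clear implicits.

Definition fam_tower (x : X) : tower_space := fun N => fam_pt B N x.

Definition closure_trunc N : set (truncated_tower_space N) :=
  kclosure (range (truncate_tower N \o fam_tower)).

(* The inverse limit of the closures [closure_trunc N], as a subspace of the
   product of all the Grassmannians. *)
Definition closure_space : kspace K :=
  ksubspace [set z : tower_space | forall N, closure_trunc (truncate_tower N z)].

(* The image in A of the graded subspace of the Rees algebra given by z. *)
Definition closure_alg (z : closure_space) : set A :=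
  \bigcup_N sval (sval z N).

End Families.

Section Yangian.
Variable K : fieldType.

(* The free algebra; the letter (i, j, r) stands for t_ij^(r+1), and the matrix
   indices 1, 2 are shifted to 0, 1. *)
Definition yfree : lalgType K := malg (fmonom ('I_2 * 'I_2 * nat)%type) K.

Definition yfree_t (i j : 'I_2) (r : nat) : yfree :=
  if r is r'.+1 then mkmalgU (fmu (i, j, r')) 1 else (i == j)%:R.

Definition bracket (A : pzRingType) (x y : A) : A := x * y - y * x.

Definition yrel (i j k l : 'I_2) (r s : nat) : yfree :=
  let t := yfree_t in
  bracket (t i j r.+1) (t k l s) - bracket (t i j r) (t k l s.+1)
  - (t k j r * t i l s - t k j s * t i l r).

Definition yideal : set yfree :=
  ideal_gen [set x | exists i j k l r s, x = yrel i j k l r s].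

Lemma yideal_ideal : two_sided_ideal yideal.
Proof.
split; first split.
- by rewrite inE => J [[[J0 _] _] _]; move: J0; rewrite inE.
- move=> a x y; rewrite !inE => Jx Jy J JS.
  have [[[_ lin] _] _] := JS.
  have := lin a x y; rewrite !inE; apply; [exact: Jx|exact: Jy].
- by move=> a x Jx; split=> J JS; have [[_ /(_ a x (Jx J JS))[]]] := JS.
Qed.

Lemma yideal0 : yideal 0.
Proof. by have [[]] := yideal_ideal; rewrite inE. Qed.

Lemma yidealZD a x y : yideal x -> yideal y -> yideal (a *: x + y).
Proof.
have [[_ lin] _] := yideal_ideal => Jx Jy.
by have := lin a x y; rewrite !inE; apply; [exact: Jx|exact: Jy].
Qed.

Lemma yidealZ a x : yideal x -> yideal (a *: x).
Proof. by move=> Jx; rewrite -[_ *: _]addr0; exact: yidealZD Jx yideal0. Qed.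

Lemma yidealD x y : yideal x -> yideal y -> yideal (x + y).
Proof. by move=> Jx Jy; rewrite -[x]scale1r; exact: yidealZD Jx Jy. Qed.

Lemma yidealN x : yideal x -> yideal (- x).
Proof. by move=> Jx; rewrite -scaleN1r; exact: yidealZ Jx. Qed.

Lemma yidealMl a x : yideal x -> yideal (a * x).
Proof. by have [_ m] := yideal_ideal => /(m a)[]. Qed.

Lemma yidealMr a x : yideal x -> yideal (x * a).
Proof. by have [_ m] := yideal_ideal => /(m a)[]. Qed.

Lemma yideal_proper : ~ yideal 1.
Proof.
have aux (A : nzRingType) (e : {rmorphism A -> K}) (a b c d f g h l : A) :
    e f * e g = e h * e l ->
    e (bracket a b - bracket c d - (f * g - h * l)) = 0.
  by rewrite /bracket !rmorphB !rmorphM => ->; ring.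
pose e : {rmorphism yfree -> K} := mcoeff (monalg.one : fmonom _).
have eZ a x : e (a *: x) = a * e x by exact: mcoeffZ.
have e_t i j r : e (yfree_t i j r) = ((i == j) && (r == 0%N))%:R.
  case: r => [|r]; first by rewrite andbT; exact: rmorph_nat.
  by rewrite andbF /e /= mcoeffU fm1_eq1.
move=> /(_ [set x | e x = 0]) H.
suff : (1 : K) = 0 by apply/eqP; rewrite oner_eq0.
rewrite -(rmorph1 e); apply: H; split; last first.
  move=> _ [i [j [k [l [r [s ->]]]]]]; apply: aux; rewrite !e_t.
  by case: r s => [|r] [|s]; rewrite ?andbT ?andbF /=; ring.
split; first split.
- by rewrite inE /=; exact: raddf0.
- move=> a x y; rewrite !inE => /= ex ey.
  change (e x = 0) in ex; change (e y = 0) in ey; change (e (a *: x + y) = 0).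
  have -> : e (a *: x + y) = e (a *: x) + e y by exact: raddfD.
  by rewrite eZ ex ey mulr0 addr0.
- move=> a x /= ex.
  change (e x = 0) in ex; change (e (a * x) = 0 /\ e (x * a) = 0).
  have eM u v : e (u * v) = e u * e v by exact: rmorphM.
  by rewrite !eM ex mulr0 mul0r.
Qed.

Definition yequiv (x y : yfree) : bool := `[< yideal (x - y) >].

Lemma yequivP : equiv_class_of yequiv.
Proof.
split=> [x|x y|y x z].
- by apply/asboolP; rewrite subrr; apply: yideal0.
- by apply/asboolP/asboolP => /yidealN; rewrite opprB.
- move=> /asboolP xy /asboolP yz; apply/asboolP.
  by rewrite -(subrK y x) -addrA; apply: yidealD.
Qed.

Canonical yequiv_equiv := EquivRelPack yequivP.

Local Open Scope quotient_scope.

Definition yangian : Type := {eq_quot yequiv_equiv}.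

HB.instance Definition _ := Choice.on yangian.
HB.instance Definition _ := EqQuotient.on yangian.

Lemma pi_yP x y : \pi_yangian x = \pi_yangian y <-> yideal (x - y).
Proof. by split=> [/eqmodP/asboolP|xy]; last by apply/eqmodP/asboolP. Qed.

Definition ylift2 (f : yfree -> yfree -> yfree) (x y : yangian) : yangian :=
  \pi_yangian (f (repr x) (repr y)).
Definition yadd := ylift2 +%R.
Definition ymul := ylift2 *%R.
Definition yopp (x : yangian) : yangian := \pi_yangian (- repr x).
Definition yscale (a : K) (x : yangian) : yangian := \pi_yangian (a *: repr x).

Lemma yreprB x : yideal (repr (\pi_yangian x) - x).
Proof. by apply/pi_yP; rewrite reprK. Qed.

Lemma yaddE x y : yadd (\pi_yangian x) (\pi_yangian y) = \pi_yangian (x + y).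
Proof. by apply/pi_yP; rewrite opprD addrACA; apply: yidealD; exact: yreprB. Qed.

Lemma ymulE x y : ymul (\pi_yangian x) (\pi_yangian y) = \pi_yangian (x * y).
Proof.
apply/pi_yP; set x' := repr _; set y' := repr _.
have -> : x' * y' - x * y = (x' - x) * y' + x * (y' - y).
  by rewrite mulrBl mulrBr addrA subrK.
exact: yidealD (yidealMr _ (yreprB x)) (yidealMl _ (yreprB y)).
Qed.

Lemma yoppE x : yopp (\pi_yangian x) = \pi_yangian (- x).
Proof. by apply/pi_yP; rewrite -opprD; exact: yidealN (yreprB x). Qed.

Lemma yscaleE a x : yscale a (\pi_yangian x) = \pi_yangian (a *: x).
Proof. by apply/pi_yP; rewrite -scalerBr; exact: yidealZ (yreprB x). Qed.

Lemma ysurj (x : yangian) : exists u, x = \pi_yangian u.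
Proof. by exists (repr x); rewrite reprK. Qed.

Definition yE := (yaddE, ymulE, yoppE, yscaleE).

Lemma yaddA : associative yadd.
Proof.
move=> x y z; case: (ysurj x) (ysurj y) (ysurj z) => {}x -> [{}y ->] [{}z ->].
by rewrite !yE addrA.
Qed.
Lemma yaddC : commutative yadd.
Proof.
move=> x y; case: (ysurj x) (ysurj y) => {}x -> [{}y ->].
by rewrite !yE addrC.
Qed.
Lemma yadd0 : left_id (\pi_yangian 0) yadd.
Proof. by move=> x; case: (ysurj x) => {}x ->; rewrite !yE add0r. Qed.
Lemma yaddN : left_inverse (\pi_yangian 0) yopp yadd.
Proof. by move=> x; case: (ysurj x) => {}x ->; rewrite !yE addNr. Qed.

HB.instance Definition _ := GRing.isZmodule.Build yangian yaddA yaddC yadd0 yaddN.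

Lemma pi_yD x y : \pi_yangian (x + y) = \pi_yangian x + \pi_yangian y.
Proof. by rewrite -yaddE. Qed.

Lemma ymulA : associative ymul.
Proof.
move=> x y z; case: (ysurj x) (ysurj y) (ysurj z) => {}x -> [{}y ->] [{}z ->].
by rewrite !yE mulrA.
Qed.
Lemma ymul1 : left_id (\pi_yangian 1) ymul.
Proof. by move=> x; case: (ysurj x) => {}x ->; rewrite !yE mul1r. Qed.
Lemma ymulr1 : right_id (\pi_yangian 1) ymul.
Proof. by move=> x; case: (ysurj x) => {}x ->; rewrite !yE mulr1. Qed.
Lemma ymulDl : left_distributive ymul yadd.
Proof.
move=> x y z; case: (ysurj x) (ysurj y) (ysurj z) => {}x -> [{}y ->] [{}z ->].
by rewrite !yE mulrDl.
Qed.
Lemma ymulDr : right_distributive ymul yadd.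
Proof.
move=> x y z; case: (ysurj x) (ysurj y) (ysurj z) => {}x -> [{}y ->] [{}z ->].
by rewrite !yE mulrDr.
Qed.
Lemma yone_neq0 : \pi_yangian 1 != \pi_yangian 0.
Proof. by apply/eqP => /pi_yP; rewrite subr0; apply: yideal_proper. Qed.

HB.instance Definition _ := GRing.Zmodule_isNzRing.Build yangian
  ymulA ymul1 ymulr1 ymulDl ymulDr yone_neq0.

Lemma pi_yM x y : \pi_yangian (x * y) = \pi_yangian x * \pi_yangian y.
Proof. by rewrite -ymulE. Qed.

Lemma yscaleA a b x : yscale a (yscale b x) = yscale (a * b) x.
Proof. by case: (ysurj x) => {}x ->; rewrite !yE scalerA. Qed.
Lemma yscale1 : left_id 1 yscale.
Proof. by move=> x; case: (ysurj x) => {}x ->; rewrite !yE scale1r. Qed.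
Lemma yscaleDr : right_distributive yscale +%R.
Proof.
move=> a x y; case: (ysurj x) => {}x ->; case: (ysurj y) => {}y ->.
by rewrite -pi_yD !yscaleE -pi_yD scalerDr.
Qed.
Lemma yscaleDl x : {morph yscale^~ x : a b / a + b}.
Proof. by case: (ysurj x) => {}x -> a b; rewrite !yscaleE -pi_yD scalerDl. Qed.

HB.instance Definition _ := GRing.Zmodule_isLmodule.Build K yangian
  yscaleA yscale1 yscaleDr yscaleDl.

Lemma pi_yZ a x : \pi_yangian (a *: x) = a *: \pi_yangian x.
Proof. by rewrite -yscaleE. Qed.

Lemma yscaleAl (a : K) (x y : yangian) : a *: (x * y) = (a *: x) * y.
Proof.
case: (ysurj x) => {}x ->; case: (ysurj y) => {}y ->.
by rewrite -pi_yM -!pi_yZ -pi_yM scalerAl.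
Qed.

HB.instance Definition _ := GRing.Lmodule_isLalgebra.Build K yangian yscaleAl.

Lemma yscaleAr (a : K) (x y : yangian) : a *: (x * y) = x * (a *: y).
Proof.
case: (ysurj x) => {}x ->; case: (ysurj y) => {}y ->.
rewrite -pi_yM -!pi_yZ -pi_yM; congr (\pi_yangian _).
rewrite -(mul_malgC a (x * y)) -(mul_malgC a y) !mulrA; congr (_ * _).
rewrite malgM_def fgmulUg malgM_def fgmulgU; apply: eq_bigr => k _.
by rewrite mulrC mul1m mulm1.
Qed.

HB.instance Definition _ := GRing.Lalgebra_isAlgebra.Build K yangian yscaleAr.

Definition yt (i j : 'I_2) (r : nat) : yangian := \pi_yangian (yfree_t i j r).

Definition yfil (N : nat) : set yangian :=
  lspan [set x | exists2 w : seq ('I_2 * 'I_2 * nat),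
    (\sum_(g <- w) g.2 <= N)%N & x = \prod_(g <- w) yt g.1.1 g.1.2 g.2].

(* The coefficient of u^-m in t_ij(u - 1): for s >= 1,
   (u - 1)^-s = \sum_(m >= s) 'C(m - 1, m - s) u^-m, while for s = 0 only the
   term m = 0 is nonzero. *)
Definition yt_shift (i j : 'I_2) (m : nat) : yangian :=
  \sum_(s < m.+1) yt i j s *+ 'C(m.-1, m - s).

Definition qdet_coef (m : nat) : yangian :=
  \sum_(a < m.+1) (yt 0 0 a * yt_shift 1 1 (m - a)
                   - yt 1 0 a * yt_shift 0 1 (m - a)).

Definition trace_coef (C : 'M[K]_2) (m : nat) : yangian :=
  \sum_i \sum_j C i j *: yt j i m.

Definition bethe (C : 'M[K]_2) : set yangian :=
  subalgebra_gen (range qdet_coef `|` range (trace_coef C)).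

End Yangian.

Section BlowUp.
Variable K : fieldType.

Definition proj_mat : kspace K := proj_space ('M[K]_2).

Definition punctured : kspace K :=
  ksubspace [set x : proj_mat | sval x <> lspan [set 1%:M]].

(* Linear coordinates on Mat_2 generating the homogeneous ideal of [I]. *)
Definition off_scalar (C : 'M[K]_2) : 'rV[K]_3 :=
  \row_(i < 3) [:: C 0 1; C 1 0; C 0 0 - C 1 1]`_i.

(* The blow-up of P(Mat_2) at [I]: the subvariety of P(Mat_2) * P^2 given by
   the equations x_i y_j = x_j y_i, where x = off_scalar and the y_i are the
   homogeneous coordinates of P^2. *)
Definition blowup : kspace K :=
  ksubspace [set p : kprod proj_mat (proj_space 'rV[K]_3) |
    forall (C : 'M[K]_2) (y : 'rV[K]_3), sval p.1 C -> sval p.2 y ->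
    forall i j, off_scalar C 0 i * y 0 j = off_scalar C 0 j * y 0 i].

Definition blowdown (b : blowup) : proj_mat := (sval b).1.

End BlowUp.

(* Main.v *)
(* Write E(y) for [offmat y].  If C = c I + l E(y) with l <> 0, then B(C) is
   generated by the coefficients of qdet T(u), by tr E(y) T^(1) and by the
   tr C T^(r), r >= 2.  These generators make sense for every point (C, y) of the
   blow-up, and commute.  Their ordered monomials have linearly independent
   symbols: symbols are evaluated through representations of Y(gl_2) on chains
   of oscillators, whose classical limits approximate to any order every series
   T(u) = 1 + O(1/u), and on such series the symbols of the generators take
   arbitrary values.  Hence the monomials of weight <= N form a basis of
   B(C, y) /\ F^N, regular in (C, y), and the family extends to the blow-up.
   The line of y is recovered from B(C, y) /\ F^1 and that of C from
   B(C, y) /\ F^2.  At a point z of the closure, closed conditions force z_1 and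
   z_2 to come from some (C, y); near z both lines have regular generators, so
   that z_N contains the monomials for (C, y) and equals their span. *)
From HB Require Import structures.
Require Import Defs.
From mathcomp Require Import all_boot all_order all_algebra.
From mathcomp Require Import all_classical all_reals.
From mathcomp Require Import complex ring.
From mathcomp Require Import -(notations) monalg.
From Stdlib Require Ncring Ncring_tac.

Set Implicit Arguments.
Unset Strict Implicit.
Unset Printing Implicit Defensive.

Import GRing.Theory Num.Theory.
Local Open Scope classical_set_scope.
Local Open Scope ring_scope.

(** * Linear algebra *)

Section LinearAlgebra.
Variables (K : fieldType) (V : lmodType K).
Implicit Types (S W : set V).

(** The blow-up appears because [qdet t 1] equals tr T^(1). In degree 1 only the class of C modulo
    scalars is therefore visible beyond qdet, it vanishes at [I], and what survives in a limit is
    the direction y of approach. In degree 2 the line of C is visible itself, at [I] too, so that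
    nothing beyond the pair (C, y) has to be recorded. F^N is given by spanning words, without a
    basis. Both the independence of monomials and the fact that an element of F^N involves no
    monomial of weight above N are therefore detected by symbols. The delicate points are those with
    C scalar: there qdet T^(r) and tr C T^(r), r >= 2, have proportional linear parts, and only the
    quadratic terms of the determinant separate them. Algebraic closedness serves to solve the
    resulting quadratic equation, and to factor polynomials into oscillator sites. The words of the
    monomials are the same at all points, which gives d_N. At a limit point one inclusion then
    suffices, and inclusions pass to limits because membership in the span of regular vectors is a
    closed condition where these vectors are free. *)

Definition subspace S := S 0 /\ forall a x y, S x -> S y -> S (a *: x + y).

Lemma submod_closedP S : GRing.submod_closed (mem S) <-> subspace S.
Proof.
split=> -[S0 SD]; split.
- by rewrite inE in S0.
- by move=> a x y Sx Sy; have := SD a x y; rewrite !inE; apply.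
- by rewrite inE.
- by move=> a x y; rewrite !inE; apply: SD.
Qed.

Lemma subspaceZ S a x : subspace S -> S x -> S (a *: x).
Proof. by case=> S0 SD Sx; rewrite -[_ *: _]addr0; apply: SD. Qed.

Lemma subspaceD S x y : subspace S -> S x -> S y -> S (x + y).
Proof. by case=> S0 SD Sx Sy; rewrite -[x]scale1r; apply: SD. Qed.

Lemma subspaceN S x : subspace S -> S x -> S (- x).
Proof. by move=> sS Sx; rewrite -scaleN1r; apply: subspaceZ. Qed.

Lemma subspaceB S x y : subspace S -> S x -> S y -> S (x - y).
Proof. by move=> sS Sx Sy; apply: subspaceD => //; apply: subspaceN. Qed.

Lemma subspace_sum S (I : Type) (r : seq I) (P : pred I) (F : I -> V) :
  subspace S -> (forall i, P i -> S (F i)) -> S (\sum_(i <- r | P i) F i).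
Proof.
move=> sS SF; apply: (big_ind S) => //; first by case: sS.
by move=> x y; apply: subspaceD.
Qed.

Lemma lspan_subspace S : subspace (lspan S).
Proof.
split=> [|a x y Sx Sy] M [/[dup] MM /submod_closedP[M0 MD] SM] //.
by apply: MD; [exact: (Sx M (conj MM SM))|exact: (Sy M (conj MM SM))].
Qed.

Lemma sub_lspan S : S `<=` lspan S.
Proof. exact: sub_gen_smallest. Qed.

Lemma mem_lspan S x : S x -> lspan S x.
Proof. exact: sub_lspan. Qed.

Lemma mem_lspan_range d (v : 'I_d -> V) i : lspan (range v) (v i).
Proof. by apply: mem_lspan; exists i. Qed.

Lemma lspan_min S W : subspace W -> S `<=` W -> lspan S `<=` W.
Proof. by move=> /submod_closedP sW SW; apply: smallest_sub. Qed.

Lemma lspanS S W : S `<=` W -> lspan S `<=` lspan W.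
Proof.
move=> SW; apply: (lspan_min (lspan_subspace W)).
exact: subset_trans SW (@sub_lspan W).
Qed.

Lemma lspan_rangeE d (v : 'I_d -> V) :
  lspan (range v) = [set x | exists c : 'I_d -> K, x = \sum_i c i *: v i].
Proof.
apply/seteqP; split.
- apply: lspan_min.
    split=> [|a _ _ [c ->] [e ->]].
      by exists (fun=> 0); rewrite big1 // => i _; rewrite scale0r.
    exists (fun i => a * c i + e i); rewrite scaler_sumr -big_split /=.
    by apply: eq_bigr => i _; rewrite scalerDl scalerA.
  move=> _ [i _ <-]; exists (fun j => (j == i)%:R).
  by rewrite (bigD1 i) //= eqxx scale1r big1 ?addr0 // => j /negPf->; rewrite scale0r.
- have sL := lspan_subspace (range v).
  move=> _ [c ->]; apply: (subspace_sum _ sL) => i _; apply: (subspaceZ _ sL).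
  exact: mem_lspan_range.
Qed.

(** [V] may be infinite-dimensional, so Zorn's lemma is used: a subspace maximal among those that
    contain [S] and avoid [v] is a complement of the line of [v], and [l] is the coordinate along
    that line. *)
Lemma separating_functional S v : subspace S -> ~ S v ->
  exists l : {scalar V}, l v = 1 /\ forall w, S w -> l w = 0.
Proof.
move=> sS Sv.
pose P X := X = set0 \/ [/\ subspace X, S `<=` X & ~ X v].
have [|H [PH maxH]] := @Zorn_bigcup V P.
  move=> F FP totF.
  have [[X0 FX0 [x0 X0x0]]|noX] := pselect (exists2 X, F X & X !=set0); last first.
    left; apply/seteqP; split=> // x [X FX Xx]; case: noX; exists X => //.
    by exists x.
  have PX X : F X -> X !=set0 -> [/\ subspace X, S `<=` X & ~ X v].
    by move=> /FP[->|//] [].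
  right; split.
  - have [[z _] _ _] := PX _ FX0 (ex_intro _ _ X0x0).
    split; first by exists X0.
    move=> a x y [X FX Xx] [Y FY Yy].
    have [[_ XD] _ _] := PX _ FX (ex_intro _ _ Xx).
    have [[_ YD] _ _] := PX _ FY (ex_intro _ _ Yy).
    have [XY|YX] := totF _ _ FX FY.
      by exists Y => //; exact: (YD a x y (XY x Xx) Yy).
    by exists X => //; exact: (XD a x y Xx (YX y Yy)).
  - move=> s Ss; exists X0 => //.
    by have [_ + _] := PX _ FX0 (ex_intro _ _ X0x0); apply.
  - by move=> [X FX Xv]; have [_ _] := PX _ FX (ex_intro _ _ Xv); apply.
have {PH} [sH SH Hv] : [/\ subspace H, S `<=` H & ~ H v].
  case: PH => // H0; case: (maxH S); last by right; split.
  rewrite H0; split; first by [].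
  by move=> S0; case: sS => /S0.
(* If [x] is not in [H], the larger subspace H + K x contains [v] by maximality; solving for [x]
   puts it in H + K v. *)
have Hdec x : exists a : K, H (x - a *: v).
  have [Hx|nHx] := pselect (H x); first by exists 0; rewrite scale0r subr0.
  pose H' := [set y | exists b, H (y - b *: x)].
  have sH' : subspace H'.
    split; first by exists 0; rewrite scale0r subr0; case: sH.
    move=> a y z [b Hy] [c Hz]; exists (a * b + c).
    rewrite scalerDl opprD addrACA -scalerA -scalerBr; apply: subspaceD => //.
    exact: subspaceZ.
  have HH' : H `<=` H' by move=> y Hy; exists 0; rewrite scale0r subr0.
  have [[b Hb]|nH'v] := pselect (H' v).
    have b0 : b != 0 by apply/eqP => b0; move: Hb; rewrite b0 scale0r subr0.
    exists b^-1; rewrite -[x - _]opprK opprB; apply: subspaceN => //.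
    rewrite -[x](scalerK b0) -scalerBr.
    exact: subspaceZ.
  case: (maxH H').
    split=> // H'H; apply: nHx; apply: H'H; exists 1.
    by rewrite scale1r subrr; case: sH.
  by right; split=> //; apply: subset_trans SH HH'.
pose f x : K := projT1 (cid (Hdec x)).
have fP x : H (x - f x *: v) by rewrite /f; case: cid.
have f_uniq x a : H (x - a *: v) -> f x = a.
  move=> Ha; apply/eqP; rewrite -subr_eq0; apply/negPn/negP => na; apply: Hv.
  rewrite -[v](scalerK na) scalerBl; apply: subspaceZ => //.
  have -> : f x *: v - a *: v = (x - a *: v) - (x - f x *: v).
    by rewrite opprB [RHS]addrC addrA subrK.
  exact: subspaceB.
have f_lin : scalar f.
  move=> a x y; apply: f_uniq.
  rewrite scalerDl opprD addrACA -scalerA -scalerBr.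
  by apply: subspaceD => //; apply: subspaceZ.
pose F := GRing.isLinear.Build K V K *%R f f_lin.
pose l : {scalar V} := HB.pack f F.
exists l; split.
  by apply: f_uniq; rewrite scale1r subrr; case: sH.
by move=> w /SH Hw; apply: f_uniq; rewrite scale0r subr0.
Qed.

Definition lindep_free d (v : 'I_d -> V) :=
  forall c : 'I_d -> K, \sum_i c i *: v i = 0 -> forall i, c i = 0.

(** Separate [v i] from the sum of [Q] and the span of the other [v j]. The vanishing on [Q] is what
    isolates a line in [line_near]. *)
Lemma dual_frame_mod (Q : set V) d (v : 'I_d -> V) : subspace Q ->
  (forall c : 'I_d -> K, Q (\sum_i c i *: v i) -> forall i, c i = 0) ->
  exists l : 'I_d -> {scalar V},
    (forall i q, Q q -> l i q = 0) /\ forall i j, l i (v j) = (i == j)%:R.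
Proof.
move=> sQ vfree.
pose W i := [set x | exists2 c : 'I_d -> K, c i = 0 & Q (x - \sum_j c j *: v j)].
have Q0 : Q 0 by case: sQ.
have sW i : subspace (W i).
  split=> [|a x y [c c0 Qx] [e e0 Qy]].
    by exists (fun=> 0) => //; rewrite big1 ?subrr // => j _; rewrite scale0r.
  exists (fun j => a * c j + e j); first by rewrite c0 e0 mulr0 addr0.
  under eq_bigr do rewrite scalerDl -scalerA.
  rewrite big_split -scaler_sumr opprD addrACA -scalerBr.
  by case: sQ => _; apply.
have vE i : v i = \sum_j (j == i)%:R *: v j.
  by rewrite (bigD1 i) //= eqxx scale1r big1 ?addr0 // => j /negPf->; rewrite scale0r.
have Wv i : ~ W i (v i).
  move=> [c ci vi]; have := vfree (fun j => (j == i)%:R - c j).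
  under eq_bigr do rewrite scalerBl.
  rewrite sumrB -vE => /(_ vi i) /eqP.
  by rewrite eqxx ci subr0 oner_eq0.
have /choice[l lP] : forall i, exists l : {scalar V},
    l (v i) = 1 /\ forall w, W i w -> l w = 0.
  by move=> i; apply: separating_functional (sW i) (Wv i).
exists l; split=> [i q Qq|i j].
  have [_ ->//] := lP i; exists (fun=> 0) => //.
  by rewrite big1 ?subr0 // => k _; rewrite scale0r.
have [<-|ij] := eqVneq i j; first by case: (lP i).
have [_ ->//] := lP i; exists (fun k => (k == j)%:R); first by rewrite (negPf ij).
by rewrite -vE subrr.
Qed.

Lemma dual_frame d (v : 'I_d -> V) : lindep_free v ->
  exists l : 'I_d -> {scalar V}, forall i j, l i (v j) = (i == j)%:R.
Proof.
move=> vfree.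
have [||l [_ lv]] := @dual_frame_mod [set 0] _ v.
- by split=> // a _ _ -> ->; rewrite scaler0 addr0.
- by move=> c; apply: vfree.
by exists l.
Qed.

Lemma free_span_le d e (v : 'I_d -> V) (w : 'I_e -> V) : lindep_free v ->
  (forall i, lspan (range w) (v i)) -> (d <= e)%N.
Proof.
move=> vfree vw.
have /choice[c cP] : forall i, exists c : 'I_e -> K, v i = \sum_j c j *: w j.
  by move=> i; have := vw i; rewrite lspan_rangeE.
pose C := \matrix_(i < d, j < e) c i j.
have [//|ed] := leqP d e.
have rk : (\rank C < d)%N by apply: leq_ltn_trans (rank_leq_col _) ed.
have : kermx C != 0 by rewrite kermx_eq0 -row_leq_rank -ltnNge.
case/rowV0Pn => u /sub_kermxP uC u0.
have /rV0Pn[i ui] := u0; case/eqP: ui; apply: (vfree (u 0)).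
under eq_bigr do rewrite cP scaler_sumr.
rewrite exchange_big big1 // => j _ /=.
under eq_bigr do rewrite scalerA.
rewrite -scaler_suml.
have := congr1 (fun M : 'rV_e => M 0 j) uC; rewrite !mxE.
under eq_bigr do rewrite mxE.
by move=> ->; rewrite scale0r.
Qed.

Lemma free_span_full d (v w : 'I_d -> V) : lindep_free v ->
  (forall i, lspan (range w) (v i)) -> lspan (range v) = lspan (range w).
Proof.
move=> vfree vw; apply/seteqP; split.
  by apply: (lspan_min (lspan_subspace _)) => _ [i _ <-].
apply: (lspan_min (lspan_subspace _)) => _ [j _ <-].
apply: contrapT => nwj.
pose v' (i : 'I_d.+1) := oapp v (w j) (unlift ord0 i).
suff : (d.+1 <= d)%N by rewrite ltnn.
apply: (@free_span_le _ _ v' w) => [c|i]; last first.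
  by rewrite /v'; case: unliftP => [k _|_] //=; exact: mem_lspan_range.
rewrite big_ord_recl /v' unlift_none /=.
under eq_bigr do rewrite liftK /=.
have [c0|c0 Ec] := eqVneq (c ord0) 0.
  rewrite c0 scale0r add0r => /vfree cv i.
  by case: (unliftP ord0 i) => [k|] ->.
case: nwj; rewrite -[w j](scalerK c0).
have sL := lspan_subspace (range v).
apply: (subspaceZ _ sL); move/eqP: Ec; rewrite addr_eq0 => /eqP->.
apply: (subspaceN sL); apply: (subspace_sum _ sL) => i _; apply: (subspaceZ _ sL).
exact: mem_lspan_range.
Qed.

Lemma free_sub_span d (W : set V) (v w : 'I_d -> V) : lindep_free v ->
  W = lspan (range w) -> (forall i, W (v i)) -> W = lspan (range v).
Proof. by move=> vfree -> vw; rewrite (free_span_full vfree vw). Qed.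

Lemma dual_coord d (l : 'I_d -> {scalar V}) (v : 'I_d -> V) x :
  (forall i j, l i (v j) = (i == j)%:R) -> lspan (range v) x ->
  x = \sum_i l i x *: v i.
Proof.
move=> lv; rewrite lspan_rangeE => -[c ->]; apply: eq_bigr => i _.
rewrite linear_sum (bigD1 i) //= linearZ /= lv eqxx mulr1 big1 ?addr0 // => j ji.
by rewrite linearZ /= lv eq_sym (negPf ji) mulr0.
Qed.

Lemma dual_free d (l : 'I_d -> {scalar V}) (v : 'I_d -> V) :
  (forall i j, l i (v j) = (i == j)%:R) -> lindep_free v.
Proof.
move=> lv c c0 i; have := congr1 (l i) c0; rewrite linear0 linear_sum.
rewrite (bigD1 i) //= linearZ /= lv eqxx mulr1 big1 ?addr0 // => j ji.
by rewrite linearZ /= lv eq_sym (negPf ji) mulr0.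
Qed.

End LinearAlgebra.

Lemma ex_scalar (K : fieldType) (V : lmodType K) (f : V -> K) :
  scalar f -> exists l : {scalar V}, forall x, l x = f x.
Proof.
move=> f_lin; pose F := GRing.isLinear.Build K V K *%R f f_lin.
by pose l : {scalar V} := HB.pack f F; exists l.
Qed.

Lemma ex_linear (K : fieldType) (V V' : lmodType K) (f : V -> V') :
  linear f -> exists g : {linear V -> V'}, forall x, g x = f x.
Proof.
move=> f_lin; pose F := GRing.isLinear.Build K V V' *:%R f f_lin.
by pose g : {linear V -> V'} := HB.pack f F; exists g.
Qed.

Lemma lspan1P (K : fieldType) (V : lmodType K) (v x : V) :
  lspan [set v] x <-> exists a, x = a *: v.
Proof.
split=> [|[a ->]]; last by apply: (subspaceZ _ (lspan_subspace _)); apply: mem_lspan.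
apply: (@lspan_min _ _ _ [set x | exists a, x = a *: v]).
  split=> [|b _ _ [a ->] [c ->]]; first by exists 0; rewrite scale0r.
  by exists (b * a + c); rewrite scalerDl scalerA.
by move=> _ ->; exists 1; rewrite scale1r.
Qed.

Lemma lspan_full_sub (K : fieldType) (V : lmodType K) d (W : set V) (v w : 'I_d -> V) :
  lindep_free v -> lspan (range v) `<=` W -> W = lspan (range w) -> W = lspan (range v).
Proof.
move=> vfree vW Ww; apply: (free_sub_span vfree Ww) => i.
have vi : lspan (range v) (v i) by apply: mem_lspan_range.
exact: (vW _ vi).
Qed.

(** * Spaces with functions *)

Section GoodSpaces.
Variable K : fieldType.
Implicit Types X Y Z : kspace K.

(* The sheaf axioms of a space with functions, not imposed by [kspace]. *)
Record good X : Prop := Good {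
  good_openT : @kopen K X setT;
  good_openI : forall U V : set X, kopen U -> kopen V -> kopen (U `&` V);
  good_openL : forall W : set X,
    (forall x, W x -> exists U, [/\ kopen U, U x & U `<=` W]) -> kopen W;
  good_regL : forall (W : set X) (f : X -> K), kopen W ->
    (forall x, W x -> exists U g,
      [/\ kopen U, U x, kreg U g & forall y, U y -> W y -> f y = g y]) ->
    kreg W f;
  good_cst : forall (U : set X) c, kopen U -> kreg U (fun=> c);
  good_add : forall (U : set X) f g, kopen U ->
    kreg U f -> kreg U g -> kreg U (fun x => f x + g x);
  good_mul : forall (U : set X) f g, kopen U ->
    kreg U f -> kreg U g -> kreg U (fun x => f x * g x);
  good_nz : forall (U : set X) f, kopen U ->
    kreg U f -> kopen [set x | U x /\ f x != 0];
  good_inv : forall (U : set X) f, kopen U ->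
    kreg U f -> (forall x, U x -> f x != 0) -> kreg U (fun x => (f x)^-1) }.

Section Basic.
Variables (X : kspace K) (gX : good X).
Implicit Types U V : set X.

Lemma good_sub U V f : kopen V -> kopen U -> V `<=` U -> kreg U f -> kreg V f.
Proof.
move=> oV oU VU fU; apply: good_regL => // x Vx; exists U, f.
by split=> //; apply: VU.
Qed.

Lemma good_ext U f g : kopen U -> (forall x, U x -> f x = g x) ->
  kreg U f -> kreg U g.
Proof.
move=> oU fg fU; apply: good_regL => // x Ux; exists U, f.
by split=> // y Uy _; rewrite fg.
Qed.

Lemma good_sum U (I : Type) (r : seq I) (P : pred I) (F : I -> X -> K) :
  kopen U -> (forall i, P i -> kreg U (F i)) ->
  kreg U (fun x => \sum_(i <- r | P i) F i x).
Proof.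
move=> oU FU; elim: r => [|i r IH].
  by apply: good_ext (good_cst gX 0 oU) => // x _; rewrite big_nil.
have [Pi|nPi] := boolP (P i); last first.
  by apply: good_ext IH => // x _; rewrite big_cons (negPf nPi).
by apply: good_ext (good_add gX oU (FU i Pi) IH) => // x _; rewrite big_cons Pi.
Qed.

Lemma good_prod U (I : Type) (r : seq I) (P : pred I) (F : I -> X -> K) :
  kopen U -> (forall i, P i -> kreg U (F i)) ->
  kreg U (fun x => \prod_(i <- r | P i) F i x).
Proof.
move=> oU FU; elim: r => [|i r IH].
  by apply: good_ext (good_cst gX 1 oU) => // x _; rewrite big_nil.
have [Pi|nPi] := boolP (P i); last first.
  by apply: good_ext IH => // x _; rewrite big_cons (negPf nPi).
by apply: good_ext (good_mul gX oU (FU i Pi) IH) => // x _; rewrite big_cons Pi.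
Qed.

Lemma good_det U n (F : X -> 'M[K]_n) : kopen U ->
  (forall i j, kreg U (fun x => F x i j)) -> kreg U (fun x => \det (F x)).
Proof.
move=> oU FU; apply: good_sum => // s _; apply: (good_mul gX) => //.
  exact: good_cst.
by apply: good_prod => // i _.
Qed.

Lemma good_adj U n (F : X -> 'M[K]_n) i j : kopen U ->
  (forall i j, kreg U (fun x => F x i j)) ->
  kreg U (fun x => (\adj (F x)) i j).
Proof.
move=> oU FU.
apply: (@good_ext U (fun x => cofactor (F x) j i)) => // [x _|].
  by rewrite mxE.
apply: (good_mul gX) => //; first exact: good_cst.
apply: good_det => // a b.
by apply: good_ext (FU (lift j a) (lift i b)) => // x _; rewrite !mxE.
Qed.

Lemma good_polyfun U (T : Type) (G : set (T -> K)) (f : X -> T) p :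
  kopen U -> (forall g, G g -> kreg U (g \o f)) -> polyfun G p ->
  kreg U (p \o f).
Proof.
move=> oU GU; elim=> [g /GU//|c|g h _ IHg _ IHh|g h _ IHg _ IHh].
- exact: good_cst.
- exact: good_add.
- exact: good_mul.
Qed.

Lemma good_bigI (I : choiceType) (U : I -> set X) : (forall i, kopen (U i)) ->
  finite_set [set i | U i <> setT] -> kopen [set x | forall i, U i x].
Proof.
move=> oU /finite_seqP[s sE].
have -> : [set x | forall i, U i x] = [set x | forall i, i \in s -> U i x].
  apply/seteqP; split=> x Ux i //; have [|nis] := boolP (i \in s); first exact: Ux.
  have [Ui|Ui] := pselect (U i = setT); first by rewrite Ui.
  have : [set i | U i <> setT] i by [].
  by rewrite sE /= (negPf nis).
elim: s {sE} => [|i s IH].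
  rewrite (_ : [set _ | _] = setT); first exact: good_openT.
  by apply/seteqP; split.
rewrite (_ : [set _ | _] = U i `&` [set x | forall i, i \in s -> U i x]).
  exact: good_openI.
apply/seteqP; split=> x.
  move=> Ux; split; first by apply: Ux; rewrite mem_head.
  by move=> j js; apply: Ux; rewrite inE js orbT.
by move=> [Uix Ux] j; rewrite inE => /orP[/eqP->//|/Ux].
Qed.

End Basic.

(** The recurring device is to multiply by a function whose non-vanishing locus lies in a given open
    set: this cuts a local formula down to where it is valid. *)
Lemma good_quasi_affine (T : Type) (G : set (T -> K)) : good (quasi_affine G).
Proof.
split.
- by move=> x _; exists (fun=> 1); split=> //; [exact: polyfun_cst|exact: oner_neq0].
- move=> U V oU oV x [/oU[p [Gp px pU]] /oV[q [Gq qx qV]]].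
  exists (fun y => p y * q y); split; [exact: polyfun_mul|exact: mulf_neq0|].
  by move=> y; rewrite mulf_eq0 negb_or => /andP[/pU ? /qV].
- move=> W WL x /WL[U [oU Ux UW]]; have [p [Gp px pU]] := oU _ Ux.
  by exists p; split=> // y /pU /UW.
- move=> W f oW fL x Wx; have [U [g [oU Ux gU fg]]] := fL x Wx.
  have [r [Gr rx rU]] := oU _ Ux.
  have [p [q [Gp Gq qx gpq]]] := gU _ Ux.
  exists (fun y => p y * r y), (fun y => q y * r y).
  split; [exact: polyfun_mul|exact: polyfun_mul|exact: mulf_neq0|].
  move=> y Wy; rewrite mulf_eq0 negb_or => /andP[qy ry].
  by rewrite fg ?gpq //; do ?exact: rU; rewrite -mulf_div divff ?mulr1.
- move=> U c oU x Ux; exists (fun=> c), (fun=> 1).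
  split; [exact: polyfun_cst|exact: polyfun_cst|exact: oner_neq0|].
  by move=> y _ _; rewrite divr1.
- move=> U f g oU fU gU x Ux; have [p [q [Gp Gq qx fpq]]] := fU _ Ux.
  have [p' [q' [Gp' Gq' qx' gpq]]] := gU _ Ux.
  exists (fun y => p y * q' y + p' y * q y), (fun y => q y * q' y).
  split; [|exact: polyfun_mul|exact: mulf_neq0|].
    by apply: (polyfun_add (f := fun y => p y * q' y)); apply: polyfun_mul.
  move=> y Uy; rewrite mulf_eq0 negb_or => /andP[qy ry].
  by rewrite fpq // gpq // addf_div.
- move=> U f g oU fU gU x Ux; have [p [q [Gp Gq qx fpq]]] := fU _ Ux.
  have [p' [q' [Gp' Gq' qx' gpq]]] := gU _ Ux.
  exists (fun y => p y * p' y), (fun y => q y * q' y).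
  split; [exact: polyfun_mul|exact: polyfun_mul|exact: mulf_neq0|].
  move=> y Uy; rewrite mulf_eq0 negb_or => /andP[qy ry].
  by rewrite fpq // gpq // mulf_div.
- move=> U f oU fU x [Ux fx]; have [p [q [Gp Gq qx fpq]]] := fU _ Ux.
  have [r [Gr rx rU]] := oU _ Ux.
  exists (fun y => p y * q y * r y); split.
  + by apply: (polyfun_mul (f := fun y => p y * q y)) => //; apply: polyfun_mul.
  + rewrite !mulf_neq0 //; apply: contra fx => /eqP px.
    by rewrite fpq // px mul0r.
  + move=> y; rewrite !mulf_eq0 !negb_or => /andP[/andP[py qy] ry].
    split; first exact: rU.
    by rewrite fpq ?mulf_neq0 ?invr_eq0 //; apply: rU.
- move=> U f oU fU f0 x Ux; have [p [q [Gp Gq qx fpq]]] := fU _ Ux.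
  exists (fun y => q y * q y), (fun y => p y * q y).
  split; [exact: polyfun_mul|exact: polyfun_mul| |].
    rewrite mulf_neq0 //; apply: contra (f0 _ Ux) => /eqP px.
    by rewrite fpq // px mul0r.
  move=> y Uy; rewrite mulf_eq0 negb_or => /andP[py qy].
  by rewrite fpq // invf_div -mulf_div divff ?mulr1.
Qed.

Lemma good_quotient X (T : Type) (q : X -> T) : good X -> good (kquotient q).
Proof.
move=> gX; split.
- exact: (good_openT gX).
- by move=> U V oU oV; apply: (good_openI gX).
- move=> W WL; apply: (good_openL gX) => x /WL[U [oU Ux UW]].
  by exists (q @^-1` U); split=> // y; apply: UW.
- move=> W f oW fL; apply: (good_regL gX) => // x /fL[U [g [oU Ux gU fg]]].
  by exists (q @^-1` U), (g \o q); split=> // y Uy Wy; apply: fg.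
- by move=> U c oU; apply: (good_cst gX).
- by move=> U f g oU fU gU; apply: (good_add gX).
- by move=> U f g oU fU gU; apply: (good_mul gX).
- by move=> U f oU fU; apply: (good_nz gX).
- by move=> U f oU fU f0; apply: (good_inv gX) => // x; apply: f0.
Qed.

Section Initial.
Variables (T : Type) (I : choiceType) (X : I -> kspace K) (pr : forall i, T -> X i).
Hypothesis gX : forall i, good (X i).
Let Y := kinitial pr.

Let boxI (U V : forall i, set (X i)) := fun i => U i `&` V i.

Let is_kboxI (U V : forall i, set (X i)) :
  is_kbox U -> is_kbox V -> is_kbox (boxI U V).
Proof.
move=> [oU fU] [oV fV]; split.
  by move=> i; exact: (good_openI (gX i) (oU i) (oV i)).
apply: (sub_finite_set (B := [set i | U i <> setT] `|` [set i | V i <> setT])).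
  move=> i /= UV; have [Ui|] := pselect (U i = setT); last by left.
  by right=> Vi; apply: UV; rewrite /boxI Ui Vi setIT.
by rewrite finite_setU.
Qed.

Let kbox_funI (U V : forall i, set (X i)) p :
  is_kbox U -> is_kbox V -> kbox_fun pr U p -> kbox_fun pr (boxI U V) p.
Proof.
move=> [oU _] [oV _]; elim=> [_ [i [g [gU ->]]]|c|g h _ ? _ ?|g h _ ? _ ?].
- apply: polyfun_gen; exists i, g; split=> //.
  by apply: (good_sub (gX i) _ (oU i)) gU; [exact: (good_openI (gX i) (oU i) (oV i))|by move=> ? []].
- exact: polyfun_cst.
- exact: polyfun_add.
- exact: polyfun_mul.
Qed.

Let boxIC (U V : forall i, set (X i)) : boxI U V = boxI V U.
Proof. by apply: functional_extensionality_dep => i; rewrite /boxI setIC. Qed.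

Let kbox_funIr (U V : forall i, set (X i)) p :
  is_kbox U -> is_kbox V -> kbox_fun pr V p -> kbox_fun pr (boxI U V) p.
Proof. by move=> bU bV pV; rewrite boxIC; apply: kbox_funI. Qed.

Let kboxI (U V : forall i, set (X i)) t :
  kbox pr (boxI U V) t <-> kbox pr U t /\ kbox pr V t.
Proof.
split=> [UV|[Ut Vt] i]; last by split; [exact: Ut|exact: Vt].
by split=> i; case: (UV i).
Qed.

Let is_kboxT : is_kbox (fun i => [set: X i]).
Proof.
split; first by move=> i; apply: (good_openT (gX i)).
by rewrite (_ : [set _ | _] = set0) //; apply/seteqP; split=> i //=; apply.
Qed.

Lemma good_initial : good Y.
Proof.
split.
- move=> t _; exists (fun i => [set: X i]), (fun=> 1).
  by split=> //; [exact: polyfun_cst|exact: oner_neq0].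
- move=> U V oU oV t [/oU[A [p [bA At Ap pt pU]]] /oV[B [q [bB Bt Bq qt qV]]]].
  exists (boxI A B), (fun y => p y * q y); split.
  + exact: is_kboxI.
  + by apply/kboxI.
  + by apply: polyfun_mul; [exact: kbox_funI|exact: kbox_funIr].
  + exact: mulf_neq0.
  + move=> y /kboxI[Ay By]; rewrite mulf_eq0 negb_or => /andP[py qy].
    by split; [exact: pU|exact: qV].
- move=> W WL t /WL[U [oU Ut UW]]; have [A [p [bA At Ap pt pU]]] := oU _ Ut.
  by exists A, p; split=> // y Ay py; apply/UW/pU.
- move=> W f oW fL t Wt; have [U [g [oU Ut gU fg]]] := fL t Wt.
  have [A [r [bA At Ar rt rU]]] := oU _ Ut.
  have [B [p [q [[bB Bt] Bp Bq qt gpq]]]] := gU _ Ut.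
  exists (boxI A B), (fun y => p y * r y), (fun y => q y * r y); split.
  + by split; [exact: is_kboxI|apply/kboxI].
  + by apply: polyfun_mul; [exact: kbox_funIr|exact: kbox_funI].
  + by apply: polyfun_mul; [exact: kbox_funIr|exact: kbox_funI].
  + exact: mulf_neq0.
  + move=> y Wy /kboxI[Ay By]; rewrite mulf_eq0 negb_or => /andP[qy ry].
    have Uy : U y by exact: rU.
    by rewrite fg // gpq // -mulf_div divff ?mulr1.
- move=> U c oU t Ut; exists (fun i => [set: X i]), (fun=> c), (fun=> 1).
  split=> //; [exact: polyfun_cst|exact: polyfun_cst|exact: oner_neq0|].
  by move=> y _ _ _; rewrite divr1.
- move=> U f g oU fU gU t Ut.
  have [A [p [q [[bA At] Ap Aq qt fpq]]]] := fU _ Ut.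
  have [B [p' [q' [[bB Bt] Bp Bq qt' gpq]]]] := gU _ Ut.
  exists (boxI A B), (fun y => p y * q' y + p' y * q y), (fun y => q y * q' y).
  have ? := kbox_funI bA bB Ap; have ? := kbox_funI bA bB Aq.
  have ? := kbox_funIr bA bB Bp; have ? := kbox_funIr bA bB Bq.
  split.
  + by split; [exact: is_kboxI|apply/kboxI].
  + by apply: (polyfun_add (f := fun y => p y * q' y)); apply: polyfun_mul.
  + exact: polyfun_mul.
  + exact: mulf_neq0.
  + move=> y Uy /kboxI[Ay By]; rewrite mulf_eq0 negb_or => /andP[qy ry].
    by rewrite fpq // gpq // addf_div.
- move=> U f g oU fU gU t Ut.
  have [A [p [q [[bA At] Ap Aq qt fpq]]]] := fU _ Ut.
  have [B [p' [q' [[bB Bt] Bp Bq qt' gpq]]]] := gU _ Ut.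
  exists (boxI A B), (fun y => p y * p' y), (fun y => q y * q' y).
  have ? := kbox_funI bA bB Ap; have ? := kbox_funI bA bB Aq.
  have ? := kbox_funIr bA bB Bp; have ? := kbox_funIr bA bB Bq.
  split.
  + by split; [exact: is_kboxI|apply/kboxI].
  + exact: polyfun_mul.
  + exact: polyfun_mul.
  + exact: mulf_neq0.
  + move=> y Uy /kboxI[Ay By]; rewrite mulf_eq0 negb_or => /andP[qy ry].
    by rewrite fpq // gpq // mulf_div.
- move=> U f oU fU t [Ut ft].
  have [A [p [q [[bA At] Ap Aq qt fpq]]]] := fU _ Ut.
  have [B [r [bB Bt Br rt rU]]] := oU _ Ut.
  exists (boxI A B), (fun y => p y * q y * r y).
  have ? := kbox_funI bA bB Ap; have ? := kbox_funI bA bB Aq.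
  have ? := kbox_funIr bA bB Br.
  split.
  + exact: is_kboxI.
  + by apply/kboxI.
  + by apply: (polyfun_mul (f := fun y => p y * q y)) => //; apply: polyfun_mul.
  + rewrite !mulf_neq0 //; apply: contra ft => /eqP px.
    by rewrite fpq // px mul0r.
  + move=> y /kboxI[Ay By]; rewrite !mulf_eq0 !negb_or => /andP[/andP[py qy] ry].
    split; first exact: rU.
    by rewrite fpq ?mulf_neq0 ?invr_eq0 //; apply: rU.
- move=> U f oU fU f0 t Ut.
  have [A [p [q [bA Ap Aq qt fpq]]]] := fU _ Ut.
  exists A, (fun y => q y * q y), (fun y => p y * q y).
  split; [exact: bA|exact: polyfun_mul|exact: polyfun_mul| |].
    rewrite mulf_neq0 //; apply: contra (f0 _ Ut) => /eqP px.
    by rewrite fpq ?px ?mul0r //; case: bA.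
  move=> y Uy Ay; rewrite mulf_eq0 negb_or => /andP[py qy].
  by rewrite fpq // invf_div -mulf_div divff ?mulr1.
Qed.

Lemma initial_pr_morphism i : kmorphism (fun t : Y => pr i t).
Proof.
move=> U oU.
(* The box with [U] in the factor [i] and the whole space in the others. The transport along [e]
   only serves typing and is trivial at [j = i]. *)
pose A j : set (X j) := [set x | forall e : j = i, U (eq_rect j (fun k => X k) x i e)].
have Ai : A i = U.
  by apply/seteqP; split=> x; [move=> /(_ erefl)|move=> Ux e; rewrite eq_axiomK].
have AT j : j <> i -> A j = setT.
  by move=> ji; apply/seteqP; split=> // x _ e; case: (ji e).
have bA : is_kbox A.
  split=> [j|].
    have [->|/eqP/AT->] := eqVneq j i; first by rewrite Ai.
    exact: (good_openT (gX j)).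
  apply: (sub_finite_set (B := [set i])) => // j /= Aj.
  by apply: contrapT => /AT.
have AU t : kbox pr A t <-> U (pr i t).
  split=> [/(_ i)|Ut j]; first by rewrite Ai.
  by have [->|/eqP/AT->] := eqVneq j i; rewrite ?Ai.
split.
  move=> t Ut; exists A, (fun=> 1).
  split=> //; [exact/AU|exact: polyfun_cst|exact: oner_neq0|].
  by move=> y /AU.
move=> g gU t Ut; exists A, (g \o pr i), (fun=> 1).
split=> //; [by split=> //; exact/AU| |exact: polyfun_cst|exact: oner_neq0|].
  by apply: polyfun_gen; exists i, g; rewrite Ai.
by move=> y _ _ _; rewrite divr1.
Qed.

(** The universal property of the initial structure. Boxes pull back to open sets because all but
    finitely many of their factors are the whole space. *)
Lemma initial_morphism Z (f : Z -> Y) : good Z ->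
  (forall i, kmorphism (fun z => pr i (f z))) -> kmorphism f.
Proof.
move=> gZ fi.
have obox A : is_kbox A -> kopen [set z | kbox pr A (f z)].
  move=> [oA fA]; apply: (good_bigI gZ (U := fun i => [set z | A i (pr i (f z))])).
    by move=> i; case: (fi i _ (oA i)).
  by apply: (sub_finite_set _ fA) => i /= + Ai; apply; rewrite Ai.
have rbox A p : is_kbox A -> kbox_fun pr A p ->
    kreg [set z | kbox pr A (f z)] (p \o f).
  move=> bA; apply: (good_polyfun gZ) => //; first exact: obox.
  move=> _ [i [g [gA ->]]].
  have [oA _] := bA; have [oi /(_ g gA) ri] := fi i _ (oA i).
  by apply: (good_sub gZ _ oi _ ri); [exact: obox|move=> z; apply].
move=> U oU; have oV : kopen (f @^-1` U).
  apply: (good_openL gZ) => z /oU[A [p [bA At Ap pt pU]]].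
  exists [set z | [set z | kbox pr A (f z)] z /\ (p \o f) z != 0].
  split=> //; first by apply: (good_nz gZ); [exact: obox|exact: rbox].
  by move=> y [Ay py]; apply: pU.
split=> // g gU; apply: (good_regL gZ) => // z Uz.
have [A [p [q [[bA At] Ap Aq qt gpq]]]] := gU _ Uz.
pose B := [set z | [set z | kbox pr A (f z)] z /\ (q \o f) z != 0].
have oA := obox _ bA.
have oB : kopen B by apply: (good_nz gZ) => //; exact: rbox.
have BA : B `<=` [set z | kbox pr A (f z)] by move=> y [].
exists B, (fun y => (p \o f) y * ((q \o f) y)^-1); split=> //.
  apply: (good_mul gZ) => //.
    exact: (good_sub gZ oB oA BA (rbox _ _ bA Ap)).
  apply: (good_inv gZ) => //; last by move=> y [].
  exact: (good_sub gZ oB oA BA (rbox _ _ bA Aq)).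
by move=> y [Ay qy] Uy; apply: gpq.
Qed.

End Initial.

Lemma kmorphism_comp X Y Z (f : X -> Y) (g : Y -> Z) :
  kmorphism f -> kmorphism g -> kmorphism (g \o f).
Proof.
move=> mf mg U oU; have [oV gV] := mg _ oU; have [oW fW] := mf _ oV.
by split=> // h hU; exact: (fW _ (gV _ hU)).
Qed.

Lemma good_subspace X (A : set X) : good X -> good (ksubspace A).
Proof. by move=> gX; apply: good_initial. Qed.

Lemma subspace_val_morphism X (A : set X) : good X ->
  kmorphism (fun x : ksubspace A => sval x).
Proof. by move=> gX; apply: (@initial_pr_morphism _ unit) tt. Qed.

Lemma subspace_morphism X Z (A : set X) (f : Z -> ksubspace A) :
  good Z -> kmorphism (fun z => sval (f z)) -> kmorphism f.
Proof. by move=> gZ fm; apply: initial_morphism. Qed.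

Lemma good_prodspace X Y : good X -> good Y -> good (kprod X Y).
Proof. by move=> gX gY; apply: good_initial => -[]. Qed.

Lemma fst_morphism X Y : good X -> good Y -> kmorphism (fun x : kprod X Y => x.1).
Proof.
move=> gX gY; apply: (@initial_pr_morphism _ bool (fun b => if b then X else Y) _ _ true).
by case.
Qed.

Lemma snd_morphism X Y : good X -> good Y -> kmorphism (fun x : kprod X Y => x.2).
Proof.
move=> gX gY; apply: (@initial_pr_morphism _ bool (fun b => if b then X else Y) _ _ false).
by case.
Qed.

Lemma prod_morphism X Y Z (f : Z -> kprod X Y) : good Z ->
  kmorphism (fun z => (f z).1) -> kmorphism (fun z => (f z).2) -> kmorphism f.
Proof. by move=> gZ f1 f2; apply: initial_morphism => // -[]. Qed.

Lemma good_pi (I : choiceType) (X : I -> kspace K) :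
  (forall i, good (X i)) -> good (kpi X).
Proof. exact: good_initial. Qed.

Lemma pi_proj_morphism (I : choiceType) (X : I -> kspace K) i :
  (forall i, good (X i)) -> kmorphism (fun x : kpi X => x i).
Proof. by move=> gX; apply: initial_pr_morphism. Qed.

Lemma pi_morphism (I : choiceType) (X : I -> kspace K) Z (f : Z -> kpi X) :
  good Z -> (forall i, kmorphism (fun z => f z i)) -> kmorphism f.
Proof. by move=> gZ fm; apply: initial_morphism. Qed.

End GoodSpaces.

(** * Morphisms to Grassmannians *)

Section Grassmannian.
Variable K : fieldType.
Implicit Types (X : kspace K) (V : lmodType K).

(** Regularity is tested against all functionals, so that no basis is chosen and [V] may be
    infinite-dimensional. Products in an algebra need a stronger form of regularity, see
    [reg_wordprod]. *)
Definition reg_vec X V (U : set X) (v : X -> V) :=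
  forall l : {scalar V}, kreg U (fun x => l (v x)).

Lemma good_frame_space V (E : set V) d : good (frame_space E d).
Proof. exact: good_quasi_affine. Qed.

Lemma good_grass V (E : set V) d : good (grass E d).
Proof. exact/good_quotient/good_frame_space. Qed.

Lemma subspace_pt_inj V (E : set V) d (W W' : subspace_pt E d) :
  sval W = sval W' -> W = W'.
Proof. by case: W W' => W p [W' p'] /= WW'; apply: eq_exist. Qed.

Lemma grass_frame V (E : set V) d (W : grass E d) :
  exists2 v : 'I_d -> V, frame E v & sval W = lspan (range v).
Proof. by case: W => W /= [v]; exists v. Qed.

(** Open sets and functions of the quotient are those of the frame space, so a map into it is a
    morphism once it lifts locally to regular frames. *)
Lemma grass_lift_morphism X V (E : set V) d (f : X -> grass E d) : good X ->
  (forall x0, exists U (v : 'I_d -> X -> V), [/\ kopen U, U x0,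
     forall x, U x -> frame E (v^~ x) /\ sval (f x) = lspan (range (v^~ x)) &
     forall i, reg_vec U (v i)]) -> kmorphism f.
Proof.
move=> gX lift.
have lift' x0 : exists U (g : X -> frame_space E d), [/\ kopen U, U x0,
    forall x, U x -> f x = frame_span (g x) &
    forall p, polyfun [set h | exists (l : {scalar V}) (i : 'I_d),
      h = fun v : {v : 'I_d -> V | frame E v} => l (sval v i)] p ->
      kreg U (p \o g)].
  have [U [v [oU Ux0 vf vreg]]] := lift x0.
  pose v0 : frame_space E d := exist (fun v : 'I_d -> V => frame E v) (v^~ x0) (vf _ Ux0).1.
  (* The lift has to be total; outside [U] it takes the irrelevant value [v0]. *)
  pose g x : frame_space E d := if pselect (U x) is left Ux
    then exist (fun v : 'I_d -> V => frame E v) (v^~ x) (vf _ Ux).1 else v0.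
  have gE x : U x -> sval (g x) = v^~ x.
    by move=> Ux; rewrite /g; case: pselect.
  exists U, g; split=> //.
    by move=> x Ux; apply: subspace_pt_inj; rewrite /= gE //; case: (vf x Ux).
  move=> p; apply: good_polyfun => // _ [l [i ->]].
  by apply: good_ext (vreg i l) => // x Ux /=; rewrite gE.
move=> O oO; have oV : kopen (f @^-1` O).
  apply: (good_openL gX) => x0 Ox0; have [U [g [oU Ux0 fg gp]]] := lift' x0.
  have [|p [Gp px pO]] := oO (g x0); first by rewrite /= -fg.
  exists [set x | U x /\ (p \o g) x != 0]; split=> //.
    by apply: (good_nz gX) => //; apply: gp.
  by move=> x [Ux px']; rewrite /= fg //; apply: pO.
split=> // h hO; apply: (good_regL gX) => // x0 Ox0.
have [U [g [oU Ux0 fg gp]]] := lift' x0.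
have [|p [q [Gp Gq qx hpq]]] := hO (g x0); first by rewrite /= -fg.
pose W := [set x | U x /\ (q \o g) x != 0].
have oW : kopen W by apply: (good_nz gX) => //; apply: gp.
have WU : W `<=` U by move=> x [].
exists W, (fun x => (p \o g) x * ((q \o g) x)^-1); split=> //.
  apply: (good_mul gX) => //; first exact: (good_sub gX oW oU WU (gp _ Gp)).
  apply: (good_inv gX) => //; last by move=> y [].
  exact: (good_sub gX oW oU WU (gp _ Gq)).
by move=> x [Ux qx'] Ox; rewrite /= fg //; apply: hpq => //; rewrite /= -fg.
Qed.

(** The standard affine chart, made of the subspaces on which the [l i] restrict to coordinates.
    Such a subspace has a unique basis dual to [l]; in terms of a frame [v] it is [v] times the
    inverse of the matrix [l i (v j)], hence regular by Cramer's rule. *)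
Lemma grass_frame_near V (E : set V) d (l : 'I_d -> {scalar V})
    (v0 : 'I_d -> V) (W0 : grass E d) :
  subspace E -> sval W0 = lspan (range v0) -> (forall i j, l i (v0 j) = (i == j)%:R) ->
  exists O (s : 'I_d -> grass E d -> V), [/\ kopen O, O W0,
    forall W, O W -> [/\ frame E (s^~ W), sval W = lspan (range (s^~ W)) &
                     forall i j, l i (s j W) = (i == j)%:R] &
    forall i, reg_vec O (s i)].
Proof.
move=> sE W0E lv0.
pose normal (W : grass E d) (w : 'I_d -> V) := [/\ frame E w, sval W = lspan (range w) &
  forall i j, l i (w j) = (i == j)%:R].
pose O : set (grass E d) := [set W | exists w, normal W w].
have normal_uniq W w w' : normal W w -> normal W w' -> w = w'.
  move=> [_ wW lw] [_ w'W lw']; apply/funext => j.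
  rewrite (dual_coord (x := w' j) lw); last by rewrite -wW w'W; apply: mem_lspan_range.
  rewrite (bigD1 j) //= lw' eqxx scale1r big1 ?addr0 // => i /negPf ij.
  by rewrite lw' ij scale0r.
pose s j W := if pselect (O W) is left OW then projT1 (cid OW) j else 0.
have sP W : O W -> normal W (s^~ W).
  move=> OW; suff -> : s^~ W = projT1 (cid OW) by case: cid.
  apply/funext => j; rewrite /s; case: pselect => // OW'.
  by congr (projT1 (cid _) _); exact: Prop_irrelevance.
have sE' W w j : normal W w -> s j W = w j.
  move=> Ww; have OW : O W by exists w.
  by rewrite (normal_uniq _ _ _ Ww (sP _ OW)).
pose M (v : frame_space E d) := \matrix_(i, j) l i (sval v j).
pose w (v : frame_space E d) j := \sum_k (invmx (M v)) k j *: sval v k.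
have M_unit v : O (frame_span v) <-> \det (M v) != 0.
  split=> [[u [uE ufs lu]]|Mv].
    have vu k : sval v k = \sum_j l j (sval v k) *: u j.
      by apply: dual_coord; rewrite // -ufs; apply: mem_lspan_range.
    have uv k : exists c : 'I_d -> K, u k = \sum_i c i *: sval v i.
      have : lspan (range (sval v)) (u k).
        by rewrite -[X in X (u k)]/(sval (frame_span v)) ufs; apply: mem_lspan_range.
      by rewrite lspan_rangeE.
    have /choice[c cP] := uv.
    pose C := \matrix_(i, k) c k i.
    have MC : M v *m C = 1%:M.
      apply/matrixP => i k; rewrite !mxE -[RHS]lu (cP k) linear_sum.
      by apply: eq_bigr => j _; rewrite !mxE linearZ /= mulrC.
    by have [] := mulmx1_unit MC; rewrite unitmxE unitfE.
  have Mu : M v \in unitmx by rewrite unitmxE unitfE.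
  exists (w v).
  have lw i j : l i (w v j) = (i == j)%:R.
    have := congr1 (fun A : 'M_d => A i j) (mulmxV Mu); rewrite !mxE => <-.
    rewrite linear_sum; apply: eq_bigr => k _.
    by rewrite linearZ /= !mxE mulrC.
  have wfree : lindep_free (w v) := dual_free lw.
  have wE i : lspan (range (sval v)) (w v i).
    by rewrite lspan_rangeE; exists (fun k => invmx (M v) k i).
  split=> //.
    split=> // i; have [vE _] := svalP v.
    by apply: subspace_sum => // k _; apply: subspaceZ.
  by apply: free_sub_span wfree _ _.
have normal_w v : O (frame_span v) -> normal (frame_span v) (w v).
  move=> Ov; have /M_unit Mv := Ov.
  have Mu : M v \in unitmx by rewrite unitmxE unitfE.
  have [u Wu] := Ov; suff -> : w v = u by [].
  have [uE ufs lu] := Wu.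
  apply/funext => k.
  have lw i j : l i (w v j) = (i == j)%:R.
    have := congr1 (fun A : 'M_d => A i j) (mulmxV Mu); rewrite !mxE => <-.
    rewrite linear_sum; apply: eq_bigr => m _.
    by rewrite linearZ /= !mxE mulrC.
  have wE i : lspan (range (sval v)) (w v i).
    by rewrite lspan_rangeE; exists (fun k => invmx (M v) k i).
  rewrite (dual_coord (x := w v k) lu); last by rewrite -ufs; apply: wE.
  rewrite (bigD1 k) //= lw eqxx scale1r big1 ?addr0 // => i /negPf ik.
  by rewrite lw ik scale0r.
have gF := good_frame_space E d.
have regM i j : @kreg K (frame_space E d) setT (fun v => M v i j).
  move=> v _; exists (fun v => l i (sval v j)), (fun=> 1); split.
  - by apply: polyfun_gen; exists (l i), j.
  - exact: polyfun_cst.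
  - exact: oner_neq0.
  - by move=> y _ _; rewrite mxE divr1.
have oT := good_openT gF.
have OE : @frame_span K V E d @^-1` O = [set v | [set: frame_space E d] v /\ \det (M v) != 0].
  by apply/seteqP; split=> v; [move=> /M_unit|move=> [_ /M_unit]].
have oO : @kopen K (frame_space E d) (@frame_span K V E d @^-1` O).
  by rewrite OE; apply: (good_nz gF) => //; apply: (good_det gF).
have OT : @frame_span K V E d @^-1` O `<=` [set: frame_space E d] by [].
exists O, s; split=> //.
- exists v0; split=> //.
  have [v [vE vfree] W0v] := grass_frame W0.
  split; last exact: dual_free lv0.
  move=> i; have : lspan (range v) (v0 i) by rewrite -W0v W0E; apply: mem_lspan_range.
  by apply: lspan_min => // _ [j _ <-].
- move=> i l'; rewrite /= /reg_vec.
  apply: (good_ext gF (f := fun v => \sum_k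
     ((\adj (M v)) k i * (\det (M v))^-1) * l' (sval v k))) => //.
    move=> v Ov; have Mv := (M_unit v).1 Ov.
    rewrite /= (sE' _ _ i (normal_w v Ov)) linear_sum; apply: eq_bigr => k _.
    by rewrite linearZ /=; congr (_ * _); rewrite /invmx unitmxE unitfE Mv [RHS]mxE mulrC.
  apply: (good_sum gF) => // k _; apply: (good_mul gF) => //.
    apply: (good_mul gF) => //.
      by apply: (good_sub gF oO oT OT); apply: (good_adj gF).
    apply: (good_inv gF) => //; last by move=> v /M_unit.
    by apply: (good_sub gF oO oT OT); apply: (good_det gF).
  apply: (good_sub gF oO oT OT) => v _.
  exists (fun v => l' (sval v k)), (fun=> 1); split.
  + by apply: polyfun_gen; exists l', k.
  + exact: polyfun_cst.
  + exact: oner_neq0.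
  + by move=> y _ _; rewrite divr1.
Qed.

Lemma morphism_frame_near X V (E : set V) d (f : X -> grass E d)
    (l : 'I_d -> {scalar V}) (v0 : 'I_d -> V) x0 :
  kmorphism f -> subspace E -> sval (f x0) = lspan (range v0) ->
  (forall i j, l i (v0 j) = (i == j)%:R) ->
  exists U (s : 'I_d -> X -> V), [/\ kopen U, U x0,
    forall x, U x -> [/\ frame E (s^~ x), sval (f x) = lspan (range (s^~ x)) &
                     forall i j, l i (s j x) = (i == j)%:R] &
    forall i, reg_vec U (s i)].
Proof.
move=> mf sE fx0 lv0; have [O [s [oO Ox0 sP sreg]]] := grass_frame_near sE fx0 lv0.
have [oU fU] := mf _ oO.
exists (f @^-1` O), (fun i x => s i (f x)); split=> //.
  by move=> x /sP.
by move=> i l'; apply: (fU _ (sreg i l')).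
Qed.

Lemma morphism_frame X V (E : set V) d (f : X -> grass E d) x0 :
  kmorphism f -> subspace E ->
  exists U (s : 'I_d -> X -> V), [/\ kopen U, U x0,
    forall x, U x -> frame E (s^~ x) /\ sval (f x) = lspan (range (s^~ x)) &
    forall i, reg_vec U (s i)].
Proof.
move=> mf sE; have [v [_ vfree] vW] := grass_frame (f x0).
have [l lv] := dual_frame vfree.
have [U [s [oU Ux sP sreg]]] := morphism_frame_near mf sE vW lv.
by exists U, s; split=> // x /sP[].
Qed.

Section RegVec.
Variables (X : kspace K) (gX : good X).

Lemma reg_vec_cst V (U : set X) (v : V) : kopen U -> reg_vec U (fun=> v).
Proof. by move=> oU l; apply: (good_cst gX). Qed.

Lemma reg_vecD V (U : set X) (v w : X -> V) : kopen U ->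
  reg_vec U v -> reg_vec U w -> reg_vec U (fun x => v x + w x).
Proof.
move=> oU vU wU l; apply: (good_ext gX (f := fun x => l (v x) + l (w x))) => //.
  by move=> x _; rewrite linearD.
exact: (good_add gX).
Qed.

Lemma reg_vecZ V (U : set X) (a : X -> K) (v : X -> V) : kopen U ->
  kreg U a -> reg_vec U v -> reg_vec U (fun x => a x *: v x).
Proof.
move=> oU aU vU l; apply: (good_ext gX (f := fun x => a x * l (v x))) => //.
  by move=> x _; rewrite linearZ.
exact: (good_mul gX).
Qed.

Lemma reg_vec_sum V (U : set X) (I : Type) (r : seq I) (P : pred I) (v : I -> X -> V) :
  kopen U -> (forall i, P i -> reg_vec U (v i)) ->
  reg_vec U (fun x => \sum_(i <- r | P i) v i x).
Proof.
move=> oU vU l; apply: (good_ext gX (f := fun x => \sum_(i <- r | P i) l (v i x))) => //.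
  by move=> x _; rewrite linear_sum.
by apply: (good_sum gX) => // i /vU; apply.
Qed.

Lemma reg_vec_sub V (U U' : set X) (v : X -> V) : kopen U -> kopen U' ->
  U' `<=` U -> reg_vec U v -> reg_vec U' v.
Proof. by move=> oU oU' UU' vU l; apply: (good_sub gX oU' oU UU'). Qed.

Lemma reg_vec_ext V (U : set X) (v w : X -> V) : kopen U ->
  (forall x, U x -> v x = w x) -> reg_vec U v -> reg_vec U w.
Proof.
by move=> oU vw vU l; apply: (good_ext gX oU) (vU l) => x Ux; rewrite vw.
Qed.

(** If [v x0] were outside the span, a functional [l] equal to 1 on it and 0 on the [m i x0] would
    give a regular function that is 1 at [x0] and 0 at the points of [A] in [U]. *)
Lemma kclosure_span V (A U : set X) x0 e (m : 'I_e -> X -> V) (v : X -> V) :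
  kclosure A x0 -> kopen U -> U x0 -> (forall i, reg_vec U (m i)) -> reg_vec U v ->
  lindep_free (m^~ x0) ->
  (forall x, A x -> U x -> lspan (range (m^~ x)) (v x)) ->
  lspan (range (m^~ x0)) (v x0).
Proof.
move=> clA oU Ux0 mreg vreg mfree mA; apply: contrapT => nv.
have [l [lv lm]] := separating_functional (lspan_subspace _) nv.
have [l' l'm] := dual_frame mfree.
pose M x := \matrix_(i < e, j < e) l' i (m j x).
(* The determinant of [M x] bordered by the column [l' j (v x)] and the row [l (m i x)], with corner
   [l (v x)]. Thanks to the adjugate in place of the inverse, it vanishes whenever [v x] is in the
   span, even if the [m i x] are dependent. *)
pose h x := \det (M x) * l (v x) -
  \sum_i (\sum_j (\adj (M x)) i j * l' j (v x)) * l (m i x).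
have Mreg i j : kreg U (fun x => M x i j).
  by apply: (good_ext gX oU) (mreg j (l' i)) => x _; rewrite mxE.
have hreg : kreg U h.
  apply: (good_ext gX (f := fun x => \det (M x) * l (v x) + \sum_i
     (-1 * \sum_j (\adj (M x)) i j * l' j (v x)) * l (m i x))) => //.
    move=> x _; congr (_ + _); rewrite -sumrN; apply: eq_bigr => i _.
    by rewrite mulN1r mulNr.
  apply: (good_add gX) => //.
    by apply: (good_mul gX) => //; apply: (good_det gX).
  apply: (good_sum gX) => // i _; apply: (good_mul gX) => //; last exact: (mreg i l).
  apply: (good_mul gX) => //; first exact: (good_cst gX).
  apply: (good_sum gX) => // j _; apply: (good_mul gX) => //.
  exact: (good_adj gX).
have hx0 : h x0 != 0.
  have -> : h x0 = 1; last exact: oner_neq0.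
  rewrite /h lv mulr1 big1; last first.
    by move=> i _; rewrite lm ?mulr0 //; apply: mem_lspan_range.
  rewrite subr0 -(det1 K e); congr (\det _); apply/matrixP => i j.
  by rewrite !mxE l'm.
have [x [[Ux hx] Ax]] := clA _ (good_nz gX oU hreg) (conj Ux0 hx0).
have := mA x Ax Ux; rewrite lspan_rangeE => -[c vc].
case/eqP: hx; rewrite /h; apply/eqP; rewrite subr_eq0; apply/eqP.
rewrite vc linear_sum mulr_sumr; apply: eq_bigr => i _.
rewrite linearZ /= mulrA; congr (_ * _).
have := congr1 (fun A : 'cV_e => A i 0)
  (congr1 (fun A => A *m (\col_k c k)) (mul_adj_mx (M x))).
rewrite /= -mulmxA mul_scalar_mx !mxE.
move=> <-; apply: eq_bigr => j _; congr (_ * _); rewrite !mxE linear_sum.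
by apply: eq_bigr => k _; rewrite !mxE linearZ /= mulrC.
Qed.

(** A local frame of [f] reduces membership to [kclosure_span]. This bounds a limit subspace from
    below, and [kclosure_sub] bounds it from above. *)
Lemma kclosure_mem V (E : set V) d (f : X -> grass E d) (A U : set X) x0 (v : X -> V) :
  subspace E -> kmorphism f ->
  kclosure A x0 -> kopen U -> U x0 -> reg_vec U v ->
  (forall x, A x -> U x -> sval (f x) (v x)) -> sval (f x0) (v x0).
Proof.
move=> sE mf clA oU Ux0 vU fA.
have [U' [s [oU' Ux0' sP sU']]] := morphism_frame x0 mf sE.
have [_ ->] := sP _ Ux0'.
have UU : (U `&` U') `<=` U by move=> x [].
have UU' : (U `&` U') `<=` U' by move=> x [].
have oI := good_openI gX oU oU'.
apply: (kclosure_span clA oI) => //.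
- by move=> i; apply: reg_vec_sub oU' oI UU' (sU' i).
- exact: reg_vec_sub oU oI UU vU.
- by have [[]] := sP _ Ux0'.
- by move=> x Ax [Ux Ux']; have [_ <-] := sP _ Ux'; apply: fA.
Qed.

Lemma reg_vec_linear V V' (U : set X) (f : {linear V -> V'}) (v : X -> V) :
  reg_vec U v -> reg_vec U (f \o v).
Proof.
move=> vU l; have [l' l'E] : exists l' : {scalar V}, forall x, l' x = l (f x).
  by apply: ex_scalar => a x y; rewrite !linearP.
have := vU l'; congr (kreg U _); apply/funext => x /=; exact: l'E.
Qed.

Lemma kclosure_sub V (E : set V) d (f : X -> grass E d) (A U : set X) x0 e
    (m : 'I_e -> X -> V) :
  subspace E -> kmorphism f -> kclosure A x0 -> kopen U -> U x0 ->
  (forall i, reg_vec U (m i)) -> lindep_free (m^~ x0) ->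
  (forall x, A x -> U x -> sval (f x) `<=` lspan (range (m^~ x))) ->
  sval (f x0) `<=` lspan (range (m^~ x0)).
Proof.
move=> sE mf clA oU Ux0 mreg mfree mA.
have [U' [s [oU' Ux0' sP sU']]] := morphism_frame x0 mf sE.
have [_ ->] := sP _ Ux0'.
have UU : (U `&` U') `<=` U by move=> x [].
have UU' : (U `&` U') `<=` U' by move=> x [].
have oI := good_openI gX oU oU'.
apply: (lspan_min (lspan_subspace _)) => _ [i _ <-].
apply: (kclosure_span clA oI (v := s i)) => //.
- by move=> j; apply: reg_vec_sub oU oI UU (mreg j).
- exact: reg_vec_sub oU' oI UU' (sU' i).
- move=> x Ax [Ux Ux']; apply: (mA x Ax Ux); have [_ ->] := sP _ Ux'.
  by apply: mem_lspan; exists i.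
Qed.

(** Exchange [iota u0] for one vector of a frame of [f x0]. The other vectors are free modulo the
    image of [iota], since this image meets [f x0] only in the line of [iota u0]. *)
Lemma line_near V V' (E : set V) d (f : X -> grass E d)
    (iota : {linear V' -> V}) (pi : {linear V -> V'}) x0 u0 :
  kmorphism f -> subspace E -> (forall u, pi (iota u) = u) -> u0 != 0 ->
  (forall u, sval (f x0) (iota u) <-> exists a, u = a *: u0) ->
  exists U (sigma : X -> V'), [/\ kopen U, U x0, reg_vec U sigma, sigma x0 = u0 &
    forall x, U x -> (exists2 u, u != 0 & sval (f x) (iota u)) ->
      [/\ sigma x != 0, sval (f x) (iota (sigma x)) &
          forall u, sval (f x) (iota u) -> exists a, u = a *: sigma x]].
Proof.
move=> mf sE iotaK u0n0 fu.
have iota_inj : injective iota := can_inj iotaK.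
have fx0u0 : sval (f x0) (iota u0) by apply/fu; exists 1; rewrite scale1r.
have iu0 : iota u0 != 0 by rewrite -(linear0 iota) (inj_eq iota_inj).
case: d => [|d] in f mf fu fx0u0 *.
  have [v _ vW] := grass_frame (f x0).
  move: fx0u0; rewrite vW lspan_rangeE => -[c]; rewrite big_ord0 => i0.
  by rewrite i0 eqxx in iu0.
have [v [vE vfree] vW] := grass_frame (f x0).
have := fx0u0; rewrite vW lspan_rangeE => -[c cu0].
have [i0 ci0] : exists i0, c i0 != 0.
  apply: contrapT => nc; move/eqP: iu0; apply; rewrite cu0 big1 // => i _.
  have [->|ci] := eqVneq (c i) 0; first by rewrite scale0r.
  by case: nc; exists i.
pose Q := range iota.
have sQ : subspace Q.
  split; first by exists 0; rewrite ?linear0.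
  by move=> a _ _ [p _ <-] [q _ <-]; exists (a *: p + q); rewrite ?linearP.
pose w k := v (lift i0 k).
have v_split (b : 'I_d.+1 -> K) :
    \sum_i b i *: v i = b i0 *: v i0 + \sum_k b (lift i0 k) *: w k.
  by rewrite (bigD1_ord i0).
have line p : sval (f x0) (iota p) -> exists a, iota p = a *: iota u0.
  by move=> /fu[a ->]; exists a; rewrite linearZ.
have wQ (e : 'I_d -> K) : Q (\sum_i e i *: w i) -> forall i, e i = 0.
  move=> [p _ pe].
  have : sval (f x0) (iota p).
    rewrite pe vW; have sL := lspan_subspace (range v).
    by apply: (subspace_sum _ sL) => k _; apply: (subspaceZ _ sL); apply: mem_lspan_range.
  case/line => a; rewrite pe cu0 => ew.
  have := vfree (fun i => oapp e 0 (unlift i0 i) - a * c i).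
  have -> : \sum_i (oapp e 0 (unlift i0 i) - a * c i) *: v i = 0.
    under eq_bigr do rewrite scalerBl -scalerA.
    rewrite sumrB -scaler_sumr -ew v_split unlift_none scale0r add0r.
    by under eq_bigr do rewrite liftK /=; rewrite subrr.
  move=> /(_ erefl) z0.
  have := z0 i0; rewrite unlift_none /= sub0r => /eqP.
  rewrite oppr_eq0 mulf_eq0 (negPf ci0) orbF => /eqP a0.
  by move=> i; have := z0 (lift i0 i); rewrite liftK /= a0 mul0r subr0.
have [lw [lwQ lww]] := dual_frame_mod sQ wQ.
have nw : ~ lspan (range w) (iota u0).
  rewrite lspan_rangeE => -[e eu].
  have := wQ e; rewrite -eu => /(_ (ex_intro2 _ _ u0 I erefl)) e0.
  by move/eqP: iu0; apply; rewrite eu big1 // => i _; rewrite e0 scale0r.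
have [l0 [l0u l0w]] := separating_functional (lspan_subspace _) nw.
(* The functionals l_j, j > 0, vanish on the image of iota, so that the vector
   dual to l_0 in the normalized frame of f x spans f x /\ range iota. *)
pose v0 (i : 'I_d.+1) := oapp w (iota u0) (unlift ord0 i).
pose l (i : 'I_d.+1) := oapp lw l0 (unlift ord0 i).
have lv0 i j : l i (v0 j) = (i == j)%:R.
  rewrite /l /v0; case: (unliftP ord0 i) => [i'|] ->;
    case: (unliftP ord0 j) => [j'|] ->; rewrite /= ?liftK ?unlift_none /=.
  - by rewrite lww (inj_eq lift_inj).
  - by rewrite lwQ //; exists u0.
  - by rewrite l0w //; apply: mem_lspan_range.
  - by rewrite l0u.
have fx0 : sval (f x0) = lspan (range v0).
  apply: (free_sub_span (dual_free lv0) vW) => i.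
  rewrite vW /v0; case: (unliftP ord0 i) => [i'|] _ /=; first exact: mem_lspan_range.
  by rewrite -vW.
have [U [s [oU Ux0 sP sreg]]] := morphism_frame_near mf sE fx0 lv0.
have fline x u : U x -> sval (f x) (iota u) -> iota u = l ord0 (iota u) *: s ord0 x.
  move=> Ux; have [_ -> ls] := sP _ Ux => /(dual_coord ls).
  rewrite big_ord_recl big1 ?addr0 // => i _.
  by rewrite /l liftK /= lwQ ?scale0r //; exists u.
exists U, (pi \o s ord0); split=> //.
- exact: reg_vec_linear.
- have := fline _ _ Ux0 fx0u0; rewrite /l unlift_none /= l0u scale1r => <-.
  exact: iotaK.
- move=> x Ux [u un0 fxu].
  have su := fline _ _ Ux fxu; set a := l _ _ in su.
  have a0 : a != 0.
    apply/eqP => a0; move/eqP: un0; apply; apply: iota_inj.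
    by rewrite su a0 scale0r linear0.
  have sE' : s ord0 x = iota (a^-1 *: u) by rewrite linearZ /= su scalerK.
  rewrite /= sE' iotaK; split.
  + by rewrite scaler_eq0 invr_eq0 negb_or a0.
  + rewrite linearZ /=; have [v1 _ fxW] := grass_frame (f x).
    by rewrite fxW; apply: (subspaceZ _ (lspan_subspace _)); rewrite -fxW.
  + move=> u' fxu'; exists (l ord0 (iota u')); apply: iota_inj.
    by rewrite linearZ /= -sE'; apply: fline.
Qed.

Lemma proj_lift V (g : X -> proj_space V) x0 : kmorphism g ->
  exists U (s : X -> V), [/\ kopen U, U x0, reg_vec U s &
    forall x, U x -> s x != 0 /\ sval (g x) = lspan [set s x]].
Proof.
move=> mg; have sT : subspace [set: V] by [].
have [U [s [oU Ux0 sP sreg]]] := morphism_frame x0 mg sT.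
exists U, (s ord0); split=> // x Ux; have [[_ sfree] ->] := sP _ Ux; split.
  apply/eqP => s0; have := sfree (fun=> 1); rewrite big_ord1 scale1r s0.
  by move=> /(_ erefl ord0) /eqP; rewrite oner_eq0.
congr lspan; apply/seteqP; split=> v; first by move=> [i _ <-]; rewrite (ord1 i).
by move=> ->; exists ord0.
Qed.

Lemma proj_lift_morphism V (g : X -> proj_space V) :
  (forall x0, exists U (s : X -> V), [/\ kopen U, U x0, reg_vec U s &
    forall x, U x -> s x != 0 /\ sval (g x) = lspan [set s x]]) -> kmorphism g.
Proof.
move=> lift; apply: grass_lift_morphism => // x0.
have [U [s [oU Ux0 sreg sP]]] := lift x0; exists U, (fun=> s); split=> // x Ux.
have [s0 ->] := sP _ Ux; split.
  split=> // c; rewrite big_ord1 => /eqP; rewrite scaler_eq0 (negPf s0) orbF.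
  by move=> /eqP c0 i; rewrite (ord1 i).
congr lspan; apply/seteqP; split=> v; first by move=> ->; exists ord0.
by move=> [i _ <-].
Qed.

Lemma proj_gen V (L : proj_space V) : exists2 v : V, v != 0 & sval L = lspan [set v].
Proof.
have [v [_ vfree] ->] := grass_frame L; exists (v ord0).
  apply/eqP => v0; have := vfree (fun=> 1); rewrite big_ord1 scale1r v0.
  by move=> /(_ erefl ord0) /eqP; rewrite oner_eq0.
congr lspan; apply/seteqP; split=> w; first by move=> [i _ <-]; rewrite (ord1 i).
by move=> ->; exists ord0.
Qed.

Lemma proj_line V (L : proj_space V) (v : V) : v != 0 -> sval L v -> sval L = lspan [set v].
Proof.
have [w w0 ->] := proj_gen L => v0 /lspan1P[a va].
have a0 : a != 0 by apply: contra v0 => /eqP a0; rewrite va a0 scale0r.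
apply/seteqP; split=> x /lspan1P[c ->]; apply/lspan1P.
  by exists (c / a); rewrite va scalerA divfK.
by exists (c * a); rewrite va scalerA.
Qed.

(** This yields the regularity of the inverse isomorphism, whose projective coordinates are lines
    cut out of the subspaces [f x] by the fixed image of [iota]. *)
Lemma line_morphism V V' (E : set V) d (f : X -> grass E d) (g : X -> proj_space V')
    (iota : {linear V' -> V}) (pi : {linear V -> V'}) :
  kmorphism f -> subspace E -> (forall u, pi (iota u) = u) ->
  (forall x u, sval (g x) u <-> sval (f x) (iota u)) -> kmorphism g.
Proof.
move=> mf sE iotaK gf; apply: proj_lift_morphism => x0.
have [u0 u0n0 gu0] := proj_gen (g x0).
have [|U [s [oU Ux0 sreg s0 sP]]] := line_near mf sE iotaK u0n0 (x0 := x0).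
  by move=> u; rewrite -gf gu0 lspan1P.
exists U, s; split=> // x Ux; have [u un0 gu] := proj_gen (g x).
have gxu : sval (g x) u by rewrite gu; apply: mem_lspan.
have [|sn0 fs fline] := sP x Ux; first by exists u => //; apply/gf.
split=> //; apply/seteqP; split=> v.
  by move=> /gf/fline[a ->]; apply/lspan1P; exists a.
move=> /lspan1P[a ->]; move/gf: fs; rewrite gu => fs.
exact: (subspaceZ _ (lspan_subspace _)).
Qed.

End RegVec.

End Grassmannian.

(** * RTT relations and the quantum determinant *)

Lemma ord2_ind (P : 'I_2 -> Prop) : P 0 -> P 1 -> forall i, P i.
Proof.
move=> P0 P1 i; have [->|->//] : i = 0 \/ i = 1.
  by case: i => [[|[|//]] ?]; [left|right]; apply: val_inj.
by [].
Qed.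

Lemma sum_ord2 (V : nmodType) (F : 'I_2 -> V) : \sum_i F i = F 0 + F 1.
Proof. by rewrite !big_ord_recl big_ord0 addr0; congr (F _ + F _); apply: val_inj. Qed.

Section NonCommutativeRing.
Variable A : pzRingType.

#[local] Instance ncring_ops :
  @Ncring.Ring_ops A 0 1 +%R *%R (fun x y => x - y) (-%R) eq := {}.

#[local] Instance ncring_ring : Ncring.Ring (Ro := ncring_ops).
Proof.
split; try exact _;
  rewrite /Algebra_syntax.equality /Ncring.eq_notation /Algebra_syntax.addition
    /Ncring.add_notation /Algebra_syntax.multiplication /Ncring.mul_notation
    /Algebra_syntax.subtraction /Ncring.sub_notation /Algebra_syntax.opposite
    /Ncring.opp_notation /Algebra_syntax.zero /Ncring.zero_notation
    /Algebra_syntax.one /Ncring.one_notation /=.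
all: try by move=> *;
  rewrite ?(add0r, addrA, mulrA, mul1r, mulr1, mulrDl, mulrDr, subrr).
by move=> x y; rewrite addrC.
Qed.

Ltac ncring := rewrite /bracket; Ncring_tac.non_commutative_ring.

Lemma bracketDl (x y z : A) : bracket (x + y) z = bracket x z + bracket y z.
Proof. ncring. Qed.
Lemma bracketDr (x y z : A) : bracket x (y + z) = bracket x y + bracket x z.
Proof. ncring. Qed.
Lemma bracketNr (x y : A) : bracket x (- y) = - bracket x y.
Proof. ncring. Qed.
Lemma bracketC (x y : A) : bracket x y = - bracket y x.
Proof. ncring. Qed.
Lemma bracketMr (x y z : A) : bracket x (y * z) = bracket x y * z + y * bracket x z.
Proof. ncring. Qed.
Lemma bracket0r (x : A) : bracket x 0 = 0.
Proof. ncring. Qed.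
Lemma bracket0l (x : A) : bracket 0 x = 0.
Proof. ncring. Qed.

Lemma bracket_sumr (I : Type) (r : seq I) (P : pred I) x (F : I -> A) :
  bracket x (\sum_(i <- r | P i) F i) = \sum_(i <- r | P i) bracket x (F i).
Proof. by rewrite /bracket mulr_sumr mulr_suml sumrB. Qed.

Lemma bracket_suml (I : Type) (r : seq I) (P : pred I) x (F : I -> A) :
  bracket (\sum_(i <- r | P i) F i) x = \sum_(i <- r | P i) bracket (F i) x.
Proof. by rewrite /bracket mulr_sumr mulr_suml sumrB. Qed.

Lemma bracket_natr (x : A) n : bracket x n%:R = 0.
Proof. by rewrite /bracket (commr_nat x n) subrr. Qed.
Lemma bracket_natl (x : A) n : bracket n%:R x = 0.
Proof. by rewrite bracketC bracket_natr oppr0. Qed.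

Lemma bracketMnr (x y : A) n : bracket x (y *+ n) = bracket x y *+ n.
Proof. by rewrite /bracket mulrnAr mulrnAl mulrnBl. Qed.

Definition rtt (t : 'I_2 -> 'I_2 -> nat -> A) :=
  (forall i j, t i j 0%N = (i == j)%:R) /\
  forall i j k l r s,
    bracket (t i j r.+1) (t k l s) - bracket (t i j r) (t k l s.+1) =
    t k j r * t i l s - t k j s * t i l r.

Definition gl2_rel (E : 'I_2 -> 'I_2 -> A) := forall i j k l,
  bracket (E i j) (E k l) = (j == k)%:R * E i l - (l == i)%:R * E k j.

(* The coefficients of T(u) (1 + E u^-1). *)
Definition mul_site (t : 'I_2 -> 'I_2 -> nat -> A) (E : 'I_2 -> 'I_2 -> A) i j r : A :=
  t i j r + \sum_a (if r is r'.+1 then t i a r' else 0) * E a j.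

(** The coproduct of Y(gl_2) followed, on its second factor, by the evaluation homomorphism T(u) ->
    1 + E u^-1; a product of two solutions with commuting entries is again a solution. *)
Lemma rtt_mul_site t E : rtt t -> gl2_rel E ->
  (forall i j r a b, GRing.comm (t i j r) (E a b)) -> rtt (mul_site t E).
Proof.
move=> [t0 tR] ER tE.
(* The coefficients of u^-1 T(u). The relations persist when t(u) or t(v) is multiplied by u^-1 or
   v^-1, the constant terms being central: these are [tp], [pt] and [pp]. *)
pose p i j r := if r is r'.+1 then t i j r' else 0.
have pS i j r : p i j r.+1 = t i j r by [].
have pE i j r a b : p i j r * E a b = E a b * p i j r.
  by case: r => [|r] /=; [rewrite mul0r mulr0|exact: tE].
pose P i r j := \sum_a p i a r * E a j.
have comm0 x i j : bracket x (t i j 0%N) = 0 by rewrite t0 bracket_natr.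
have comm0l x i j : bracket (t i j 0%N) x = 0 by rewrite t0 bracket_natl.
have tp i j k l r s : bracket (t i j r.+1) (p k l s) - bracket (t i j r) (p k l s.+1) =
    t k j r * p i l s - p k j s * t i l r.
  case: s => [|s]; last exact: (tR i j k l r s).
  by rewrite /= bracket0r comm0; ncring.
have pt i j k l r s : bracket (p i j r.+1) (t k l s) - bracket (p i j r) (t k l s.+1) =
    p k j r * t i l s - t k j s * p i l r.
  case: r => [|r]; last exact: (tR i j k l r s).
  by rewrite /= comm0l bracket0l; ncring.
have pp i j k l r s : bracket (p i j r.+1) (p k l s) - bracket (p i j r) (p k l s.+1) =
    p k j r * p i l s - p k j s * p i l r.
  case: r => [|r]; case: s => [|s]; last exact: (tR i j k l r s).
  - by rewrite /= ?comm0l ?comm0 ?bracket0l ?bracket0r; ncring.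
  - by rewrite /= comm0l bracket0l; ncring.
  - by rewrite /= bracket0r comm0; ncring.
have tPl i j k l r s :
    bracket (t i j r.+1) (P k s l) - bracket (t i j r) (P k s.+1 l) =
    t k j r * P i s l - p k j s * P i r.+1 l.
  rewrite /P !bracket_sumr !mulr_sumr -!sumrB; apply: eq_bigr => b _.
  have tEl r' : bracket (t i j r') (E b l) = 0.
    by rewrite /bracket (tE i j r' b l) subrr.
  rewrite !bracketMr !tEl !mulr0 !addr0 -mulrBl tp pS; ncring.
have Ptl i j k l r s :
    bracket (P i r.+1 j) (t k l s) - bracket (P i r j) (t k l s.+1) =
    P k r j * t i l s - P k s.+1 j * p i l r.
  rewrite /P !bracket_suml !mulr_suml -!sumrB; apply: eq_bigr => a _.
  have brE x s' : bracket (x * E a j) (t k l s') = bracket x (t k l s') * E a j.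
    by rewrite /bracket -mulrA -(tE k l s' a j); ncring.
  rewrite !brE -mulrBl pt pS -!mulrA.
  by rewrite -[E a j * t _ _ _](tE i l s a j) -[E a j * p _ _ _]pE; ncring.
(* The first summand collects the brackets of the [p]; the brackets of the [E] turn into the second
   one by the gl_2 relations. *)
have PP i j k l r s : bracket (P i r j) (P k s l) =
    \sum_a \sum_b bracket (p i a r) (p k b s) * (E a j * E b l)
    + (p k j s * P i r l - P k s j * p i l r).
  have -> : p k j s * P i r l - P k s j * p i l r = \sum_a \sum_b
      p k b s * p i a r * ((j == b)%:R * E a l - (l == a)%:R * E b j).
    under [RHS]eq_bigr do under eq_bigr do rewrite mulrBr.
    under [RHS]eq_bigr do rewrite sumrB.
    rewrite sumrB; congr (_ - _).
      rewrite /P mulr_sumr; apply: eq_bigr => a _.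
      rewrite (bigD1 j) //= eqxx mul1r big1 ?addr0 ?mulrA // => b bj.
      by rewrite eq_sym (negPf bj) mul0r mulr0.
    rewrite exchange_big /P mulr_suml /=; apply: eq_bigr => b _.
    rewrite (bigD1 l) //= eqxx mul1r big1 ?addr0; last first.
      by move=> a al; rewrite eq_sym (negPf al) mul0r mulr0.
    by rewrite -!mulrA pE.
  rewrite -big_split /= /P bracket_suml; apply: eq_bigr => a _.
  rewrite bracket_sumr -big_split /=; apply: eq_bigr => b _.
  rewrite -ER /bracket.
  have -> : p i a r * E a j * (p k b s * E b l) = p i a r * p k b s * (E a j * E b l).
    by rewrite -!mulrA; congr (_ * _); rewrite !mulrA pE.
  have -> : p k b s * E b l * (p i a r * E a j) = p k b s * p i a r * (E b l * E a j).
    by rewrite -!mulrA; congr (_ * _); rewrite !mulrA pE.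
  ncring.
have PPE i j k l r s : P i r j * P k s l = \sum_a \sum_b p i a r * p k b s * (E a j * E b l).
  rewrite /P mulr_suml; apply: eq_bigr => a _; rewrite mulr_sumr; apply: eq_bigr => b _.
  by rewrite -!mulrA; congr (_ * _); rewrite !mulrA pE.
have PPl i j k l r s :
    bracket (P i r.+1 j) (P k s l) - bracket (P i r j) (P k s.+1 l) =
    P k r j * P i s l - P k s j * P i r l + (p k j s * P i r.+1 l - P k s j * t i l r)
    - (t k j s * P i r l - P k s.+1 j * p i l r).
  rewrite !PP !pS.
  have -> : forall a b c d : A, a + b - (c + d) = (a - c) + b - d by move=> *; ncring.
  congr (_ + _ - _); rewrite !PPE -!sumrB; apply: eq_bigr => a _.
  rewrite -!sumrB; apply: eq_bigr => b _.
  by rewrite -mulrBl pp mulrBl.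
split=> [i j|i j k l r s].
  by rewrite /mul_site t0 big1 ?addr0 // => a _; rewrite mul0r.
have mE i' j' r' : mul_site t E i' j' r' = t i' j' r' + P i' r' j' by [].
rewrite !mE !bracketDl !bracketDr.
have -> : forall a b c d a' b' c' d' : A, a + b + (c + d) - (a' + b' + (c' + d')) =
    (a - a') + (b - b') + (c - c') + (d - d') by move=> *; ncring.
rewrite tR tPl Ptl PPl; ncring.
Qed.

Lemma rtt_trivial : rtt (fun i j r => ((i == j) && (r == 0%N))%:R).
Proof.
split=> [i j|i j k l r s]; first by rewrite andbT.
rewrite !bracket_natl subrr; case: r s => [|r] [|s]; rewrite ?andbF ?andbT;
  by rewrite ?(mul0r, mulr0, subrr) // -!natrM mulnC subrr.
Qed.

Definition shift_coef (f : nat -> A) m : A := \sum_(s < m.+1) f s *+ 'C(m.-1, m - s).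

Lemma shift_coef0 f : shift_coef f 0 = f 0%N.
Proof. by rewrite /shift_coef big_ord1 subnn bin0. Qed.

(** The series with coefficients [f s.+1] is u (f(u) - f_0), whose translate is (u - 1) (f(u - 1) -
    f_0). On coefficients this is Pascal's rule. *)
Lemma shift_coefS f m : shift_coef (fun s => f s.+1) m =
  shift_coef f m.+1 - shift_coef f m + (if m is 0 then f 0%N else 0).
Proof.
case: m => [|m].
  by rewrite /shift_coef !big_ord_recl !big_ord0 /= mulr0n !addr0; ncring.
rewrite addr0 /shift_coef /=.
rewrite [in RHS]big_ord_recl subn0 bin_small // mulr0n add0r.
rewrite [X in _ - X]big_ord_recl subn0 bin_small // mulr0n add0r.
rewrite [X in X - _]big_ord_recr [LHS]big_ord_recr /= !subnn !bin0 addrAC; congr (_ + _).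
rewrite -sumrB; apply: eq_bigr => s _; rewrite /= /bump !leq0n !add1n !subSS.
by rewrite subSn -1?ltnS // binS mulrnDr addrK.
Qed.

Section Convolution.
Implicit Types f g : nat -> A.

Definition conv f g m : A := \sum_(a < m.+1) f a * g (m - a)%N.

Lemma convDBl F G H g m : conv (fun a => F a - G a + H a) g m =
  conv F g m - conv G g m + conv H g m.
Proof.
by rewrite -sumrB -big_split; apply: eq_bigr => a _; rewrite mulrDl mulrBl.
Qed.
Lemma convDBr F G H g m : conv g (fun a => F a - G a + H a) m =
  conv g F m - conv g G m + conv g H m.
Proof.
by rewrite -sumrB -big_split; apply: eq_bigr => a _; rewrite mulrDr mulrBr.
Qed.
Lemma convNl f g m : conv (fun a => - f a) g m = - conv f g m.
Proof. by rewrite -sumrN; apply: eq_bigr => a _; rewrite mulNr. Qed.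

Lemma bracket_conv x f g m : bracket x (conv f g m) =
  conv (fun a => bracket x (f a)) g m + conv f (fun a => bracket x (g a)) m.
Proof.
by rewrite bracket_sumr -big_split; apply: eq_bigr => a _; rewrite bracketMr.
Qed.

(* Leibniz rule for the operation (u - v + 1) [x(u), -]; the coefficients of x
   of degrees r and r + 1 are x' and x. *)
Definition dbracket (x x' : A) f a :=
  bracket x (f a) - bracket x' (f a.+1) + bracket x' (f a).

Lemma dbracket_conv x x' f g m : bracket x' (f 0%N) = 0 -> bracket x' (g 0%N) = 0 ->
  dbracket x x' (conv f g) m =
  conv (dbracket x x' f) g m + conv f (dbracket x x' g) m.
Proof.
move=> f0 g0.
have convS : bracket x' (conv f g m.+1) =
    conv (fun a => bracket x' (f a.+1)) g m + conv f (fun a => bracket x' (g a.+1)) m.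
  rewrite bracket_conv; congr (_ + _).
    by rewrite /conv big_ord_recl f0 mul0r add0r.
  rewrite /conv big_ord_recr /= subnn g0 mulr0 addr0.
  by apply: eq_bigr => a _; rewrite subSn // -ltnS.
rewrite /dbracket convDBl convDBr convS !bracket_conv.
do 6 ?[set C := conv _ _ _]; ncring.
Qed.

End Convolution.

Section QuantumDeterminant.
Variables (t : 'I_2 -> 'I_2 -> nat -> A) (tR : rtt t).

Let ts i j := shift_coef (t i j).

Let comm0 x i j : bracket x (t i j 0%N) = 0.
Proof. by case: tR => -> _; rewrite bracket_natr. Qed.

Let ts0 i j : ts i j 0%N = (i == j)%:R.
Proof. by rewrite /ts shift_coef0; case: tR. Qed.

(** The defining relation at (u, v - 1), where the factor u - v becomes the u - v + 1 encoded by
    [dbracket]. *)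
Lemma rtt_shift i j k l r s :
  dbracket (t i j r.+1) (t i j r) (ts k l) s =
  t k j r * ts i l s - ts k j s * t i l r.
Proof.
have brE x f m : bracket x (shift_coef f m) = shift_coef (fun s => bracket x (f s)) m.
  by rewrite bracket_sumr; apply: eq_bigr => a _; rewrite bracketMnr.
have -> : dbracket (t i j r.+1) (t i j r) (ts k l) s =
    shift_coef (fun s => bracket (t i j r.+1) (t k l s) - bracket (t i j r) (t k l s.+1)) s.
  have -> : forall f g m, shift_coef (fun s => f s - g s) m =
      shift_coef f m - shift_coef g m.
    by move=> f g m; rewrite -sumrB; apply: eq_bigr => a _; rewrite mulrnBl.
  rewrite (shift_coefS (fun s => bracket (t i j r) (t k l s))) /dbracket !brE.
  by case: (s) => [|s']; rewrite ?comm0 ?addr0 //; ncring.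
rewrite /ts mulr_sumr mulr_suml -sumrB; apply: eq_bigr => a _.
by case: tR => _ ->; rewrite mulrnAr mulrnAl mulrnBl.
Qed.

Let AA i j k l m := conv (t i j) (ts k l) m.
Let BB k l i j m := \sum_(a < m.+1) ts k l (m - a)%N * t i j a.

(** This is [rtt_shift] at v = u, where the factor u - v + 1 is 1. On coefficients, the contribution
    of u - v telescopes along the antidiagonal of degree [m]. *)
Lemma rtt_fusion i j k l m :
  AA i j k l m - AA k j i l m = BB k l i j m - BB k j i l m.
Proof.
apply/eqP; rewrite -subr_eq0; apply/eqP.
pose X r s := bracket (t i j r) (ts k l s).
have -> : AA i j k l m - AA k j i l m - (BB k l i j m - BB k j i l m) =
    \sum_(a < m.+1) (X a.+1 (m - a)%N - X a (m - a).+1) * -1.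
  rewrite /AA /BB /conv -!sumrB; apply: eq_bigr => a _.
  have := rtt_shift i j k l a (m - a); rewrite /dbracket -/(X _ _) -/(X _ _) -/(X _ _).
  move=> /(congr1 (fun z => z - X a (m - a)%N)); rewrite addrK => ->.
  rewrite /X; ncring.
rewrite -mulr_suml.
have -> : \sum_(a < m.+1) (X a.+1 (m - a)%N - X a (m - a).+1) = X m.+1 0%N - X 0%N m.+1.
  rewrite -(big_mkord xpredT (fun a => X a.+1 (m - a)%N - X a (m - a).+1)).
  rewrite (@telescope_sumr_eq _ 0 m.+1 (fun a => X a (m.+1 - a)%N)) ?subn0 ?subnn //.
  by move=> a /andP[_ am]; rewrite subSS subSn.
by rewrite /X ts0 bracket_natr; case: tR => -> _; rewrite bracket_natl subrr mul0r.
Qed.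

Definition qdet m := conv (t 0 0) (ts 1 1) m - conv (t 1 0) (ts 0 1) m.

(* The adjugate matrix, for which That(v) T(v - 1) = qdet T(v). *)
Let th (k l : 'I_2) s : A :=
  if k == 0 then (if l == 0 then t 1 1 s else - t 0 1 s)
  else (if l == 0 then - t 1 0 s else t 0 0 s).

Let use_eq (a b x y : A) : a = b -> x - y = a - b -> x = y.
Proof. by move=> ->; rewrite subrr => /eqP; rewrite subr_eq0 => /eqP. Qed.

Let use_eqN (a b x y : A) : a = b -> x - y = b - a -> x = y.
Proof. by move=> ->; apply: use_eq. Qed.

Let th_ts k j m : \sum_l conv (th k l) (ts l j) m = (k == j)%:R * qdet m.
Proof.
rewrite sum_ord2; elim/ord2_ind: k; elim/ord2_ind: j; rewrite /th /= ?mul1r ?mul0r ?convNl.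
- have := rtt_fusion 0 1 1 0 m; have := rtt_fusion 0 0 1 1 m.
  rewrite /AA /qdet => -> e; apply: (use_eqN e); ncring.
- have := rtt_fusion 1 1 0 1 m; rewrite /AA => ->; exact: subrr.
- have := rtt_fusion 0 0 1 0 m; rewrite /AA => e; apply: (use_eq e); ncring.
- rewrite /qdet; ncring.
Qed.

Ltac cross u H H' := by first [apply: (u _ _ _ _ H); ncring|apply: (u _ _ _ _ H'); ncring].

(** The crossing relation, that is, the form of the defining relations for a multiple of T(v -
    1)^-1. Each of the sixteen cases is one defining relation up to sign, read with its two
    generators in one of the two orders. *)
Let th_cross i j k l r s :
  dbracket (t i j r.+1) (t i j r) (th k l) s =
  (k == j)%:R * (\sum_a t i a r * th a l s) - (i == l)%:R * (\sum_a th k a s * t a j r).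
Proof.
case: tR => _ tR'; rewrite /dbracket !sum_ord2.
have tR2 i' j' k' l' := tR' i' j' k' l' r s.
have tR3 i' j' k' l' := tR' k' l' i' j' s r.
elim/ord2_ind: k; elim/ord2_ind: l; rewrite /th /=.
- elim/ord2_ind: i; elim/ord2_ind: j; rewrite /= ?mul1r ?mul0r;
    [cross use_eq (tR2 0 0 1 1) (tR3 0 0 1 1)|cross use_eq (tR2 0 1 1 1) (tR3 0 1 1 1)
    |cross use_eq (tR2 1 0 1 1) (tR3 1 0 1 1)|cross use_eq (tR2 1 1 1 1) (tR3 1 1 1 1)].
- elim/ord2_ind: i; elim/ord2_ind: j; rewrite /= ?mul1r ?mul0r;
    [cross use_eqN (tR2 0 0 0 1) (tR3 0 0 0 1)|cross use_eqN (tR2 0 1 0 1) (tR3 0 1 0 1)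
    |cross use_eqN (tR2 1 0 0 1) (tR3 1 0 0 1)|cross use_eqN (tR2 1 1 0 1) (tR3 1 1 0 1)].
- elim/ord2_ind: i; elim/ord2_ind: j; rewrite /= ?mul1r ?mul0r;
    [cross use_eqN (tR2 0 0 1 0) (tR3 0 0 1 0)|cross use_eqN (tR2 0 1 1 0) (tR3 0 1 1 0)
    |cross use_eqN (tR2 1 0 1 0) (tR3 1 0 1 0)|cross use_eqN (tR2 1 1 1 0) (tR3 1 1 1 0)].
- elim/ord2_ind: i; elim/ord2_ind: j; rewrite /= ?mul1r ?mul0r;
    [cross use_eq (tR2 0 0 0 0) (tR3 0 0 0 0)|cross use_eq (tR2 0 1 0 0) (tR3 0 1 0 0)
    |cross use_eq (tR2 1 0 0 0) (tR3 1 0 0 0)|cross use_eq (tR2 1 1 0 0) (tR3 1 1 0 0)].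
Qed.

(** Apply the Leibniz rule to qdet T(v) = That(v) T(v - 1): the middle terms cancel and (u - v + 1)
    [t_ij(u), qdet T(v)] equals [t_ij(u), qdet T(v)]. So (u - v) kills the bracket, and induction on
    [r] starts from the scalar t_ij^(0). *)
Lemma qdet_central i j r m : bracket (t i j r) (qdet m) = 0.
Proof.
have qE n : qdet n = \sum_l conv (th j l) (ts l j) n by rewrite th_ts eqxx mul1r.
have step r' n : bracket (t i j r'.+1) (qdet n) = bracket (t i j r') (qdet n.+1).
  apply/eqP; rewrite -subr_eq0; apply/eqP.
  apply: (@addIr _ (bracket (t i j r') (qdet n))); rewrite add0r.
  have -> : bracket (t i j r'.+1) (qdet n) - bracket (t i j r') (qdet n.+1)
      + bracket (t i j r') (qdet n) =
      \sum_l dbracket (t i j r'.+1) (t i j r') (conv (th j l) (ts l j)) n.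
    by rewrite !qE !bracket_sumr -sumrB -big_split.
  have th0 x k l : bracket x (th k l 0%N) = 0.
    by rewrite /th; case: ifP => _; case: ifP => _; rewrite ?bracketNr comm0 ?oppr0.
  have ts0' x k l : bracket x (ts k l 0%N) = 0 by rewrite ts0 bracket_natr.
  under eq_bigr => l _ do rewrite dbracket_conv //.
  rewrite big_split /=.
  have -> : \sum_l conv (dbracket (t i j r'.+1) (t i j r') (th j l)) (ts l j) n =
      t i j r' * qdet n - \sum_b \sum_(a < n.+1) th j b a * t b j r' * ts i j (n - a)%N.
    transitivity (\sum_l (\sum_b t i b r' * conv (th b l) (ts l j) n
      - (i == l)%:R * \sum_b \sum_(a < n.+1) th j b a * t b j r' * ts i j (n - a)%N)).
      apply: eq_bigr => l _.
      have -> : \sum_b t i b r' * conv (th b l) (ts l j) n =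
          \sum_(a < n.+1) (\sum_b t i b r' * th b l a) * ts l j (n - a)%N.
        under eq_bigr do rewrite mulr_sumr.
        rewrite exchange_big; apply: eq_bigr => a _; rewrite mulr_suml.
        by apply: eq_bigr => b _; rewrite mulrA.
      have -> : (i == l)%:R * (\sum_b \sum_(a < n.+1)
            th j b a * t b j r' * ts i j (n - a)%N) =
          \sum_(a < n.+1) ((i == l)%:R * \sum_b th j b a * t b j r') * ts l j (n - a)%N.
        rewrite exchange_big mulr_sumr; apply: eq_bigr => a _ /=.
        rewrite -mulrA mulr_suml; case: eqP => [->|_]; last by rewrite !mul0r.
        by [].
      rewrite -sumrB; apply: eq_bigr => a _.
      by rewrite th_cross eqxx mul1r mulrBl.
    rewrite sumrB; congr (_ - _).
      rewrite exchange_big /=.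
      under eq_bigr do rewrite -mulr_sumr th_ts.
      rewrite (bigD1 j) //= eqxx mul1r big1 ?addr0 // => b /negPf bj.
      by rewrite bj mul0r mulr0.
    rewrite (bigD1 i) //= eqxx mul1r [X in _ + X]big1 ?addr0 // => b bi.
    by rewrite eq_sym (negPf bi) mul0r.
  have -> : \sum_l conv (th j l) (dbracket (t i j r'.+1) (t i j r') (ts l j)) n =
      \sum_b \sum_(a < n.+1) th j b a * t b j r' * ts i j (n - a)%N - qdet n * t i j r'.
    rewrite qE mulr_suml -sumrB; apply: eq_bigr => l _.
    rewrite mulr_suml -sumrB; apply: eq_bigr => a _.
    by rewrite rtt_shift mulrBr !mulrA.
  by rewrite addrA subrK.
elim: r m => [|r IH] m; first by case: tR => -> _; rewrite bracket_natl.
by rewrite step IH.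
Qed.

End QuantumDeterminant.

End NonCommutativeRing.

(** * Oscillator representations *)

Section Fock.
Variable K : fieldType.

(* Sequences of coefficients of formal power series in the variables
   x_(k,i), with coefficients in K[z]. *)
Definition fock : Type := (nat * 'I_2 -> nat) -> {poly K}.
HB.instance Definition _ := GRing.Lmodule.copy fock ((nat * 'I_2 -> nat) -> {poly K}).

Record fock_op := FockOp { fock_fun :> fock -> fock; fock_linear : linear fock_fun }.

HB.instance Definition _ := gen_eqMixin fock_op.
HB.instance Definition _ := gen_choiceMixin fock_op.

Lemma fock_opP (a b : fock_op) : (forall f, a f = b f) -> a = b.
Proof.
case: a b => [a la] [b lb] /= /funext ab.
by case: _ / ab lb => lb; congr FockOp; apply: Prop_irrelevance.
Qed.

Lemma fock_opD (a : fock_op) f g : a (f + g) = a f + a g.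
Proof. by have := fock_linear a 1 f g; rewrite !scale1r. Qed.

Lemma fock_op0 (a : fock_op) : a 0 = 0.
Proof. by apply: (addIr (a 0)); rewrite -fock_opD !add0r. Qed.

Lemma fock_opZ (a : fock_op) c f : a (c *: f) = c *: a f.
Proof. by have := fock_linear a c f 0; rewrite fock_op0 !addr0. Qed.

Fact fadd_linear (a b : fock_op) : linear (fun f => a f + b f).
Proof. by move=> c f g; rewrite !fock_linear scalerDr addrACA. Qed.
Definition fadd a b := FockOp (fadd_linear a b).
Fact fzero_linear : linear (fun _ : fock => 0 : fock).
Proof. by move=> c f g; rewrite scaler0 addr0. Qed.
Definition fzero := FockOp fzero_linear.
Fact fopp_linear (a : fock_op) : linear (fun f => - a f).
Proof. by move=> c f g; rewrite fock_linear opprD scalerN. Qed.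
Definition fopp a := FockOp (fopp_linear a).
Fact fmul_linear (a b : fock_op) : linear (fun f => a (b f)).
Proof. by move=> c f g; rewrite !fock_linear. Qed.
Definition fmul a b := FockOp (fmul_linear a b).
Fact fone_linear : linear (fun f : fock => f).
Proof. by []. Qed.
Definition fone := FockOp fone_linear.
Fact fscale_linear c (a : fock_op) : linear (fun f => c *: a f).
Proof. by move=> d f g; rewrite fock_linear scalerDr !scalerA mulrC. Qed.
Definition fscale c a := FockOp (fscale_linear c a).

Fact faddA : associative fadd.
Proof. by move=> a b c; apply: fock_opP => f /=; rewrite addrA. Qed.
Fact faddC : commutative fadd.
Proof. by move=> a b; apply: fock_opP => f /=; rewrite addrC. Qed.
Fact fadd0 : left_id fzero fadd.
Proof. by move=> a; apply: fock_opP => f /=; rewrite add0r. Qed.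
Fact faddN : left_inverse fzero fopp fadd.
Proof. by move=> a; apply: fock_opP => f /=; rewrite addNr. Qed.

HB.instance Definition _ := GRing.isZmodule.Build fock_op faddA faddC fadd0 faddN.

Fact fmulA : associative fmul.
Proof. by move=> a b c; apply: fock_opP. Qed.
Fact fmul1 : left_id fone fmul.
Proof. by move=> a; apply: fock_opP. Qed.
Fact fmulr1 : right_id fone fmul.
Proof. by move=> a; apply: fock_opP. Qed.
Fact fmulDl : left_distributive fmul fadd.
Proof. by move=> a b c; apply: fock_opP. Qed.
Fact fmulDr : right_distributive fmul fadd.
Proof. by move=> a b c; apply: fock_opP => f /=; rewrite fock_opD. Qed.
Fact fone_neq0 : fone != 0.
Proof.
apply/eqP => /(congr1 (fun a : fock_op => a (fun=> 1) (fun=> 0%N))) /= /eqP.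
by rewrite oner_eq0.
Qed.

HB.instance Definition _ := GRing.Zmodule_isNzRing.Build fock_op
  fmulA fmul1 fmulr1 fmulDl fmulDr fone_neq0.

Fact fscaleA c d a : fscale c (fscale d a) = fscale (c * d) a.
Proof. by apply: fock_opP => f /=; rewrite scalerA. Qed.
Fact fscale1 : left_id 1 fscale.
Proof. by move=> a; apply: fock_opP => f /=; rewrite scale1r. Qed.
Fact fscaleDr : right_distributive fscale +%R.
Proof. by move=> c a b; apply: fock_opP => f /=; rewrite scalerDr. Qed.
Fact fscaleDl a : {morph fscale^~ a : c d / c + d}.
Proof. by move=> c d; apply: fock_opP => f /=; rewrite scalerDl. Qed.

HB.instance Definition _ := GRing.Zmodule_isLmodule.Build K fock_op
  fscaleA fscale1 fscaleDr fscaleDl.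

Fact fscaleAl (c : K) (a b : fock_op) : c *: (a * b) = (c *: a) * b.
Proof. exact: fock_opP. Qed.

HB.instance Definition _ := GRing.Lmodule_isLalgebra.Build K fock_op fscaleAl.

Fact fscaleAr (c : K) (a b : fock_op) : c *: (a * b) = a * (c *: b).
Proof. by apply: fock_opP => f; rewrite /= fock_opZ. Qed.

HB.instance Definition _ := GRing.Lalgebra_isAlgebra.Build K fock_op fscaleAr.

Lemma fock_opDE (a b : fock_op) f : (a + b) f = a f + b f.
Proof. by []. Qed.
Lemma fock_opME (a b : fock_op) f : (a * b) f = a (b f).
Proof. by []. Qed.
Lemma fock_opZE c (a : fock_op) f : (c *: a) f = c *: a f.
Proof. by []. Qed.

Section Weyl.
(* Evaluation point of x_(k,i) and slope of the translate of d/dx_(k,i). *)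
Variables (x p : nat * 'I_2 -> K).
Implicit Types (l m : nat * 'I_2) (e : nat * 'I_2 -> nat).

Definition upd e l v : nat * 'I_2 -> nat := fun m => if m == l then v else e m.

Lemma updE e l v : upd e l v l = v. Proof. by rewrite /upd eqxx. Qed.
Lemma upd_neq e l m v : m != l -> upd e l v m = e m.
Proof. by rewrite /upd => /negPf->. Qed.
Lemma upd_upd e l v w : upd (upd e l v) l w = upd e l w.
Proof. by apply/funext => m; rewrite /upd; case: eqP. Qed.
Lemma updC e l m v w : l != m -> upd (upd e l v) m w = upd (upd e m w) l v.
Proof.
move=> lm; apply/funext => k; rewrite /upd.
by case: (eqVneq k m) => [->|//]; rewrite eq_sym (negPf lm).
Qed.
Lemma upd_id e l : upd e l (e l) = e.
Proof. by apply/funext => m; rewrite /upd; case: eqP => [->|]. Qed.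

(** [Xfun] multiplies by the coordinate expanded at the point x, and [Dfun] is the derivative
    conjugated by the exponential of z times the linear form p. The degree in z thus counts
    derivatives, and the top coefficient at the constant term is the principal symbol at (x, p). *)
Definition Xfun l (f : fock) : fock := fun e =>
  x l *: f e + (if e l is v.+1 then f (upd e l v) else 0).
Definition Dfun l (f : fock) : fock := fun e =>
  p l *: ('X * f e) + (e l).+1%:R *: f (upd e l (e l).+1).

Fact Xfun_linear l : linear (Xfun l).
Proof.
move=> c f g; apply/funext => e; rewrite /Xfun /=.
have fE (a b : fock) h : (c *: a + b) h = c *: a h + b h by [].
rewrite !fE; case: (e l) => [|v]; rewrite ?fE !scalerDr !scalerA ?scaler0 ?addr0.
  by rewrite mulrC.
by rewrite mulrC addrACA.
Qed.
Definition Xop l := FockOp (Xfun_linear l).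

Fact Dfun_linear l : linear (Dfun l).
Proof.
move=> c f g; apply/funext => e; rewrite /Dfun.
have fE (a b : fock) h : (c *: a + b) h = c *: a h + b h by [].
rewrite !fE mulrDr -scalerAr !scalerDr !scalerA addrACA.
by congr (_ + _); rewrite ?(mulrC (p l)) ?(mulrC _%:R).
Qed.
Definition Dop l := FockOp (Dfun_linear l).

Lemma Xop_comm l m : Xop l * Xop m = Xop m * Xop l.
Proof.
have [->//|lm] := eqVneq l m.
apply: fock_opP => f; apply/funext => e; rewrite !fock_opME /= /Xfun.
have ml : m != l by rewrite eq_sym.
have u_ml v : upd e m v l = e l by rewrite upd_neq.
have u_lm v : upd e l v m = e m by rewrite upd_neq.
case El: (e l) => [|v]; case Em: (e m) => [|w];
  rewrite ?u_ml ?u_lm ?El ?Em ?addr0 ?scalerDr ?addr0 !scalerA ?(mulrC (x m)) //.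
by rewrite (updC _ _ _ lm) -!addrA; congr (_ + _); rewrite !addrA [X in X + _ = _]addrC.
Qed.

Lemma Dop_comm l m : Dop l * Dop m = Dop m * Dop l.
Proof.
have [->//|lm] := eqVneq l m.
apply: fock_opP => f; apply/funext => e; rewrite !fock_opME /= /Dfun.
have ml : m != l by rewrite eq_sym.
rewrite !upd_neq // (updC _ _ _ lm) !mulrDr !scalerDr -!scalerAr !scalerA.
rewrite (mulrC (p m)) (mulrC (_%:R) (_%:R)) -!addrA; congr (_ + _).
by rewrite !addrA (mulrC (p m)) (mulrC (p l)) [X in X + _ = _]addrC.
Qed.

Lemma DX_comm l m : Dop l * Xop m = Xop m * Dop l + ((l == m)%:R : K)%:A.
Proof.
apply: fock_opP => f; apply/funext => e; rewrite fock_opDE !fock_opME fock_opZE.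
change (Dfun l (Xfun m f) e = Xfun m (Dfun l f) e + (l == m)%:R *: f e).
rewrite /Dfun /Xfun; have [<-|lm] := eqVneq l m.
  rewrite updE upd_upd upd_id scale1r.
  case E: (e l) => [|v].
    by rewrite !addr0 !scale1r !scalerDr -!scalerAr !scalerA (mulrC (x l)) addrA.
  rewrite updE upd_upd -E upd_id !mulrDr !scalerDr -!scalerAr !scalerA.
  rewrite (mulrC (x l)) (mulrC (x l)) -natr1 !scalerDl scale1r.
  by rewrite [LHS]addrACA !addrA.
rewrite mulr0n scale0r addr0 upd_neq 1?eq_sym //.
case E: (e m) => [|v].
  by rewrite !addr0 !scalerDr -!scalerAr !scalerA (mulrC (x m)) (mulrC (x m)).
rewrite upd_neq // (updC _ _ _ lm) !mulrDr !scalerDr -!scalerAr !scalerA.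
by rewrite (mulrC (x m)) (mulrC (x m)) addrACA.
Qed.

(** The action of gl_2 by the operators x_i d/dx_j, one copy for each site k. *)
Definition site k i j : fock_op := Xop (k, i) * Dop (k, j).

Lemma site_gl2 k : gl2_rel (site k).
Proof.
rewrite /gl2_rel /bracket /site.
have XDXD (i j a b : 'I_2) :
    Xop (k, i) * Dop (k, j) * (Xop (k, a) * Dop (k, b)) =
    Xop (k, i) * Xop (k, a) * (Dop (k, j) * Dop (k, b))
    + (j == a)%:R * (Xop (k, i) * Dop (k, b)).
  rewrite -mulrA (mulrA (Dop _)) DX_comm mulrDl mulrDr -!mulrA; congr (_ + _).
  rewrite xpair_eqE eqxx /=; case: eqP => _.
    by rewrite scale1r !mul1r.
  by rewrite scale0r !mul0r mulr0.
move=> i j a b; rewrite !XDXD (Xop_comm (k, a)) (Dop_comm (k, b)).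
by rewrite opprD addrACA subrr add0r.
Qed.

Lemma site_comm k k' i j a b : k != k' -> GRing.comm (site k i j) (site k' a b).
Proof.
move=> kk'; have DX (m n : nat) (u v : 'I_2) : m != n -> GRing.comm (Dop (m, u)) (Xop (n, v)).
  by move=> mn; rewrite /GRing.comm DX_comm xpair_eqE (negPf mn) scale0r addr0.
apply: commrM; apply: commr_sym; apply: commrM; apply: commr_sym.
- exact: Xop_comm.
- by apply: DX.
- by apply/commr_sym/DX; rewrite eq_sym.
- exact: Dop_comm.
Qed.

(* T(u) = (1 + E_0 u^-1) ... (1 + E_(n-1) u^-1), of classical limit
   the product of the 1 + X_k u^-1 where X_k = x_k p_k^T. *)
Fixpoint chain n : 'I_2 -> 'I_2 -> nat -> fock_op :=
  if n is n'.+1 then mul_site (chain n') (site n')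
  else fun i j r => ((i == j) && (r == 0%N))%:R.

Lemma chain_comm n k i j r a b : (n <= k)%N -> GRing.comm (chain n i j r) (site k a b).
Proof.
elim: n i j r => [|n IH] i j r nk; first exact/commr_sym/commr_nat.
apply/commr_sym/commrD; first exact/commr_sym/IH/ltnW.
apply: commr_sum => c _; apply: commrM; last first.
  by apply: site_comm; rewrite gtn_eqF.
by case: r => [|r]; [exact: commr0|apply/commr_sym/IH/ltnW].
Qed.

Lemma chain_rtt n : rtt (chain n).
Proof.
elim: n => [|n IH]; first exact: rtt_trivial.
by apply: rtt_mul_site IH (site_gl2 n) _ => i j r a b; apply: chain_comm.
Qed.

Definition site_mx k : 'M[{poly K}]_2 :=
  1%:M + \matrix_(i, j) ((x (k, i) * p (k, j)) *: 'X).
Fixpoint chain_mx n : 'M[{poly K}]_2 :=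
  if n is n'.+1 then chain_mx n' *m site_mx n' else 1%:M.

Definition zfil n (f : fock) := forall e, (size (f e) <= n.+1)%N.
Definition zcoef n (f : fock) : K := (f (fun=> 0%N))`_n.

(* a raises the degree in z by at most d, with leading term c at the point x. *)
Definition has_symbol d (c : K) (a : fock_op) := forall n f, zfil n f ->
  zfil (n + d) (a f) /\ zcoef (n + d) (a f) = c * zcoef n f.

Lemma has_symbolD d c c' a b : has_symbol d c a -> has_symbol d c' b ->
  has_symbol d (c + c') (a + b).
Proof.
move=> sa sb n f fn; have [fa ca] := sa n f fn; have [fb cb] := sb n f fn.
split=> [e|]; first by rewrite (leq_trans (size_polyD _ _)) // geq_max fa fb.
by rewrite /zcoef coefD mulrDl; congr (_ + _).
Qed.

Lemma has_symbolZ d c k a : has_symbol d c a -> has_symbol d (k * c) (k *: a).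
Proof.
move=> sa n f fn; have [fa ca] := sa n f fn.
split=> [e|]; first by rewrite (leq_trans (size_scale_leq _ _)).
by rewrite /zcoef coefZ -mulrA; congr (_ * _).
Qed.

Lemma has_symbolM d d' c c' a b : has_symbol d c a -> has_symbol d' c' b ->
  has_symbol (d + d') (c * c') (a * b).
Proof.
move=> sa sb n f fn; have [fb cb] := sb n f fn; have [fa ca] := sa _ _ fb.
by rewrite (addnC d) addnA -mulrA -cb; split.
Qed.

Lemma has_symbol1 : has_symbol 0 1 1.
Proof. by move=> n f fn; rewrite addn0 mul1r. Qed.

Lemma has_symbol0 d : has_symbol d 0 0.
Proof.
move=> n f fn; rewrite mul0r; split; last by rewrite /zcoef coef0.
by move=> e; rewrite size_poly0.
Qed.

Lemma has_symbol_lt d d' c a : (d < d')%N -> has_symbol d c a -> has_symbol d' 0 a.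
Proof.
move=> dd' sa n f /sa[fa _]; rewrite mul0r; split.
  by move=> e; rewrite (leq_trans (fa e)) // ltnS leq_add2l ltnW.
by apply/nth_default/(leq_trans (fa _)); rewrite ltn_add2l.
Qed.

Lemma has_symbol_sum d (I : Type) (r : seq I) (P : pred I) (c : I -> K) (F : I -> fock_op) :
  (forall i, P i -> has_symbol d (c i) (F i)) ->
  has_symbol d (\sum_(i <- r | P i) c i) (\sum_(i <- r | P i) F i).
Proof.
by move=> sF; apply: (big_rec2 (has_symbol d)) => [|i a b /sF ? ?];
  [exact: has_symbol0|exact: has_symbolD].
Qed.

(** The shift part of [Xfun] does not reach the constant term. *)
Lemma Xop_symbol l : has_symbol 0 (x l) (Xop l).
Proof.
move=> n f fn; rewrite addn0; split=> [e|]; last by rewrite /zcoef /= /Xfun addr0 coefZ.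
rewrite /= /Xfun (leq_trans (size_polyD _ _)) // geq_max.
rewrite (leq_trans (size_scale_leq _ _)) //=.
by case: (e l) => [|v]; rewrite ?size_poly0.
Qed.

(** The derivative part of [Dfun] does not raise the degree in z, hence is absent from the leading
    term. *)
Lemma Dop_symbol l : has_symbol 1 (p l) (Dop l).
Proof.
move=> n f fn; rewrite addn1; split=> [e|].
  rewrite /= /Dfun (leq_trans (size_polyD _ _)) // geq_max.
  apply/andP; split; apply: leq_trans (size_scale_leq _ _) _; last exact: leqW (fn _).
  have [->|f0] := eqVneq (f e) 0; first by rewrite mulr0 size_poly0.
  by rewrite mulrC size_mulX // ltnS; apply: fn.
rewrite /zcoef /= /Dfun coefD !coefZ coefXM /=.
by rewrite [X in _ + _ * X]nth_default ?mulr0 ?addr0 //; apply: fn.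
Qed.

Lemma site_symbol k i j : has_symbol 1 (x (k, i) * p (k, j)) (site k i j).
Proof. exact: has_symbolM (Xop_symbol _) (Dop_symbol _). Qed.

Lemma chain_symbol n i j r : has_symbol r (chain_mx n i j)`_r (chain n i j r).
Proof.
elim: n i j r => [|n IH] i j r.
  rewrite /= !mxE coefMn coef1; case: r => [|r].
    by rewrite andbT eqxx; case: (i == j); [exact: has_symbol1|exact: has_symbol0].
  by rewrite andbF mul0rn; exact: has_symbol0.
have -> : (chain_mx n.+1 i j)`_r = (chain_mx n i j)`_r + \sum_a
    (if r is r'.+1 then (chain_mx n i a)`_r' else 0) * (x (n, a) * p (n, j)).
  rewrite /= mulmxDr mulmx1 mxE coefD; congr (_ + _).
  rewrite mxE coef_sum; apply: eq_bigr => a _.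
  rewrite !mxE -scalerAr coefZ coefMX mulrC.
  by case: r.
apply: has_symbolD => //; apply: has_symbol_sum => a _.
case: r => [|r]; first by rewrite !mul0r; exact: has_symbol0.
rewrite -addn1; apply: has_symbolM => //; exact: site_symbol.
Qed.

End Weyl.
End Fock.

(** * Universal property and symbols of Y(gl_2) *)

Section Lift.
Variable K : fieldType.

Lemma yfree_lift (A : algType K) (t : 'I_2 -> 'I_2 -> nat -> A) :
  (forall i j, t i j 0%N = (i == j)%:R) ->
  exists e : yfree K -> A, [/\ forall a x y, e (a *: x + y) = a *: e x + e y,
    forall x y, e (x * y) = e x * e y, e 1 = 1 &
    forall i j r, e (yfree_t K i j r) = t i j r].
Proof.
move=> t0.
pose h (m : fmonom ('I_2 * 'I_2 * nat)%type) : A :=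
  \prod_(g <- fmonom_val m) t g.1.1 g.1.2 g.2.+1.
have hM : mmorphism h.
  split=> [m n|].
    by rewrite /h fmM big_cat.
  by rewrite /h fm1 big_nil.
pose H := monalg.isMultiplicative.Build _ _ h hM.
pose hh : MMorphism.type _ _ := HB.pack h H.
pose f : {rmorphism K -> A} := in_alg A.
have fC c a : GRing.comm (f c) a by rewrite /GRing.comm /f /= mulr_algl mulr_algr.
have [eM e1] := @commr_mmap_is_multiplicative _ _ _ f hh (fun g m m' => fC _ _).
have eD := @mmapD _ _ _ f hh.
have eZ := @mmapZ _ _ _ f hh.
have eU i j r : mmap f hh (mkmalgU (fmu (i, j, r)) 1) = t i j r.+1.
  rewrite mmapU /f /= scale1r mul1r /h fmU big_seq1 //.
exists (mmap f hh); split.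
- by move=> a x y; rewrite eD eZ /f /= mulr_algl.
- by move=> x y; apply: eM.
- by [].
- move=> i j [|r]; last exact: eU.
  rewrite /yfree_t t0; case: (i == j) => /=; first exact: e1.
  exact: (@mmap0 _ _ _ f hh).
Qed.
End Lift.

Lemma lspanM (K : fieldType) (A : algType K) (S S' W : set A) : subspace W ->
  (forall x y, S x -> S' y -> W (x * y)) ->
  forall x y, lspan S x -> lspan S' y -> W (x * y).
Proof.
move=> [W0 WD] SW x y Sx Sy; move: x Sx; apply: (@lspan_min _ _ _ [set x | W (x * y)]).
  split=> /= [|a x x' Wx Wx']; first by rewrite mul0r.
  by rewrite mulrDl -scalerAl; apply: WD.
move=> x Sx /=; move: y Sy; apply: (@lspan_min _ _ _ [set y | W (x * y)]).
  split=> /= [|a y y' Wy Wy']; first by rewrite mulr0.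
  by rewrite mulrDr -scalerAr; apply: WD.
by move=> y; apply: SW.
Qed.

(* The degree N component of an element of A in the associated graded algebra,
   evaluated at the classical matrix T(u^-1). *)
Record symbol_at (K : fieldType) (A : algType K) (t : 'I_2 -> 'I_2 -> nat -> A)
    (F : nat -> set A) (T : 'M[{poly K}]_2) (S : nat -> A -> K) : Prop := SymbolAt {
  symbol_linear : forall N a x y, S N (a *: x + y) = a * S N x + S N y;
  symbol1 : S 0%N 1 = 1;
  symbolM : forall M N x y, F M x -> F N y -> S (M + N)%N (x * y) = S M x * S N y;
  symbol_lt : forall M N x, (M < N)%N -> F M x -> S N x = 0;
  symbol_t : forall i j r, S r (t i j r) = (T i j)`_r }.

(** The symbol is read off from the action on one vector. It is multiplicative because, for y in F
    N, the operator [rho y] has a symbol valid on all vectors; this is checked on the spanning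
    words. *)
Lemma symbol_of_rep (K : fieldType) (A : algType K) (t : 'I_2 -> 'I_2 -> nat -> A)
    (F : nat -> set A) (x p : nat * 'I_2 -> K) n (rho : A -> fock_op K) :
  (forall a y z, rho (a *: y + z) = a *: rho y + rho z) ->
  (forall y z, rho (y * z) = rho y * rho z) -> rho 1 = 1 ->
  (forall i j r, rho (t i j r) = chain x p n i j r) ->
  (forall N, F N = lspan [set y | exists2 w : seq ('I_2 * 'I_2 * nat),
     (\sum_(g <- w) g.2 <= N)%N & y = \prod_(g <- w) t g.1.1 g.1.2 g.2]) ->
  exists S, symbol_at t F (chain_mx x p n) S.
Proof.
move=> rL rM r1 rt FE.
(* All that matters is that [vac] has degree 0 in z and constant term 1. *)
pose vac : fock K := fun=> 1.
have vac0 : zfil 0 vac by move=> e; rewrite size_poly1.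
have cvac : zcoef 0 vac = 1 by rewrite /zcoef coef1.
pose S N y := zcoef N (rho y vac).
have symE N c y : has_symbol N c (rho y) -> S N y = c.
  by move=> /(_ 0%N vac vac0)[_]; rewrite add0n cvac mulr1.
have symex N y : F N y -> exists c, has_symbol N c (rho y).
  rewrite FE; move: y.
  apply: (@lspan_min _ _ _ [set y | exists c, has_symbol N c (rho y)]).
    have rho0 : rho 0 = 0.
      by have := rL (-1) 0 0; rewrite !scaleN1r oppr0 addr0 => ->; rewrite addNr.
    split=> [|a y z [c yc] [d zd]]; first by exists 0; rewrite rho0; apply: has_symbol0.
    by exists (a * c + d); rewrite rL; apply: has_symbolD => //; apply: has_symbolZ.
  move=> _ [w wN ->].
  have [c sc] : exists c, has_symbol (\sum_(g <- w) g.2) c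
      (rho (\prod_(g <- w) t g.1.1 g.1.2 g.2)).
    elim: w {wN} => [|g w [c IH]].
      by exists 1; rewrite !big_nil r1; apply: has_symbol1.
    rewrite !big_cons rM; exists ((chain_mx x p n g.1.1 g.1.2)`_g.2 * c).
    by apply: has_symbolM => //; rewrite rt; apply: chain_symbol.
  move: wN; rewrite leq_eqVlt => /orP[/eqP <-|wN]; first by exists c.
  by exists 0; apply: has_symbol_lt wN sc.
have symP N y : F N y -> has_symbol N (S N y) (rho y).
  by move=> /symex[c yc]; rewrite (symE _ _ _ yc).
exists S; split.
- by move=> N a y z; rewrite /S rL /zcoef coefD coefZ.
- by apply: symE; rewrite r1; apply: has_symbol1.
- by move=> M N y z /symP My /symP Nz; apply: symE; rewrite rM; apply: has_symbolM.
- by move=> M N y MN /symP My; apply: symE; apply: has_symbol_lt MN My.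
- by move=> i j r; apply: symE; rewrite rt; apply: chain_symbol.
Qed.

(* An interface hiding the construction of Y(gl_2), which unification would
   unfold. *)
Record yangian_like (K : fieldType) (A : algType K) (t : 'I_2 -> 'I_2 -> nat -> A)
    (F : nat -> set A) : Prop := YangianLike {
  yl_rtt : rtt t;
  yl_subspace : forall N, subspace (F N);
  yl_le : forall M N, (M <= N)%N -> F M `<=` F N;
  yl_1 : F 0%N 1;
  yl_t : forall i j r, F r (t i j r);
  yl_M : forall M N x y, F M x -> F N y -> F (M + N)%N (x * y);
  yl_symbol : forall x p n, exists S, symbol_at t F (chain_mx x p n) S }.

Section YangianBasics.
Variable K : fieldType.
Local Notation Y := (yangian K).
Local Notation t := (@yt K).
Local Open Scope quotient_scope.

Lemma morph_yrel (L : lalgType K) (A : nzRingType) (f : L -> A)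
    (fD : forall x y, f (x + y) = f x + f y) (fM : forall x y, f (x * y) = f x * f y)
    (a b c d e g h l : L) :
  f (bracket a b - bracket c d - (e * g - h * l)) =
  bracket (f a) (f b) - bracket (f c) (f d) - (f e * f g - f h * f l).
Proof.
have f0 : f 0 = 0 by apply: (addIr (f 0)); rewrite -fD !add0r.
have fN x : f (- x) = - f x by apply: (addIr (f x)); rewrite -fD !addNr.
by rewrite /bracket !fD !fN !fD !fN !fM.
Qed.

Section LinearMultiplicative.
Variables (L : lalgType K) (A : algType K) (f : L -> A).
Hypothesis fL : forall a x y, f (a *: x + y) = a *: f x + f y.

Lemma linear_funD x y : f (x + y) = f x + f y.
Proof. by rewrite -[x]scale1r fL !scale1r. Qed.

Lemma linear_funB x y : f (x - y) = f x - f y.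
Proof. by rewrite addrC -scaleN1r fL scaleN1r addrC. Qed.

Lemma kernel_ideal : (forall x y, f (x * y) = f x * f y) ->
  two_sided_ideal [set x | f x = 0].
Proof.
move=> fM; split; last by move=> a x /= fx; rewrite !fM fx mulr0 mul0r.
apply/submod_closedP; split=> [|a x y /= fx fy].
  by rewrite /= -(subrr 0) linear_funB subrr.
by rewrite fL fx fy scaler0 addr0.
Qed.
End LinearMultiplicative.

Lemma yt0 i j : t i j 0 = (i == j)%:R.
Proof. by rewrite /yt /=; case: (i == j). Qed.

Lemma yt_rtt : rtt t.
Proof.
split; first exact: yt0.
move=> i j k l r s; apply/eqP; rewrite -subr_eq0; apply/eqP.
transitivity (\pi_Y (yrel K i j k l r s) : Y).
  exact: esym (@morph_yrel (yfree K) Y (\pi_Y) (@pi_yD K) (@pi_yM K) _ _ _ _ _ _ _ _).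
suff -> : \pi_Y (yrel K i j k l r s) = \pi_Y (0 : yfree K) :> Y by [].
apply/pi_yP; rewrite subr0 => J [_ SJ]; apply: SJ.
by exists i, j, k, l, r, s.
Qed.

Lemma yangian_lift (A : algType K) (u : 'I_2 -> 'I_2 -> nat -> A) : rtt u ->
  exists rho : Y -> A, [/\ forall a x y, rho (a *: x + y) = a *: rho x + rho y,
    forall x y, rho (x * y) = rho x * rho y, rho 1 = 1 &
    forall i j r, rho (t i j r) = u i j r].
Proof.
move=> [u0 uR]; have [e [eL eM e1 et]] := yfree_lift u0.
have eI x : yideal x -> e x = 0.
  apply: (smallest_sub (kernel_ideal eL eM)) => _ [i [j [k [l [r [s ->]]]]]].
  apply: etrans (morph_yrel (linear_funD eL) eM _ _ _ _ _ _ _ _) _.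
  by rewrite !et uR subrr.
have epi x : e (repr (\pi_Y x : Y)) = e x.
  by apply/eqP; rewrite -subr_eq0 -(linear_funB eL); apply/eqP; exact: (eI _ (yreprB x)).
exists (fun y => e (repr y)); split.
- move=> a x y; case: (ysurj x) (ysurj y) => {}x -> [{}y ->].
  by rewrite -pi_yZ -pi_yD !epi eL.
- move=> x y; case: (ysurj x) (ysurj y) => {}x -> [{}y ->].
  by rewrite -pi_yM !epi eM.
- exact: etrans (epi 1) e1.
- by move=> i j r; rewrite epi et.
Qed.

Lemma yfil_subspace N : subspace (@yfil K N).
Proof. exact: lspan_subspace. Qed.

Lemma yfil_le M N : (M <= N)%N -> @yfil K M `<=` @yfil K N.
Proof. by move=> MN; apply: lspanS => x [w wM ->]; exists w => //; apply: leq_trans MN. Qed.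

Lemma yfil1 : @yfil K 0 1.
Proof. by apply: mem_lspan; exists [::]; rewrite !big_nil. Qed.

Lemma yfil_t i j r : @yfil K r (t i j r).
Proof. by apply: mem_lspan; exists [:: (i, j, r)]; rewrite !big_seq1. Qed.

Lemma yfilM M N x y : @yfil K M x -> @yfil K N y -> @yfil K (M + N) (x * y).
Proof.
apply: (lspanM (yfil_subspace (M + N))) => _ _ [w wM ->] [w' wN ->].
apply: mem_lspan; exists (w ++ w'); last by rewrite big_cat.
by rewrite big_cat leq_add.
Qed.

Lemma yangian_is_yangian_like : yangian_like t (@yfil K).
Proof.
split.
- exact: yt_rtt.
- exact: yfil_subspace.
- exact: yfil_le.
- exact: yfil1.
- exact: yfil_t.
- exact: yfilM.
- move=> x p n; have [rho [rL rM r1 rt]] := yangian_lift (chain_rtt x p n).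
  exact: symbol_of_rep rL rM r1 rt (fun N => erefl).
Qed.

End YangianBasics.

(** * Classical limits *)

Section Classical.
Variable K : numClosedFieldType.
Implicit Types T : 'M[{poly K}]_2.

Definition realizable T := exists x p n, T = chain_mx x p n.

Definition rank1 (u v : 'I_2 -> K) : 'M[{poly K}]_2 := \matrix_(i, j) (u i * v j)%:P.

Lemma chain_mx_ext (x p x' p' : nat * 'I_2 -> K) n :
  (forall k i, (k < n)%N -> x (k, i) = x' (k, i) /\ p (k, i) = p' (k, i)) ->
  chain_mx x p n = chain_mx x' p' n.
Proof.
elim: n => [//|n IH] E; rewrite /= IH; last by move=> k i kn; apply/E/ltnW.
congr (_ *m (_ + _)); apply/matrixP => i j; rewrite !mxE.
by have [-> _] := E n i (ltnSn n); have [_ ->] := E n j (ltnSn n).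
Qed.

Lemma realizable_site T u v : realizable T -> realizable (T *m (1%:M + 'X *: rank1 u v)).
Proof.
move=> [x [p [n ->]]].
exists (fun l => if l.1 == n then u l.2 else x l), (fun l => if l.1 == n then v l.2 else p l), n.+1.
rewrite /=; congr (_ *m (_ + _)).
  by apply: chain_mx_ext => k i kn /=; rewrite ltn_eqF.
by apply/matrixP => i j; rewrite !mxE /= eqxx mulrC mul_polyC.
Qed.

(** Since [rank1 u v] is idempotent, the matrix 1 + (q - 1) [rank1 u v] is multiplicative in q. Over
    a closed field, q with constant term 1 is a product of factors 1 - X / z over its roots z, and
    each factor is one site. *)
Lemma realizable_poly T (u v : 'I_2 -> K) (q : {poly K}) : realizable T -> u 0 * v 0 + u 1 * v 1 = 1 ->
  q`_0 = 1 -> realizable (T *m (1%:M + (q - 1) *: rank1 u v)).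
Proof.
move=> rT uv q0.
have R2 : rank1 u v *m rank1 u v = rank1 u v.
  apply/matrixP => i j; rewrite !mxE !big_ord_recl big_ord0 !mxE addr0.
  have -> : lift ord0 ord0 = 1 :> 'I_2 by apply: val_inj.
  rewrite -!rmorphM -rmorphD; congr (_%:P).
  by rewrite -[RHS]mulr1 -uv; ring.
have [s qE] := closed_field_poly_normal q.
have q_neq0 : q != 0 by apply/eqP => qz; move: q0; rewrite qz coef0 => /eqP; rewrite eq_sym oner_eq0.
have s0 z : z \in s -> z != 0.
  move=> zs; apply/eqP => z0; move: q0; rewrite -horner_coef0 qE hornerZ horner_prod.
  rewrite (big_rem z) //= hornerXsubC z0 subrr mul0r mulr0 => /eqP.
  by rewrite eq_sym oner_eq0.
have {qE} -> : q = \prod_(z <- s) (1 + (- z^-1) *: 'X).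
  have -> : \prod_(z <- s) (1 + (- z^-1) *: 'X) =
      (\prod_(z <- s) (- z^-1)) *: \prod_(z <- s) ('X - z%:P).
    elim: s s0 {qE} => [|z s IH] s0; first by rewrite !big_nil scale1r.
    rewrite !big_cons IH => [|w ws]; last by apply: s0; rewrite inE ws orbT.
    have -> : 1 + - z^-1 *: 'X = (- z^-1)%:P * ('X - z%:P).
      rewrite mulrBr -polyCM mulNr mulVf ?s0 ?mem_head // (polyCN 1) opprK addrC.
      by rewrite mul_polyC.
    by rewrite -!mul_polyC polyCM; ring.
  rewrite {1}qE; congr (_ *: _).
  move: q0; rewrite -horner_coef0 {1}qE hornerZ horner_prod => q0.
  apply: (@mulIf _ (\prod_(z <- s) (- z))).
    rewrite prodf_seq_neq0; apply/allP => z zs /=; rewrite oppr_eq0; exact: s0.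
  have -> : (\prod_(z <- s) (- z^-1)) * (\prod_(z <- s) (- z)) = 1.
    rewrite -big_split /= big_seq big1 // => z zs.
    by rewrite mulrNN mulVf // s0.
  rewrite -[RHS]q0; congr (_ * _); apply: eq_bigr => z _.
  by rewrite hornerXsubC sub0r.
elim: s {s0} => [|z s IH]; first by rewrite big_nil subrr scale0r addr0 mulmx1.
rewrite big_cons; set q' := \prod_(_ <- _) _ in IH *.
have -> : T *m (1%:M + ((1 + - z^-1 *: 'X) * q' - 1) *: rank1 u v) =
    (T *m (1%:M + (q' - 1) *: rank1 u v)) *m
    (1%:M + 'X *: rank1 u (fun i => - z^-1 * v i)).
  rewrite -mulmxA; congr (_ *m _).
  have -> : 'X *: rank1 u (fun i => - z^-1 * v i) = (- z^-1 *: 'X) *: rank1 u v.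
    apply/matrixP => i j; rewrite !mxE -mul_polyC !polyCM; ring.
  rewrite mulmxDl mul1mx mulmxDr mulmx1 -scalemxAl -scalemxAr R2.
  rewrite -addrA; congr (_ + _).
  by rewrite !scalerA -!scalerDl; congr (_ *: _); ring.
exact: realizable_site.
Qed.

Lemma realizable_coef0 T i j : realizable T -> (T i j)`_0 = (i == j)%:R.
Proof.
move=> [x [p [n ->]]]; elim: n i j => [|n IH] i j.
  by rewrite /= mxE coefMn coef1.
rewrite /= mulmxDr mulmx1 mxE coefD IH mxE coef_sum big1 ?addr0 // => a _.
by rewrite mxE -scalerAr coefZ coefMX mulr0.
Qed.

Definition approx N T T' := forall i j r, (r <= N)%N -> (T i j)`_r = (T' i j)`_r.

(** Multiply by the factor with q = 1 + c X^(N+1). As T has constant term 1, exactly c times the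
    projection is added in degree N + 1. *)
Lemma realizable_step T N c (u v : 'I_2 -> K) : realizable T -> u 0 * v 0 + u 1 * v 1 = 1 ->
  exists T', [/\ realizable T', approx N T T' &
    forall i j, (T' i j)`_N.+1 = (T i j)`_N.+1 + c * (u i * v j)].
Proof.
move=> rT uv; pose q : {poly K} := 1 + c *: 'X^(N.+1).
have q0 : q`_0 = 1 by rewrite coefD coef1 coefZ coefXn mulr0 addr0.
exists (T *m (1%:M + (q - 1) *: rank1 u v)).
have coefT' i j r : ((T *m (1%:M + (q - 1) *: rank1 u v)) i j)`_r =
    (T i j)`_r + \sum_a (if (r < N.+1)%N then 0 else (T i a)`_(r - N.+1)) * (c * (u a * v j)).
  rewrite mulmxDr mulmx1 mxE coefD mxE coef_sum; congr (_ + _); apply: eq_bigr => a _.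
  have -> : T i a * ((q - 1) *: rank1 u v) a j = (c * (u a * v j)) *: (T i a * 'X^(N.+1)).
    by rewrite !mxE /q addrAC subrr add0r -!mul_polyC !polyCM; ring.
  by rewrite coefZ coefMXn mulrC.
split.
- exact: realizable_poly.
- move=> i j r rN; rewrite coefT' ltnS rN big1 ?addr0 // => a _; exact: mul0r.
- move=> i j; rewrite coefT' ltnn subnn; congr (_ + _).
  rewrite (bigD1 i) //= (realizable_coef0 _ _ rT) eqxx mul1r big1 ?addr0 // => a ai.
  by rewrite (realizable_coef0 _ _ rT) eq_sym (negPf ai) mul0r.
Qed.

Lemma realizable_approx T N : (forall i j, (T i j)`_0 = (i == j)%:R) ->
  exists T', realizable T' /\ approx N T' T.
Proof.
move=> T0; elim: N => [|N [T' [rT' aT']]].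
  exists 1%:M; split; first by exists (fun=> 0), (fun=> 0), 0%N.
  by move=> i j [|//] _; rewrite T0 mxE coefMn coef1.
pose d i j := (T i j)`_N.+1 - (T' i j)`_N.+1.
pose e0 (i : 'I_2) : K := (i == 0)%:R; pose e1 (i : 'I_2) : K := (i == 1)%:R.
have chk (u v : 'I_2 -> K) (c : K) (T1 : 'M[{poly K}]_2) (rT1 : realizable T1)
    (uv : u 0 * v 0 + u 1 * v 1 = 1) := @realizable_step T1 N c u v rT1 uv.
(* The last two idempotents also have a 1 in position (0, 0); the coefficient compensates for it. *)
have [|T1 [r1 a1 d1]] := chk e0 e0 (d 0 0 - d 0 1 - d 1 0) T' rT'.
  by rewrite /e0 /=; ring.
have [|T2 [r2 a2 d2]] := chk e1 e1 (d 1 1) T1 r1.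
  by rewrite /e1 /=; ring.
have [|T3 [r3 a3 d3]] := chk e0 (fun=> 1) (d 0 1) T2 r2.
  by rewrite /e0 /=; ring.
have [|T4 [r4 a4 d4]] := chk (fun=> 1) e0 (d 1 0) T3 r3.
  by rewrite /e0 /=; ring.
exists T4; split=> // i j r; rewrite leq_eqVlt => /orP[/eqP->|rN]; last first.
  by rewrite -a4 // -a3 // -a2 // -a1 // aT'.
rewrite d4 d3 d2 d1.
by elim/ord2_ind: i; elim/ord2_ind: j; rewrite /e0 /e1 /d /=; ring.
Qed.

End Classical.

(** * Matrix series with prescribed symbols *)

Lemma build_sequence (X : Type) (x0 : nat -> X) (P : nat -> (nat -> X) -> Prop) :
  (forall m f g, (forall k, (k <= m)%N -> f k = g k) -> P m f -> P m g) ->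
  (forall m f, (forall k, (k < m)%N -> P k f) ->
    exists x, P m (fun k => if k == m then x else f k)) ->
  forall N, exists f, forall m, (m < N)%N -> P m f.
Proof.
move=> Pext step; elim=> [|N [f fP]]; first by exists x0.
have [x Px] := step N f fP; exists (fun k => if k == N then x else f k) => m.
rewrite ltnS leq_eqVlt => /orP[/eqP->//|mN]; apply: Pext (fP m mN) => k km.
by rewrite ltn_eqF // (leq_ltn_trans km).
Qed.

(** The section of [off_scalar] with image the matrices whose entry (1, 1) is 0, a complement of the
    scalar matrices. *)
Definition offmat (K : fieldType) (y : 'rV[K]_3) : 'M[K]_2 :=
  \matrix_(i, j) (if i == 0 then (if j == 0 then y 0 2 else y 0 0)
                  else if j == 0 then y 0 1 else 0).

Section OffScalar.
Variable K : fieldType.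
Implicit Types (C : 'M[K]_2) (u y : 'rV[K]_3).

Lemma offmatZD a u v : offmat (a *: u + v) = a *: offmat u + offmat v :> 'M[K]_2.
Proof.
apply/matrixP => i j; rewrite !mxE.
by case: ifP => _; case: ifP => _; rewrite ?mulr0 ?addr0.
Qed.

Lemma offmatZ a u : offmat (a *: u) = a *: offmat u :> 'M[K]_2.
Proof.
have o0 : offmat 0 = 0 :> 'M[K]_2.
  by apply/matrixP => i j; rewrite !mxE; case: ifP => _; case: ifP.
by rewrite -[a *: u]addr0 offmatZD o0 addr0.
Qed.

Lemma offmat_off_scalar C : C = (C 1 1)%:M + offmat (off_scalar C).
Proof.
apply/matrixP => i j; rewrite !mxE.
by elim/ord2_ind: i; elim/ord2_ind: j; rewrite /= ?mulr1n ?mulr0n ?add0r ?addr0 // addrC subrK.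
Qed.

Lemma off_scalarZD a C C' : off_scalar (a *: C + C') = a *: off_scalar C + off_scalar C'.
Proof. by apply/rowP => -[[|[|[|//]]] i3]; rewrite !mxE /= ?mxE //; ring. Qed.

Lemma off_scalar1 : off_scalar (1%:M : 'M[K]_2) = 0.
Proof. by apply/rowP => -[[|[|[|//]]] i3]; rewrite !mxE //= subrr. Qed.

Lemma off_scalar0 : off_scalar (0 : 'M[K]_2) = 0.
Proof. by apply/rowP => -[[|[|[|//]]] i3]; rewrite !mxE //= subrr. Qed.

Lemma off_scalarZ a C : off_scalar (a *: C) = a *: off_scalar C.
Proof. by rewrite -[a *: C]addr0 off_scalarZD off_scalar0 addr0. Qed.

Lemma offmatK y : off_scalar (offmat y) = y.
Proof.
by apply/rowP => -[[|[|[|//]]] i3]; rewrite !mxE /= ?subr0; congr (y 0 _); apply: val_inj.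
Qed.

Lemma off_scalar_eq0 C : off_scalar C = 0 -> C = (C 1 1)%:M.
Proof.
move=> C0; rewrite {1}(offmat_off_scalar C) C0.
by rewrite (_ : offmat 0 = 0) ?addr0 // -(scale0r (0 : 'rV[K]_3)) offmatZ scale0r.
Qed.

End OffScalar.

Section SolveSymbols.
Variable K : numClosedFieldType.
Implicit Types (P Q : 'M[K]_2) (y : 'rV[K]_3).

Definition bdet P Q := P 0 0 * Q 1 1 - P 1 0 * Q 0 1.
Definition mxpair (C : 'M[K]_2) P := \sum_i \sum_j C i j * P j i.
(** With tau 0 = 1, these are the terms of the coefficient m + 1 of the determinant that are
    quadratic in tau 1, ..., tau m; what remains is the trace of tau (m + 1), see [dcoefS]. *)
Definition qpart (tau : nat -> 'M[K]_2) m := \sum_(a < m) bdet (tau a.+1) (tau (m - a)%N).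
Definition dcoef (tau : nat -> 'M[K]_2) m := \sum_(a < m.+1) bdet (tau a) (tau (m - a)%N).

Let mk a b c d : 'M[K]_2 :=
  \matrix_(i, j) (if i == 0 then (if j == 0 then a else b) else if j == 0 then c else d).

Let mkE a b c d : [/\ mk a b c d 0 0 = a, mk a b c d 0 1 = b,
  mk a b c d 1 0 = c & mk a b c d 1 1 = d].
Proof. by rewrite !mxE. Qed.

Lemma mxpairE C P : mxpair C P = C 0 0 * P 0 0 + C 0 1 * P 1 0 + (C 1 0 * P 0 1 + C 1 1 * P 1 1).
Proof. by rewrite /mxpair !sum_ord2. Qed.

Lemma mxpair_offmat y P : mxpair (offmat y) P = y 0 2 * P 0 0 + y 0 0 * P 1 0 + y 0 1 * P 0 1.
Proof. by rewrite mxpairE !mxE /= mul0r addr0. Qed.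

Lemma row3_neq0 y : y != 0 -> [\/ y 0 0 != 0, y 0 1 != 0 | y 0 2 != 0].
Proof.
move=> y0; have [y00|] := eqVneq (y 0 0) 0; last by constructor 1.
have [y01|] := eqVneq (y 0 1) 0; last by constructor 2.
have [y02|] := eqVneq (y 0 2) 0; last by constructor 3.
case/eqP: y0; apply/rowP => -[[|[|[|//]]] i3]; rewrite mxE.
- by rewrite -y00; congr (y 0 _); apply: val_inj.
- by rewrite -y01; congr (y 0 _); apply: val_inj.
- by rewrite -y02; congr (y 0 _); apply: val_inj.
Qed.

(** The trace and the pairing with E(y) are independent functionals, since E(y) is nonzero with
    entry (1, 1) equal to 0 and so is not scalar. *)
Lemma solve_trace_pair y p q : y != 0 ->
  exists Q, Q 0 0 + Q 1 1 = p /\ mxpair (offmat y) Q = q.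
Proof.
move=> /row3_neq0[] yn.
- exists (mk p 0 ((q - y 0 2 * p) / y 0 0) 0); rewrite mxpair_offmat.
  have [-> -> -> ->] := mkE p 0 ((q - y 0 2 * p) / y 0 0) 0.
  by split; [ring|field].
- exists (mk p ((q - y 0 2 * p) / y 0 1) 0 0); rewrite mxpair_offmat.
  have [-> -> -> ->] := mkE p ((q - y 0 2 * p) / y 0 1) 0 0.
  by split; [ring|field].
- exists (mk (q / y 0 2) 0 0 (p - q / y 0 2)); rewrite mxpair_offmat.
  have [-> -> -> ->] := mkE (q / y 0 2) 0 0 (p - q / y 0 2).
  by split; [ring|field].
Qed.

Lemma solve_quadratic (a k : K) : exists x, x ^+ 2 - a * x + k = 0.
Proof.
exists ((a + sqrtC (a ^+ 2 - 4 * k)) / 2).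
set s := sqrtC _; have s2 : s ^+ 2 = a ^+ 2 - 4 * k by rewrite sqrtCK.
have -> : ((a + s) / 2) ^+ 2 - a * ((a + s) / 2) + k = (s ^+ 2 - (a ^+ 2 - 4 * k)) / 4.
  by field.
by rewrite s2 subrr mul0r.
Qed.

(** With one off-diagonal entry equal to 1, the trace and the pairing express the other entries
    through x = [Q 0 0], and the determinant becomes a quadratic equation for x. If only [y 0 2] is
    nonzero, the pairing fixes x and the second off-diagonal entry adjusts the determinant. The last
    conclusion prepares [solve_pairing]. *)
Lemma solve_det y a b e : y != 0 -> exists Q,
  [/\ Q 0 0 + Q 1 1 = a, mxpair (offmat y) Q = b, bdet Q Q = e &
      (Q 0 1 != 0) || (Q 1 0 != 0)].
Proof.
move=> y_neq0; have [y0|yn] := eqVneq (y 0 0) 0; last first.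
  have [x xP] := solve_quadratic (a + y 0 2 / y 0 0) ((b - y 0 1) / y 0 0 + e).
  exists (mk x 1 ((b - y 0 2 * x - y 0 1) / y 0 0) (a - x)); rewrite mxpair_offmat /bdet.
  have [-> -> -> ->] := mkE x 1 ((b - y 0 2 * x - y 0 1) / y 0 0) (a - x).
  rewrite oner_eq0; split=> //; [ring|by field|].
  apply/eqP; rewrite -subr_eq0; apply/eqP; rewrite -[RHS]oppr0 -xP; by field.
case: (row3_neq0 y_neq0) => yn; first by rewrite y0 eqxx in yn.
  have [x xP] := solve_quadratic (a + y 0 2 / y 0 1) ((b - y 0 0) / y 0 1 + e).
  exists (mk x ((b - y 0 2 * x - y 0 0) / y 0 1) 1 (a - x)); rewrite mxpair_offmat /bdet.
  have [-> -> -> ->] := mkE x ((b - y 0 2 * x - y 0 0) / y 0 1) 1 (a - x).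
  rewrite oner_eq0 orbT; split=> //; [ring|by field|].
  apply/eqP; rewrite -subr_eq0; apply/eqP; rewrite -[RHS]oppr0 -xP; by field.
pose x := (b - y 0 1) / y 0 2.
exists (mk x 1 (x * (a - x) - e) (a - x)); rewrite mxpair_offmat /bdet.
have [-> -> -> ->] := mkE x 1 (x * (a - x) - e) (a - x).
by rewrite oner_eq0 y0 /x; split=> //; [ring|field|ring].
Qed.

(** The polarized determinant with [P] is a linear form in [Q]; as it involves an off-diagonal entry
    of [Q], it is independent of the trace. *)
Lemma solve_pairing P p v : (P 0 1 != 0) || (P 1 0 != 0) ->
  exists Q, Q 0 0 + Q 1 1 = p /\ bdet P Q + bdet Q P = v.
Proof.
move=> /orP[] Pn.
- exists (mk p 0 ((P 1 1 * p - v) / P 0 1) 0); rewrite /bdet.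
  have [-> -> -> ->] := mkE p 0 ((P 1 1 * p - v) / P 0 1) 0.
  by split; [ring|field].
- exists (mk p ((P 1 1 * p - v) / P 1 0) 0 0); rewrite /bdet.
  have [-> -> -> ->] := mkE p ((P 1 1 * p - v) / P 1 0) 0 0.
  by split; [ring|field].
Qed.

Lemma dcoefS tau m : tau 0%N = 1%:M ->
  dcoef tau m.+1 = tau m.+1 0 0 + tau m.+1 1 1 + qpart tau m.
Proof.
move=> t0; rewrite /dcoef big_ord_recl /= t0 subn0.
rewrite {1}/bdet !mxE /= mul1r mul0r subr0 [_ + tau _ 1 1]addrC -addrA; congr (_ + _).
rewrite big_ord_recr /= /bump leq0n add1n subnn t0 addrC; congr (_ + _).
by rewrite /bdet !mxE /= mulr1 mulr0 subr0.
Qed.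

Lemma qpart_ext tau tau' m : (forall k, (0 < k <= m)%N -> tau k = tau' k) ->
  qpart tau m = qpart tau' m.
Proof.
move=> E; apply: eq_bigr => a _.
rewrite !E //; first by rewrite subn_gt0 ltn_ord leq_subr.
by rewrite ltn_ord.
Qed.

(** For l <> 0 each tau (m + 1) is found from two independent linear equations. For l = 0, off the
    exceptional direction [be 0], the pairings see only traces, and the determinants must be
    adjusted through their quadratic parts. *)
Lemma solve_symbols y c l (al be : nat -> K) N : y != 0 -> (c != 0) || (l != 0) ->
  let C := c%:M + l *: offmat y in
  exists tau : nat -> 'M[K]_2, tau 0%N = 1%:M /\ forall m, (m < N)%N ->
    dcoef tau m.+1 = al m /\
    mxpair (if m is 0 then offmat y else C) (tau m.+1) = be m.
Proof.
move=> y0 cl C.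
have pairC Q : mxpair C Q = c * (Q 0 0 + Q 1 1) + l * mxpair (offmat y) Q.
  by rewrite !mxpairE !mxE /=; ring.
have [l0|ln0] := eqVneq l 0; last first.
  pose P m (tau : nat -> 'M[K]_2) := if m is m'.+1 then
     tau m 0 0 + tau m 1 1 + qpart tau m' = al m' /\
     mxpair (if m' is 0 then offmat y else C) (tau m) = be m' else tau 0%N = 1%:M.
  have [|m f _|tau tauP] := build_sequence (fun=> 1%:M) (P := P) _ _ N.+1.
  - move=> [|m] f g fg; first by rewrite /P -fg.
    rewrite /P -fg // => -[e1 e2]; split=> //; rewrite -e1; congr (_ + _).
    by apply/esym/qpart_ext => k /andP[_ km]; rewrite fg // ltnW.
  - case: m => [|m]; first by exists 1%:M.
    have [Q [Q1 Q2]] := solve_trace_pair (al m - qpart f m)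
      (if m is 0 then be m else (be m - c * (al m - qpart f m)) / l) y0.
    exists Q; rewrite /P eqxx Q1; split.
      rewrite (qpart_ext (tau' := f)) ?subrK // => k /andP[_ km].
      by rewrite ltn_eqF.
    case: m Q1 Q2 => [|m] Q1 Q2 //.
    by rewrite pairC Q1 Q2 [l * _]mulrC divfK // addrC subrK.
  - exists tau; have t0 := tauP 0%N isT; split=> // m mN.
    by have [e1 e2] := tauP m.+1 mN; rewrite dcoefS.
have c0 : c != 0 by move: cl; rewrite l0 eqxx orbF.
have {}pairC Q : mxpair C Q = c * (Q 0 0 + Q 1 1) by rewrite pairC l0 mul0r addr0.
(* For m >= 1 the value [be m] fixes the trace of tau (m + 1), so [al m] becomes a condition on
   [qpart tau m], to be met already by the choice of tau m. Hence the conditions on traces and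
   quadratic parts are shifted by one degree, and tau 1 has to meet three equations. *)
pose P m (tau : nat -> 'M[K]_2) := match m with
  | 0%N => tau 0%N = 1%:M
  | 1%N => [/\ tau 1%N 0 0 + tau 1%N 1 1 = al 0%N, mxpair (offmat y) (tau 1%N) = be 0%N,
     (tau 1%N 0 1 != 0) || (tau 1%N 1 0 != 0) & qpart tau 1 = al 1%N - be 1%N / c]
  | m'.+1 => tau m 0 0 + tau m 1 1 = be m' / c /\ qpart tau m = al m - be m / c
  end.
have [|m f fP|tau tauP] := build_sequence (fun=> 1%:M) (P := P) _ _ N.+1.
- have qe f g m : (forall k, (k <= m)%N -> f k = g k) -> qpart g m = qpart f m.
    by move=> fg; apply/esym/qpart_ext => k /andP[_ km]; rewrite fg.
  move=> [|[|m]] f g fg; rewrite /P; first by rewrite -fg.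
    by rewrite (qe _ _ _ fg) -fg.
  by rewrite (qe _ _ _ fg) -fg.
- case: m fP => [|[|m]] fP; first by exists 1%:M.
    have [Q [Q1 Q2 Q3 Q4]] := solve_det (al 0%N) (be 0%N) (al 1%N - be 1%N / c) y0.
    by exists Q; rewrite /P /= /qpart big_ord1.
  have [_ _ f1 _] := fP 1%N isT.
  pose g Q k := if k == m.+2 then Q else f k.
  (* The new matrix enters only the two extreme terms, paired with tau 1; the equation is linear in
     it, and solvable because tau 1 is not diagonal. *)
  have qE Q : qpart (g Q) m.+2 = bdet (f 1%N) Q + bdet Q (f 1%N) +
      \sum_(a < m) bdet (f a.+2) (f (m.+1 - a)%N).
    rewrite /qpart big_ord_recl big_ord_recr /= /g /= subn0 !eqxx.
    rewrite -[RHS]addrA; congr (bdet _ _ + _); rewrite [LHS]addrC; congr (_ + _).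
      by rewrite /bump leq0n add1n subSS subSnn.
    apply: eq_bigr => a _; rewrite /bump leq0n add1n !subSS !eqSS ltn_eqF //.
    by rewrite (@ltn_eqF _ m.+2) // ltnS leq_subr.
  have [Q [Q1 Q2]] := solve_pairing (be m.+1 / c) (al m.+2 - be m.+2 / c -
     \sum_(a < m) bdet (f a.+2) (f (m.+1 - a)%N)) f1.
  by exists Q; rewrite /P eqxx Q1 -/(g Q) qE Q2 subrK.
- exists tau; have t0 := tauP 0%N isT; split=> // -[|m] mN.
    have [e1 e2 _ _] := tauP 1%N mN; rewrite dcoefS // /qpart big_ord0 addr0.
    by split.
  have [e1 _] := tauP m.+2 mN; rewrite dcoefS // pairC e1 [c * _]mulrC divfK //; split=> //.
  case: m mN e1 => [|m] mN e1.
    by have [_ _ _ ->] := tauP 1%N (ltnW mN); rewrite addrC subrK.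
  by have [_ ->] := tauP m.+2 (ltnW mN); rewrite addrC subrK.
Qed.

End SolveSymbols.

(** * Monomials in the generators of Bethe subalgebras *)

Lemma digits_inj B n (d d' : nat -> nat) :
  (forall k, d k < B)%N -> (forall k, d' k < B)%N ->
  (\sum_(k < n) d k * B ^ k = \sum_(k < n) d' k * B ^ k)%N ->
  forall k, (k < n)%N -> d k = d' k.
Proof.
elim: n d d' => [//|n IH] d d' dB dB' E.
have B0 : (0 < B)%N by apply: leq_ltn_trans (dB 0%N).
have shift (f : nat -> nat) : (\sum_(k < n.+1) f k * B ^ k = (\sum_(k < n) f k.+1 * B ^ k) * B + f 0)%N.
  rewrite big_ord_recl expn0 muln1 addnC big_distrl /=; congr (_ + _)%N.
  by apply: eq_bigr => k _; rewrite /bump leq0n add1n expnSr mulnA.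
move: E; rewrite !shift => E.
have E0 : d 0%N = d' 0%N.
  by have := congr1 (modn^~ B) E; rewrite /= !modnMDl !modn_small.
have {}E : (\sum_(k < n) d k.+1 * B ^ k = \sum_(k < n) d' k.+1 * B ^ k)%N.
  by have := congr1 (divn^~ B) E; rewrite /= !divnMDl // !divn_small // !addn0.
by case=> [//|k]; rewrite ltnS; exact: (IH (fun k => d k.+1) (fun k => d' k.+1) (fun k => dB _) (fun k => dB' _) E).
Qed.

(** The exponent of a word under the Kronecker substitution of x^(B^k) for the k-th variable. Its
    digits in base B are the multiplicities of the letters once B exceeds the length. *)
Definition code B (w : seq nat) := (\sum_(k <- w) B ^ k)%N.

Lemma code_perm B (w w' : seq nat) : (size w < B)%N -> (size w' < B)%N ->
  code B w = code B w' -> perm_eq w w'.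
Proof.
move=> wB wB' ww'.
have codeE n (v : seq nat) : all (fun k => k < n)%N v ->
    code B v = (\sum_(k < n) count_mem (k : nat) v * B ^ k)%N.
  elim: v => [|a v IH] /=; first by rewrite /code big_nil big1.
  move=> /andP[an vn]; rewrite /code big_cons -/(code B v) IH //.
  under [RHS]eq_bigr do rewrite mulnDl.
  rewrite big_split /= [in RHS](bigD1 (Ordinal an)) //= eqxx mul1n [X in (_ + X + _)%N]big1 ?addn0 //.
  by move=> k ka; rewrite eq_sym (_ : (k == a :> nat) = false) //; apply: negPf.
pose n := (\max_(k <- w ++ w') k).+1.
have vn v : {subset v <= w ++ w'} -> all (fun k => k < n)%N v.
  by move=> vw; apply/allP => k /vw kw; rewrite ltnS; exact: leq_bigmax_seq.
have wn : all (fun k => k < n)%N w by apply: vn => k; rewrite mem_cat => ->.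
have wn' : all (fun k => k < n)%N w' by apply: vn => k; rewrite mem_cat => ->; rewrite orbT.
move: ww'; rewrite (codeE n w) // (codeE n w') // => E.
have cB (v : seq nat) : (size v < B)%N -> forall k, (count_mem k v < B)%N.
  by move=> vB k; apply: leq_ltn_trans (count_size _ _) vB.
have cE := @digits_inj B n (fun k => count_mem k w) (fun k => count_mem k w')
  (cB w wB) (cB w' wB') E.
apply/allP => k; rewrite mem_cat => kw /=; apply/eqP/cE.
by case/orP: kw; [move/(allP wn)|move/(allP wn')].
Qed.

Lemma poly_fun0 (K : numFieldType) (p : {poly K}) : (forall x, p.[x] = 0) -> p = 0.
Proof.
move=> px; apply/eqP/negPn/negP => p0.
pose rs : seq K := [seq n%:R | n <- iota 0 (size p)].
have : (size rs < size p)%N.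
  apply: max_poly_roots => //; first by apply/allP => z _; rewrite /root px.
  by rewrite map_inj_uniq ?iota_uniq // => m n /eqP; rewrite eqr_nat => /eqP.
by rewrite size_map size_iota ltnn.
Qed.

Lemma monomials_indep (K : numFieldType) (ws : seq (seq nat)) (c : seq nat -> K) :
  uniq ws -> (forall w, w \in ws -> sorted leq w) ->
  (forall ga : nat -> K, \sum_(w <- ws) c w * \prod_(k <- w) ga k = 0) ->
  forall w, w \in ws -> c w = 0.
Proof.
move=> uws sws E.
pose B := (\max_(w <- ws) size w).+1.
have wB w : w \in ws -> (size w < B)%N by move=> ww; rewrite ltnS; exact: leq_bigmax_seq.
have codeI w w' : w \in ws -> w' \in ws -> code B w = code B w' -> w = w'.
  move=> ww ww' /(code_perm (wB _ ww) (wB _ ww')).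
  exact: (sorted_eq leq_trans anti_leq (sws _ ww) (sws _ ww')).
pose p : {poly K} := \sum_(w <- ws) c w *: 'X^(code B w).
have p0 : p = 0.
  apply: poly_fun0 => x; rewrite -[RHS](E (fun k => x ^+ (B ^ k))) horner_sum.
  by apply: eq_bigr => w _; rewrite hornerZ hornerXn expr_sum.
move=> w ww; have := congr1 (fun q : {poly K} => q`_(code B w)) p0.
rewrite coef0 coef_sum (bigD1_seq w) //= coefZ coefXn eqxx mulr1 big_seq_cond big1 ?addr0 //.
move=> w' /andP[ww' w'w]; rewrite coefZ coefXn.
by case: eqP => [/codeI e|_]; [rewrite e ?eqxx in w'w|rewrite mulr0].
Qed.

Section Generators.
Variables (K : numClosedFieldType) (A : algType K) (t : 'I_2 -> 'I_2 -> nat -> A).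
Variable F : nat -> set A.
Hypothesis yl : yangian_like t F.
Implicit Types (C : 'M[K]_2) (y : 'rV[K]_3).

Definition trc C m : A := \sum_i \sum_j C i j *: t j i m.

Definition wt (k : nat) := k./2.+1.

(** The even letter 2 m stands for qdet T^(m+1) and the odd letter 2 m + 1 for the trace generator
    of degree m + 1; both have weight m + 1. *)
Definition gen C y k : A :=
  if odd k then (if k./2 is 0 then trc (offmat y) 1 else trc C (wt k)) else qdet t (wt k).

Definition wordwt (w : seq nat) := (\sum_(k <- w) wt k)%N.
Definition wordprod C y (w : seq nat) : A := \prod_(k <- w) gen C y k.

Let sF := yl_subspace yl.

Lemma trc_fil C m : F m (trc C m).
Proof.
do 2 (apply: (subspace_sum _ (sF m)) => ? _).
by apply: (subspaceZ _ (sF m)); apply: (yl_t yl).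
Qed.

Lemma subspaceMn (S : set A) x n : subspace S -> S x -> S (x *+ n).
Proof. by move=> sS Sx; rewrite -scaler_nat; apply: subspaceZ. Qed.

Lemma shift_fil i j m : F m (shift_coef (t i j) m).
Proof.
apply: (subspace_sum _ (sF m)) => s _; apply: subspaceMn => //.
by apply: (yl_le yl (_ : s <= m)%N); [rewrite -ltnS|apply: (yl_t yl)].
Qed.

Lemma qdet_fil m : F m (qdet t m).
Proof.
have sub i j k l : F m (conv (t i j) (shift_coef (t k l)) m).
  apply: (subspace_sum _ (sF m)) => a _.
  rewrite -[X in F X](subnKC (_ : a <= m)%N) -1?ltnS //.
  by apply: (yl_M yl); [exact: (yl_t yl)|exact: shift_fil].
exact: subspaceB.
Qed.

Lemma gen_fil C y k : F (wt k) (gen C y k).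
Proof.
rewrite /gen; case: ifP => _; last exact: qdet_fil.
by case Ek: k./2 => [|m]; rewrite /wt ?Ek; apply: trc_fil.
Qed.

Lemma wordprod_fil C y w : F (wordwt w) (wordprod C y w).
Proof.
rewrite /wordwt /wordprod; elim: w => [|k w IH]; first by rewrite !big_nil; exact: (yl_1 yl).
by rewrite !big_cons; apply: (yl_M yl) => //; apply: gen_fil.
Qed.

Section Symbols.
Variables (T : 'M[{poly K}]_2) (S : nat -> A -> K).
Hypothesis ST : symbol_at t F T S.

Lemma symbol0 N : S N 0 = 0.
Proof.
by have := symbol_linear ST N (-1) 0 0; rewrite scaler0 addr0 mulN1r addNr.
Qed.

Lemma symbolZ N a x : S N (a *: x) = a * S N x.
Proof. by rewrite -[a *: x]addr0 (symbol_linear ST) symbol0 addr0. Qed.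

Lemma symbolD N (x y : A) : S N (x + y) = S N x + S N y.
Proof. by rewrite -[x]scale1r (symbol_linear ST) mul1r scale1r. Qed.

Lemma symbolB N (x y : A) : S N (x - y) = S N x - S N y.
Proof. by rewrite -scaleN1r symbolD symbolZ mulN1r. Qed.

Lemma symbol_sum N (I : Type) (r : seq I) (P : pred I) (f : I -> A) :
  S N (\sum_(i <- r | P i) f i) = \sum_(i <- r | P i) S N (f i).
Proof. by apply: (big_morph (S N)); [exact: symbolD|exact: symbol0]. Qed.

(** The translation u - 1 adds to t_ij^(m) only terms of lower degree, so it is invisible to
    symbols. *)
Lemma symbol_shift i j m : S m (shift_coef (t i j) m) = (T i j)`_m.
Proof.
rewrite /shift_coef big_ord_recr /= subnn bin0 mulr1n symbolD (symbol_t ST).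
rewrite symbol_sum big1 ?add0r // => s _.
rewrite -scaler_nat symbolZ (symbol_lt ST (ltn_ord s)) ?mulr0 //.
exact: (yl_t yl).
Qed.

Lemma symbol_trc C m : S m (trc C m) = \sum_i \sum_j C i j * (T j i)`_m.
Proof.
rewrite symbol_sum; apply: eq_bigr => i _; rewrite symbol_sum; apply: eq_bigr => j _.
by rewrite symbolZ (symbol_t ST).
Qed.

Lemma symbol_qdet m : S m (qdet t m) =
  \sum_(a < m.+1) ((T 0 0)`_a * (T 1 1)`_(m - a) - (T 1 0)`_a * (T 0 1)`_(m - a)).
Proof.
have sub i j k l : S m (conv (t i j) (shift_coef (t k l)) m) =
    \sum_(a < m.+1) (T i j)`_a * (T k l)`_(m - a).
  rewrite symbol_sum; apply: eq_bigr => a _.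
  have am : (a <= m)%N by rewrite -ltnS.
  rewrite -[X in S X](subnKC am) (symbolM ST) ?symbol_shift ?(symbol_t ST) //.
    exact: (yl_t yl).
  exact: shift_fil.
by rewrite symbolB !sub -sumrB.
Qed.

Lemma symbol_wordprod C y w :
  S (wordwt w) (wordprod C y w) = \prod_(k <- w) S (wt k) (gen C y k).
Proof.
rewrite /wordwt /wordprod; elim: w => [|k w IH].
  by rewrite !big_nil (symbol1 ST).
rewrite !big_cons (symbolM ST) ?IH //; first exact: gen_fil.
exact: wordprod_fil.
Qed.

End Symbols.

(** C and y represent a point of the blow-up, with l = 0 exactly on the exceptional divisor; see
    [on_blowup_compatible] and [compatible_on_blowup]. *)
Definition compatible C y := y != 0 /\
  exists c l, (c != 0) || (l != 0) /\ C = c%:M + l *: offmat y.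

Lemma gen_symbol_surj C y N (ga : nat -> K) : compatible C y ->
  exists T S, symbol_at t F T S /\ forall k, (wt k <= N)%N -> S (wt k) (gen C y k) = ga k.
Proof.
move=> [y0 [c [l [cl CE]]]].
have [tau [tau0 tauP]] := solve_symbols (fun m => ga m.*2) (fun m => ga m.*2.+1) N y0 cl.
rewrite -CE in tauP.
pose T0 : 'M[{poly K}]_2 := \matrix_(i, j) \poly_(r < N.+1) tau r i j.
have T0E i j r : (r <= N)%N -> (T0 i j)`_r = tau r i j.
  by move=> rN; rewrite mxE coef_poly ltnS rN.
have [|T [[x [p [n TE]]] TT0]] := @realizable_approx K T0 N.
  by move=> i j; rewrite T0E // tau0 mxE.
have [S ST] := yl_symbol yl x p n; rewrite -TE in ST.
have TS i j r : (r <= N)%N -> (T i j)`_r = tau r i j by move=> rN; rewrite TT0 ?T0E.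
exists T, S; split=> // k kN; have [e1 e2] := tauP k./2 kN.
rewrite /gen; case: ifP => ok.
  have -> : ga k = ga k./2.*2.+1 by rewrite -[in LHS](odd_double_half k) ok.
  rewrite /wt in kN *; rewrite -e2 /mxpair.
  case: (k./2) kN => [|m] kN; rewrite (symbol_trc ST); apply: eq_bigr => i _;
    by apply: eq_bigr => j _; rewrite TS.
have -> : ga k = ga k./2.*2 by rewrite -[in LHS](odd_double_half k) ok.
rewrite -e1 (symbol_qdet ST) /dcoef /bdet; apply: eq_bigr => a _.
have am : (a <= wt k)%N by rewrite -ltnS.
have ? : (a <= N)%N by exact: leq_trans am kN.
have ? : (wt k - a <= N)%N by exact: leq_trans (leq_subr _ _) kN.
by rewrite !TS.
Qed.

(** In the largest weight N with a nonzero coefficient, the symbol of degree N is a polynomial in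
    the symbols of the generators, which are arbitrary. The case n0 = 0 gives independence; the case
    n0 = N + 1 bounds the weights of the monomials in an element of F N. *)
Lemma wordprod_lead C y (ws : seq (seq nat)) (c : seq nat -> K) n0 : compatible C y ->
  uniq ws -> (forall w, w \in ws -> sorted leq w) ->
  (forall n S T, (n0 <= n)%N -> symbol_at t F T S ->
    S n (\sum_(w <- ws) c w *: wordprod C y w) = 0) ->
  forall w, w \in ws -> (n0 <= wordwt w)%N -> c w = 0.
Proof.
move=> Cy uws sws E.
pose Q n := `[< exists w, [/\ w \in ws, c w != 0, wordwt w = n & (n0 <= n)%N] >].
move=> w0 w0ws w0n; apply/eqP/negPn/negP => cw0.
have exQ : exists n, Q n by exists (wordwt w0); apply/asboolP; exists w0.
have Qb n : Q n -> (n <= \max_(w <- ws) wordwt w)%N.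
  by move=> /asboolP[w [ww _ <- _]]; exact: leq_bigmax_seq.
case: (ex_maxnP exQ Qb) => N /asboolP[w1 [w1ws cw1 w1N n0N]] Nmax.
case/negP: cw1; apply/eqP.
pose ws' := [seq w <- ws | wordwt w == N].
apply: (@monomials_indep K ws' c); rewrite ?filter_uniq //.
- by move=> w; rewrite mem_filter => /andP[_ /sws].
- move=> ga; have [T [S [ST Sga]]] := gen_symbol_surj N ga Cy.
  rewrite -[RHS](E N S T n0N ST) (symbol_sum ST) big_filter.
  rewrite [RHS](bigID (fun w => wordwt w == N)) /= [X in _ = _ + X]big_seq_cond.
  rewrite [X in _ = _ + X]big1 ?addr0.
    apply: eq_bigr => w /eqP wN; rewrite (symbolZ ST) -[in RHS]wN (symbol_wordprod ST).
    congr (_ * _); rewrite big_seq [RHS]big_seq; apply: eq_bigr => k kw.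
    by rewrite Sga // -wN /wordwt (big_rem k) //= leq_addr.
  move=> w /andP[ww wN]; rewrite (symbolZ ST).
  have [wltN|] := ltnP (wordwt w) N.
    by rewrite (symbol_lt ST wltN) ?mulr0 //; exact: wordprod_fil.
  rewrite leq_eqVlt eq_sym (negPf wN) /= => Nw.
  have [->|cw] := eqVneq (c w) 0; first by rewrite mul0r.
  have : Q (wordwt w).
    by apply/asboolP; exists w; split=> //; exact: leq_trans n0N (ltnW Nw).
  by move=> /Nmax; rewrite leqNgt Nw.
- by rewrite mem_filter w1N eqxx.
Qed.

End Generators.

Fixpoint words b n : seq (seq nat) :=
  if n is n'.+1 then [::] :: [seq k :: w | k <- iota 0 b, w <- words b n'] else [:: [::]].

Lemma mem_words b n w : (size w <= n)%N -> all (fun k => k < b)%N w -> w \in words b n.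
Proof.
elim: n w => [|n IH] [|k w] //= wn /andP[kb wb].
rewrite inE /=; apply/allpairsP; exists (k, w); split=> //=; first by rewrite mem_iota.
exact: IH.
Qed.

(** Sorted words represent multisets of commuting generators. A word of weight at most N has at most
    N letters, all below 2 N. The list involves neither C nor y, so its length is the common
    dimension d_N. *)
Definition swords N : seq (seq nat) :=
  undup [seq w <- words N.*2 N | sorted leq w && (wordwt w <= N)%N].

Lemma size_wordwt w : (size w <= wordwt w)%N.
Proof.
elim: w => [//|k w IH] /=; rewrite /wordwt big_cons -add1n leq_add //.
Qed.

Lemma wordwt_mem k w : k \in w -> (wt k <= wordwt w)%N.
Proof. by move=> kw; rewrite /wordwt (big_rem k) //= leq_addr. Qed.

Lemma mem_swords N w : (w \in swords N) = sorted leq w && (wordwt w <= N)%N.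
Proof.
rewrite mem_undup mem_filter andb_idr // => /andP[_ wN].
apply: mem_words; first exact: leq_trans (size_wordwt w) wN.
apply/allP => k kw; have := leq_trans (wordwt_mem kw) wN; rewrite /wt => kN.
by rewrite -[k]odd_double_half; case: (odd k); rewrite ?add0n ?add1n ?ltn_double // ltn_Sdouble.
Qed.

(** * Commutativity and monomial bases *)

Section Commutation.
Variables (K : numClosedFieldType) (A : algType K) (t : 'I_2 -> 'I_2 -> nat -> A).
Variable F : nat -> set A.
Hypothesis yl : yangian_like t F.
Implicit Types (C : 'M[K]_2) (y : 'rV[K]_3).

Lemma bracketZl (a : K) (x z : A) : bracket (a *: x) z = a *: bracket x z.
Proof. by rewrite /bracket -scalerAl -scalerAr scalerBr. Qed.
Lemma bracketZr (a : K) (x z : A) : bracket x (a *: z) = a *: bracket x z.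
Proof. by rewrite /bracket -scalerAl -scalerAr scalerBr. Qed.
Lemma bracket0_comm (x z : A) : bracket x z = 0 <-> GRing.comm x z.
Proof.
by split=> [/eqP|xz]; [rewrite subr_eq0 => /eqP|rewrite /bracket xz subrr].
Qed.

Let tR := yl_rtt yl.

(** Let X(u, v) be the bracket of the two traces and Z(u, v) the same sum with two row indices
    exchanged. The relations give (u - v) X = Z and (u - v) Z = X on coefficients, and both vanish
    for r = 0. *)
Lemma trc_comm C r s : bracket (trc t C r) (trc t C s) = 0.
Proof.
pose c (p : 'I_2 * 'I_2) := C p.1 p.2.
have trcE m : trc t C m = \sum_p c p *: t p.2 p.1 m.
  by rewrite /trc pair_big.
pose Q (f : 'I_2 * 'I_2 -> 'I_2 * 'I_2 -> A) := \sum_p \sum_q (c p * c q) *: f p q.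
have QB f g : Q f - Q g = Q (fun p q => f p q - g p q).
  rewrite -sumrB; apply: eq_bigr => p _; rewrite -sumrB; apply: eq_bigr => q _.
  by rewrite scalerBr.
have Qswap f : Q f = Q (fun p q => f q p).
  rewrite /Q exchange_big; apply: eq_bigr => p _; apply: eq_bigr => q _.
  by rewrite mulrC.
have Qe f g : (forall p q, f p q = g p q) -> Q f = Q g.
  by move=> fg; apply: eq_bigr => p _; apply: eq_bigr => q _; rewrite fg.
pose X r s := Q (fun p q => bracket (t p.2 p.1 r) (t q.2 q.1 s)).
pose Z r s := Q (fun p q => bracket (t q.2 p.1 r) (t p.2 q.1 s)).
have XE : bracket (trc t C r) (trc t C s) = X r s.
  rewrite !trcE bracket_suml; apply: eq_bigr => p _.
  rewrite bracket_sumr; apply: eq_bigr => q _.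
  by rewrite bracketZl bracketZr scalerA.
have [t0 tS] := tR.
have XS a b : X a.+1 b - X a b.+1 = Z a b.
  rewrite QB (Qe _ (fun p q => t q.2 p.1 a * t p.2 q.1 b - t q.2 p.1 b * t p.2 q.1 a)).
    rewrite -QB [X in _ - X]Qswap QB; exact: Qe.
  by move=> p q; rewrite tS.
have ZS a b : Z a.+1 b - Z a b.+1 = X a b.
  rewrite QB (Qe _ (fun p q => t p.2 p.1 a * t q.2 q.1 b - t p.2 p.1 b * t q.2 q.1 a)).
    rewrite -QB [X in _ - X]Qswap QB; exact: Qe.
  by move=> p q; rewrite tS.
have Q0 f : (forall p q, f p q = 0) -> Q f = 0.
  by move=> f0; rewrite /Q big1 // => p _; rewrite big1 // => q _; rewrite f0 scaler0.
rewrite XE; suff : X r s = 0 /\ Z r s = 0 by case.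
elim: r s {XE} => [|r IH] s.
  by split; apply: Q0 => p q; rewrite t0 bracket_natl.
have [x0 z0] := IH s; have [x1 z1] := IH s.+1.
split; first by have := XS r s; rewrite x1 z0 subr0.
by have := ZS r s; rewrite x0 z1 subr0.
Qed.

Lemma bracket_t1 i j k l s :
  bracket (t i j 1%N) (t k l s) = (k == j)%:R * t i l s - (i == l)%:R * t k j s.
Proof.
have [t0 tS] := tR; have := tS i j k l 0%N s.
by rewrite !t0 bracket_natl subr0 => ->; rewrite (commr_nat (t k j s)) /GRing.comm.
Qed.

(** C is a combination of I and E(y). The first part gives tr T^(s), invariant under the adjoint
    action of the t_ij^(1); the second is an instance of [trc_comm]. *)
Lemma trc1_comm C y s : compatible C y -> bracket (trc t (offmat y) 1) (trc t C s) = 0.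
Proof.
move=> [_ [c [l [_ ->]]]].
have -> : trc t (c%:M + l *: offmat y) s =
    c *: (\sum_k t k k s) + l *: trc t (offmat y) s.
  rewrite /trc !scaler_sumr -big_split; apply: eq_bigr => i _ /=.
  rewrite scaler_sumr; under eq_bigr do rewrite !mxE scalerDl -scalerA.
  rewrite big_split /=; congr (_ + _); last first.
    by apply: eq_bigr => j _; rewrite mxE.
  rewrite (bigD1 i) //= eqxx big1 ?addr0 // => j ji.
  by rewrite eq_sym (negPf ji) mulr0n scale0r.
rewrite bracketDr !bracketZr trc_comm scaler0 addr0 bracket_sumr.
rewrite [X in c *: X](_ : _ = 0) ?scaler0 //.
under eq_bigr do rewrite bracket_suml.
rewrite exchange_big big1 // => i _ /=.
under eq_bigr do rewrite bracket_suml.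
rewrite exchange_big big1 // => j _ /=.
under eq_bigr do rewrite bracketZl bracket_t1.
rewrite -scaler_sumr sumrB (bigD1 i) //= eqxx mul1r big1 ?addr0; last first.
  by move=> k ki; rewrite (negPf ki) mul0r.
rewrite (bigD1 j) //= eqxx mul1r big1 ?addr0 ?subrr ?scaler0 //.
by move=> k kj; rewrite eq_sym (negPf kj) mul0r.
Qed.

Lemma trc_qdet_comm C r m : bracket (trc t C r) (qdet t m) = 0.
Proof.
rewrite bracket_suml big1 // => i _; rewrite bracket_suml big1 // => j _.
by rewrite bracketZl (qdet_central tR) scaler0.
Qed.

Lemma qdet_comm m n : bracket (qdet t m) (qdet t n) = 0.
Proof.
have sub i j r : bracket (shift_coef (t i j) r) (qdet t n) = 0.
  rewrite bracket_suml big1 // => s _.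
  by rewrite bracketC bracketMnr bracketC (qdet_central tR) oppr0 mul0rn oppr0.
have conv0 i j k l : bracket (conv (t i j) (shift_coef (t k l)) m) (qdet t n) = 0.
  rewrite bracket_suml big1 // => a _; rewrite bracketC bracketMr.
  rewrite bracketC (qdet_central tR) [bracket (qdet t n) _]bracketC sub.
  by rewrite !oppr0 mul0r mulr0 addr0 oppr0.
by rewrite /(qdet t m) bracketDl conv0 add0r bracketC bracketNr bracketC conv0 !oppr0.
Qed.

Lemma gen_comm C y k k' : compatible C y -> GRing.comm (gen t C y k) (gen t C y k').
Proof.
move=> Cy; apply/bracket0_comm; rewrite /gen.
case: (odd k); case: (odd k'); last exact: qdet_comm.
- case: (k./2) (k'./2) => [|m] [|m']; first exact: trc_comm.
  + exact: trc1_comm.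
  + by rewrite bracketC trc1_comm ?oppr0.
  + exact: trc_comm.
- by case: (k./2) => [|m]; apply: trc_qdet_comm.
- by rewrite bracketC; case: (k'./2) => [|m]; rewrite trc_qdet_comm oppr0.
Qed.

Section Bbar.
Variables (C : 'M[K]_2) (y : 'rV[K]_3) (Cy : compatible C y).
Local Notation wp := (wordprod t C y).

Lemma wordprod_perm w w' : perm_eq w w' -> wp w = wp w'.
Proof.
have gw k v : GRing.comm (gen t C y k) (wp v).
  by apply: commr_prod => j _; apply: gen_comm.
have rem_wp k v : k \in v -> wp v = gen t C y k * wp (rem k v).
  elim: v => [//|j v IH]; rewrite inE /wordprod /= => kv.
  case: (eqVneq j k) kv => [->|jk] /=; first by rewrite big_cons.
  move=> /IH e.
  by rewrite !big_cons -/(wp v) e !mulrA (gen_comm j k Cy).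
elim: w w' => [|k w IH] w' ww'.
  by move: ww'; rewrite perm_sym => /perm_nilP->.
have kw' : k \in w' by rewrite -(perm_mem ww') mem_head.
rewrite /wordprod big_cons -/(wp w) -/(wp w') (rem_wp k w') // (IH (rem k w')) //.
by rewrite -(perm_cons k) (perm_trans ww') // perm_to_rem.
Qed.

Lemma wordwt_perm w w' : perm_eq w w' -> wordwt w = wordwt w'.
Proof. exact: perm_big. Qed.

Definition wvec N (i : 'I_(size (swords N))) : A := wp (tnth (in_tuple (swords N)) i).

Lemma wvec_span N : lspan (range (@wvec N)) = lspan [set wp w | w in [set w | (wordwt w <= N)%N]].
Proof.
apply/seteqP; split; apply: lspan_min; try exact: lspan_subspace.
  move=> _ [i _ <-]; apply: mem_lspan; exists (tnth (in_tuple (swords N)) i) => //=.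
  by have := mem_tnth i (in_tuple (swords N)); rewrite mem_swords => /andP[].
move=> _ [w /= wN <-].
have ww : perm_eq w (sort leq w) by rewrite perm_sym perm_sort.
have : sort leq w \in swords N.
  by rewrite mem_swords (sort_sorted leq_total) -(wordwt_perm ww).
rewrite -[swords N]/(tval (in_tuple (swords N))) => /tnthP[i iE].
by rewrite (wordprod_perm ww) iE -[wp _]/(wvec i); apply: mem_lspan_range.
Qed.

Lemma wvec_lead N (c : 'I_(size (swords N)) -> K) n0 :
  (forall n S T, (n0 <= n)%N -> symbol_at t F T S -> S n (\sum_i c i *: wvec i) = 0) ->
  forall i, (n0 <= wordwt (tnth (in_tuple (swords N)) i))%N -> c i = 0.
Proof.
move=> E i.
(* The coefficients as a function on words, with value 0 off the list. *)
pose c' w := if insub (index w (swords N)) is Some j then c j else 0.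
have uS : uniq (swords N) by exact: undup_uniq.
have cE j : c' (tnth (in_tuple (swords N)) j) = c j.
  rewrite /c' (tnth_nth [::]) index_uniq ?ltn_ord //= insubT ?ltn_ord // => jN.
  by congr c; apply: val_inj.
rewrite -cE; apply: (wordprod_lead yl (C := C) (y := y) (ws := swords N)) => //.
- by move=> w; rewrite mem_swords => /andP[].
- move=> n S T n0n ST; rewrite -[RHS](E n S T n0n ST) big_tnth; congr (S n _).
  by apply: eq_bigr => j _; rewrite cE.
- exact: mem_tnth.
Qed.

Lemma wvec_frame N : frame (F N) (@wvec N).
Proof.
split=> [i|c c0 i].
  have := mem_tnth i (in_tuple (swords N)); rewrite mem_swords => /andP[_ wN].
  exact: (yl_le yl wN) (wordprod_fil yl C y _).
apply: (wvec_lead (n0 := 0) _ _) => // n S T _ ST.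
by rewrite c0 (symbol0 ST).
Qed.

Definition bbar : set A := subalgebra_gen (range (gen t C y)).

Lemma subalgebraP (S : set A) : is_subalgebra S <->
  [/\ S 1, subspace S & forall x z, S x -> S z -> S (x * z)].
Proof.
split=> [[S1 SL SM]|[S1 [S0 SL] SM]].
  have S1' : S 1 by rewrite inE in S1.
  have SL' a x z : S x -> S z -> S (a *: x + z).
    by move=> Sx Sz; have := SL a x z; rewrite !inE; apply.
  split=> // [|x z Sx Sz]; last by have := SM x z; rewrite !inE; apply.
  by split=> //; rewrite -(addNr 1) -scaleN1r; apply: SL'.
split; first by rewrite inE.
- by move=> a x z; rewrite !inE; apply: SL.
- by move=> x z; rewrite !inE; apply: SM.
Qed.

Lemma subalgebra_gen_subalgebra (S : set A) : is_subalgebra (subalgebra_gen S).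
Proof.
apply/subalgebraP; split.
- by move=> M [/subalgebraP[]].
- split=> [|a x z Sx Sz] M [/[dup] MM /subalgebraP[_ [M0 ML] _] SM] //.
  by apply: ML; [exact: (Sx M (conj MM SM))|exact: (Sz M (conj MM SM))].
- move=> x z Sx Sz M [/[dup] MM /subalgebraP[_ _ Mm] SM].
  by apply: Mm; [exact: (Sx M (conj MM SM))|exact: (Sz M (conj MM SM))].
Qed.

Lemma bbar_subalgebra : is_subalgebra bbar.
Proof. exact: subalgebra_gen_subalgebra. Qed.

Lemma bbar_gen k : bbar (gen t C y k).
Proof. by move=> M [_ SM]; apply: SM; exists k. Qed.

Lemma bbar_wordprod w : bbar (wp w).
Proof.
have /subalgebraP[b1 _ bM] := bbar_subalgebra.
rewrite /wordprod; elim: w => [|k w IH]; first by rewrite big_nil.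
by rewrite big_cons; apply: bM => //; apply: bbar_gen.
Qed.

Let span N := lspan [set wp w | w in [set w | (wordwt w <= N)%N]].

Let spanM M N x z : span M x -> span N z -> span (M + N)%N (x * z).
Proof.
apply: (lspanM (lspan_subspace _)) => _ _ [w wM <-] [w' wN <-].
apply: mem_lspan; exists (w ++ w'); last by rewrite /wordprod big_cat.
by rewrite /= /wordwt big_cat leq_add.
Qed.

Let span_le M N : (M <= N)%N -> span M `<=` span N.
Proof.
by move=> MN; apply: lspanS => _ [w wM <-]; exists w => //=; apply: leq_trans MN.
Qed.

Lemma bbar_span x : bbar x -> exists N, span N x.
Proof.
apply: (smallest_sub (X := [set x | exists N, span N x])).
  apply/subalgebraP; split.
  - by exists 0%N; apply: mem_lspan; exists [::]; rewrite /= ?/wordwt ?/wordprod big_nil.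
  - split; first by exists 0%N; case: (lspan_subspace [set wp w | w in [set w | (wordwt w <= 0)%N]]).
    move=> a u v [M Mu] [N Nv]; exists (maxn M N).
    have [_ sL] := lspan_subspace [set wp w | w in [set w | (wordwt w <= maxn M N)%N]].
    by apply: sL; [apply: (span_le (leq_maxl M N))|apply: (span_le (leq_maxr M N))].
  - by move=> u v [M Mu] [N Nv]; exists (M + N)%N; apply: spanM.
move=> _ [k _ <-]; exists (wt k); apply: mem_lspan; exists [:: k].
  by rewrite /= /wordwt big_seq1.
by rewrite /wordprod big_seq1.
Qed.

(** An element of F N has zero symbols in all degrees above N, so by [wvec_lead] the monomials of
    larger weight do not occur in it. *)
Lemma bbar_fil N : bbar `&` F N = lspan (range (@wvec N)).
Proof.
apply/seteqP; split=> [x [/bbar_span[M Mx] Nx]|]; last first.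
  have /subalgebraP[_ bs _] := bbar_subalgebra.
  apply: lspan_min.
    split; first by split; [case: bs|case: (yl_subspace yl N)].
    move=> a u v [bu Nu] [bv Nv]; split; first by case: bs => _; apply.
    by case: (yl_subspace yl N) => _; apply.
  by move=> _ [i _ <-]; split; [exact: bbar_wordprod|case: (wvec_frame N)].
have {Mx} : lspan (range (@wvec (maxn M N))) x.
  by rewrite wvec_span; apply: span_le Mx; exact: leq_maxl.
rewrite lspan_rangeE => -[c xE].
have sL := lspan_subspace (range (@wvec N)).
rewrite xE; apply: (subspace_sum _ sL) => i _.
have [iN|Ni] := leqP (wordwt (tnth (in_tuple (swords (maxn M N))) i)) N.
  apply: (subspaceZ _ sL); rewrite wvec_span; apply: mem_lspan.
  by exists (tnth (in_tuple (swords (maxn M N))) i).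
rewrite (wvec_lead (n0 := N.+1) (c := c)) ?scale0r //; first by case: sL.
by move=> n S T Nn ST; rewrite -xE (symbol_lt ST Nn).
Qed.

End Bbar.
End Commutation.

(** * Bethe subalgebras in degrees one and two *)

Section LowDegree.
Variables (K : numClosedFieldType) (A : algType K) (t : 'I_2 -> 'I_2 -> nat -> A).
Variable F : nat -> set A.
Hypothesis yl : yangian_like t F.
Implicit Types (C P : 'M[K]_2) (y u : 'rV[K]_3).

Lemma trcZD a C P m : trc t (a *: C + P) m = a *: trc t C m + trc t P m.
Proof.
rewrite /trc scaler_sumr -big_split; apply: eq_bigr => i _.
rewrite scaler_sumr -big_split; apply: eq_bigr => j _.
by rewrite !mxE scalerDl scalerA.
Qed.

Lemma trc0 m : trc t 0 m = 0.
Proof. by rewrite /trc big1 // => i _; rewrite big1 // => j _; rewrite mxE scale0r. Qed.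

Lemma trcZ a C m : trc t (a *: C) m = a *: trc t C m.
Proof. by rewrite -[a *: C]addr0 trcZD trc0 addr0. Qed.

Lemma qdet0 : qdet t 0 = 1.
Proof.
have [t0 _] := yl_rtt yl.
by rewrite /qdet /conv !big_ord1 subnn !shift_coef0 !t0 /= mulr1 mulr0 subr0.
Qed.

(** This coincidence makes the degree 1 generator of B(C) degenerate as C tends to I, and allows tr
    C T^(1) to be replaced by tr E(y) T^(1) in [bethe_bbar]. *)
Lemma qdet1 : qdet t 1 = trc t 1%:M 1.
Proof.
have [t0 _] := yl_rtt yl.
have sh1 f : shift_coef f 1 = f 1%N :> A.
  by rewrite /shift_coef sum_ord2 /= bin0n mulr0n add0r subnn bin0.
rewrite /qdet /conv /trc !sum_ord2 /= subn0 subnn !shift_coef0 !sh1 !t0 /= !mxE /=.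
rewrite !(mulr1, mulr0, mul1r, mul0r, addr0, add0r, scale0r, scale1r, subr0) /=.
by rewrite addrC.
Qed.

Lemma trc_C0 C : trc t C 0 = (C 0 0 + C 1 1) *: 1.
Proof.
have [t0 _] := yl_rtt yl.
by rewrite /trc !sum_ord2 !t0 /= !scaler0 addr0 add0r scalerDl.
Qed.

Lemma bbar_scale C y a b : a != 0 -> b != 0 -> bbar t (a *: C) (b *: y) = bbar t C y.
Proof.
move=> a0 b0.
have gE k : exists2 s, s != 0 & gen t (a *: C) (b *: y) k = s *: gen t C y k.
  rewrite /gen; case: (odd k); last by exists 1; rewrite ?oner_eq0 // scale1r.
  by case: (k./2) => [|m]; [exists b; rewrite // offmatZ trcZ|exists a; rewrite // trcZ].
apply/seteqP; split; apply: smallest_sub; try exact: bbar_subalgebra.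
  move=> _ [k _ <-]; have [s s0 ->] := gE k.
  have /subalgebraP[_ sb _] := bbar_subalgebra t C y.
  exact: (subspaceZ _ sb (bbar_gen k)).
move=> _ [k _ <-]; have [s s0 e] := gE k.
have /subalgebraP[_ sb _] := bbar_subalgebra t (a *: C) (b *: y).
rewrite -[gen t C y k](scalerK s0) -e.
exact: (subspaceZ _ sb (bbar_gen k)).
Qed.

Definition bethe_alg C : set A := subalgebra_gen (range (qdet t) `|` range (trc t C)).

Lemma bethe_bbar C y c l : l != 0 -> C = c%:M + l *: offmat y ->
  bethe_alg C = bbar t C y.
Proof.
move=> l0 CE.
have trE : trc t C 1 = c *: qdet t 1 + l *: trc t (offmat y) 1.
  by rewrite CE -scalemx1 trcZD trcZ qdet1.
have sB : is_subalgebra (bethe_alg C) by apply: subalgebra_gen_subalgebra.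
have /subalgebraP[B1 sBs BM] := sB.
have qB m : bethe_alg C (qdet t m) by move=> M [_ MS]; apply: MS; left; exists m.
have tB m : bethe_alg C (trc t C m) by move=> M [_ MS]; apply: MS; right; exists m.
have sb := bbar_subalgebra t C y.
have /subalgebraP[b1 sbs bM] := sb.
have qb m : bbar t C y (qdet t m).
  case: m => [|m]; first by rewrite qdet0.
  by have := @bbar_gen K A t C y m.*2; rewrite /gen odd_double /wt doubleK.
have yb : bbar t C y (trc t (offmat y) 1) by have := @bbar_gen K A t C y 1; rewrite /gen.
apply/seteqP; split; apply: smallest_sub => //.
  move=> _ [[m _ <-]|[m _ <-]]; first exact: qb.
  case: m => [|[|m]].
  - by rewrite trc_C0; exact: (subspaceZ _ sbs b1).
  - rewrite trE; exact: (subspaceD sbs (subspaceZ _ sbs (qb 1%N)) (subspaceZ _ sbs yb)).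
  - have := @bbar_gen K A t C y (m.+1.*2.+1).
    by rewrite /gen /= odd_double /wt /= uphalf_double.
move=> _ [k _ <-]; rewrite /gen; case: ifP => _; last exact: qB.
case: (k./2) => [|m]; last exact: tB.
have -> : trc t (offmat y) 1 = l^-1 *: (trc t C 1 - c *: qdet t 1).
  by rewrite trE addrAC subrr add0r scalerK.
exact: (subspaceZ _ sBs (subspaceB sBs (tB 1%N) (subspaceZ _ sBs (qB 1%N)))).
Qed.

Lemma symbol_12 (M1 M2 : 'M[K]_2) : exists T S, [/\ symbol_at t F T S,
  forall C, S 1%N (trc t C 1) = mxpair C M1, forall C, S 2%N (trc t C 2) = mxpair C M2 &
  S 2%N (qdet t 2) = M2 0 0 + M2 1 1 + bdet M1 M1].
Proof.
pose tau r : 'M[K]_2 := match r with 0%N => 1%:M | 1%N => M1 | _ => M2 end.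
pose T0 : 'M[{poly K}]_2 := \matrix_(i, j) \poly_(r < 3) tau r i j.
have T0E i j r : (r <= 2)%N -> (T0 i j)`_r = tau r i j.
  by move=> rN; rewrite mxE coef_poly ltnS rN.
have [|T [[x [p [n TE]]] TT0]] := @realizable_approx K T0 2.
  by move=> i j; rewrite T0E // mxE.
have [S ST] := yl_symbol yl x p n; rewrite -TE in ST.
have TS i j r : (r <= 2)%N -> (T i j)`_r = tau r i j by move=> rN; rewrite TT0 ?T0E.
exists T, S; split=> // [C|C|].
- by rewrite (symbol_trc ST); apply: eq_bigr => i _; apply: eq_bigr => j _; rewrite TS.
- by rewrite (symbol_trc ST); apply: eq_bigr => i _; apply: eq_bigr => j _; rewrite TS.
- rewrite (symbol_qdet yl ST) !big_ord_recl big_ord0 /= !TS // /bump /= !mxE /=.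
  by rewrite /bdet; ring.
Qed.

Local Notation q := (qdet t 1).
Local Notation b y := (trc t (offmat y) 1).

(** The monomials of weight at most 2 other than tr C T^(2), none of which involves C. As C is a
    combination of I and E(y), the span of [M9 y] contains the part of degree at most 2 for every C
    compatible with y. *)
Definition U7 y : seq A := [:: 1; q; b y; q * q; q * b y; b y * b y; qdet t 2].
Definition M9 y : seq A := U7 y ++ [:: trc t 1%:M 2; trc t (offmat y) 2].

Let F1 C : F 1%N (trc t C 1).
Proof. exact: trc_fil. Qed.
Let F01 : F 0%N 1 := yl_1 yl.

(** The coefficients of index 0, 1, 2 belong to elements of degree at most 1 and do not contribute.
    The matrix P is 1 for [M9_free] and C for [W2_line]. *)
Lemma symbol2_comb (M1 M2 : 'M[K]_2) : exists T S, [/\ symbol_at t F T S,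
  forall C, S 2%N (trc t C 2) = mxpair C M2 &
  forall y P (a : nat -> K),
  S 2%N (\sum_(i < 9) a i *: nth 0 (U7 y ++ [:: trc t P 2; trc t (offmat y) 2]) i) =
  a 3%N * mxpair 1%:M M1 ^+ 2 + a 4%N * (mxpair 1%:M M1 * mxpair (offmat y) M1)
  + a 5%N * mxpair (offmat y) M1 ^+ 2 + a 6%N * (M2 0 0 + M2 1 1 + bdet M1 M1)
  + a 7%N * mxpair P M2 + a 8%N * mxpair (offmat y) M2].
Proof.
have [T [S [ST S1 S2 Sq]]] := symbol_12 M1 M2; exists T, S; split=> // y P a.
have S01 : S 2%N 1 = 0 by apply: (symbol_lt ST _ F01).
have S11 C : S 2%N (trc t C 1) = 0 by apply: (symbol_lt ST _ (F1 C)).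
have S2M C C' : S 2%N (trc t C 1 * trc t C' 1) = mxpair C M1 * mxpair C' M1.
  by rewrite -[2%N]/(1 + 1)%N (symbolM ST) ?S1.
rewrite !big_ord_recl big_ord0 /= !(symbolD ST) !(symbolZ ST) (symbol0 ST).
rewrite qdet1 !S2M !S11 !S2 S01 Sq /bump /=.
by rewrite !mulr0 !add0r addr0 -!addrA !expr2.
Qed.

Lemma symbol1_comb (M1 : 'M[K]_2) : exists T S, [/\ symbol_at t F T S,
  S 1%N 1 = 0 & forall C, S 1%N (trc t C 1) = mxpair C M1].
Proof.
have [T [S [ST S1 S2 Sq]]] := symbol_12 M1 0; exists T, S; split=> //.
by apply: (symbol_lt ST _ F01).
Qed.

Lemma mxpair0 C : mxpair C 0 = 0 :> K.
Proof. by rewrite mxpairE !mxE !mulr0 !addr0. Qed.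
Lemma mxpair1 P : mxpair 1%:M P = P 0 0 + P 1 1.
Proof. by rewrite mxpairE !mxE /= !mul1r !mul0r addr0 add0r. Qed.

Definition nth_fam n (s : seq A) (i : 'I_n) : A := nth 0 s i.

Lemma nth_fam8 y z (V : set A) i : (forall k, (k < 7)%N -> V (nth 0 (U7 y) k)) -> V z ->
  V (@nth_fam 8 (U7 y ++ [:: z]) i).
Proof.
move=> VU Vz; rewrite /nth_fam nth_cat; case: ltnP => [/VU//|i7].
by have -> : (i : nat) = 7%N by apply/eqP; rewrite eqn_leq i7 -ltnS ltn_ord.
Qed.

Lemma span_nthP n s x : lspan (range (@nth_fam n s)) x <->
  exists a : nat -> K, x = \sum_(i < n) a i *: nth 0 s i.
Proof.
rewrite lspan_rangeE; split=> [[c ->]|[a ->]]; last by exists (fun i => a i).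
exists (fun k => if insub k is Some i then c i else 0).
by apply: eq_bigr => i _; rewrite valK.
Qed.

Lemma mem_span_nth n s k : (k < n)%N -> lspan (range (@nth_fam n s)) (nth 0 s k).
Proof. by move=> kn; apply: mem_lspan; exists (Ordinal kn). Qed.

Lemma free_nthP n s : lindep_free (@nth_fam n s) <->
  forall a : nat -> K, \sum_(i < n) a i *: nth 0 s i = 0 -> forall k, (k < n)%N -> a k = 0.
Proof.
split=> [sf a a0 k kn|sf c c0 i]; first exact: (sf (fun i => a i) a0 (Ordinal kn)).
have := sf (fun k => if insub k is Some j then c j else 0) _ i (ltn_ord i).
rewrite valK; apply; rewrite -[RHS]c0; apply: eq_bigr => j _; by rewrite valK.
Qed.

Lemma free_prefix m n s s' : (m <= n)%N -> take m s = take m s' ->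
  lindep_free (@nth_fam n s) -> lindep_free (@nth_fam m s').
Proof.
move=> mn ss' /free_nthP sf; apply/free_nthP => a a0 k km.
have := sf (fun k => if (k < m)%N then a k else 0) _ k (leq_trans km mn).
rewrite km; apply; rewrite -[RHS]a0.
rewrite (big_ord_widen n (fun k => a k *: nth 0 s' k) mn) [RHS]big_mkcond /=.
apply: eq_bigr => i _; case: ifP => im; last by rewrite scale0r.
by rewrite -(nth_take _ im) ss' nth_take.
Qed.

Lemma M9_free y : y != 0 -> lindep_free (@nth_fam 9 (M9 y)).
Proof.
move=> y0; apply/free_nthP => a a0.
have E (M1 M2 : 'M[K]_2) : a 3%N * mxpair 1%:M M1 ^+ 2 + a 4%N * (mxpair 1%:M M1 * mxpair (offmat y) M1)
    + a 5%N * mxpair (offmat y) M1 ^+ 2 + a 6%N * (M2 0 0 + M2 1 1 + bdet M1 M1)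
    + a 7%N * mxpair 1%:M M2 + a 8%N * mxpair (offmat y) M2 = 0.
  by have [T [S [ST _ <-]]] := symbol2_comb M1 M2; rewrite a0 (symbol0 ST).
(* With zero trace, zero pairing and determinant 1 in degree 1, and the zero matrix in degree 2,
   only qdet T^(2) contributes. *)
have a6 : a 6%N = 0.
  have [Q [Q1 Q2 Q3 _]] := solve_det 0 0 1 y0.
  have := E Q 0; rewrite !mxpair0 mxpair1 Q1 Q2 Q3 !mxE => <-; ring.
have a7 : a 7%N = 0.
  have [Q [Q1 Q2]] := solve_trace_pair 1 0 y0.
  by have := E 0 Q; rewrite !mxpair0 !mxpair1 Q1 Q2 a6 => <-; ring.
have a8 : a 8%N = 0.
  have [Q [Q1 Q2]] := solve_trace_pair 0 1 y0.
  by have := E 0 Q; rewrite !mxpair0 !mxpair1 Q1 Q2 a6 => <-; ring.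
have {}E x z : a 3%N * x ^+ 2 + a 4%N * (x * z) + a 5%N * z ^+ 2 = 0.
  have [Q [Q1 Q2]] := solve_trace_pair x z y0.
  by have := E Q 0; rewrite !mxpair0 !mxpair1 Q1 Q2 a6 => <-; ring.
have a3 : a 3%N = 0 by have := E 1 0 => <-; ring.
have a5 : a 5%N = 0 by have := E 0 1 => <-; ring.
have a4 : a 4%N = 0 by have := E 1 1; rewrite a3 a5 => <-; ring.
move: a0; rewrite !big_ord_recl big_ord0 /= /bump /= !add1n a3 a4 a5 a6 a7 a8.
rewrite !scale0r !addr0 => a0.
have {}E x z : a 1%N * x + a 2%N * z = 0.
  have [Q [Q1 Q2]] := solve_trace_pair x z y0.
  have [T [S [ST S0 S1]]] := symbol1_comb Q.
  have := congr1 (S 1%N) a0; rewrite !(symbolD ST) !(symbolZ ST) (symbol0 ST).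
  by rewrite S0 qdet1 !S1 mxpair1 Q1 Q2 mulr0 add0r.
have a1 : a 1%N = 0 by have := E 1 0 => <-; ring.
have a2 : a 2%N = 0 by have := E 0 1 => <-; ring.
move: a0; rewrite a1 a2 !scale0r !addr0 => a00.
have a0 : a 0%N = 0.
  have [T [S [ST S0 S1]]] := symbol1_comb 0.
  by have := congr1 (S 0%N) a00; rewrite (symbolZ ST) (symbol1 ST) mulr1 (symbol0 ST).
by do 9 (case=> [//|]).
Qed.

(** A family independent of y whose span contains the degree 1 parts at all points at once. *)
Definition M5 : seq A := [:: 1; q; b (delta_mx 0 0); b (delta_mx 0 1); b (delta_mx 0 2)].

Lemma offmat_decomp u : b u = u 0 0 *: b (delta_mx 0 0) + u 0 1 *: b (delta_mx 0 1)
  + u 0 2 *: b (delta_mx 0 2).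
Proof.
rewrite -!trcZ -!offmatZ -[trc t _ 1 + trc t _ 1 + _](_ : trc t (offmat (u 0 0 *: delta_mx 0 0
  + u 0 1 *: delta_mx 0 1 + u 0 2 *: delta_mx 0 2)) 1 = _).
  congr (trc t (offmat _) 1); apply/rowP => -[[|[|[|//]]] i3]; rewrite !mxE /=;
    rewrite ?mulr1 ?mulr0 ?addr0 ?add0r; congr (u 0 _); exact: val_inj.
by rewrite -[u 0 0 *: _]scale1r -addrA offmatZD trcZD scale1r scale1r -[u 0 1 *: delta_mx 0 1]scale1r
  offmatZD trcZD !scale1r addrA.
Qed.

Lemma M5_free : lindep_free (@nth_fam 5 M5).
Proof.
apply/free_nthP => a a0.
have E (Q : 'M[K]_2) : a 1%N * (Q 0 0 + Q 1 1) + a 2%N * Q 1 0 + a 3%N * Q 0 1 + a 4%N * Q 0 0 = 0.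
  have [T [S [ST S0 S1]]] := symbol1_comb Q.
  have := congr1 (S 1%N) a0; rewrite (symbol0 ST) => <-.
  rewrite !big_ord_recl big_ord0 /= /bump /= !add1n !(symbolD ST) !(symbolZ ST) (symbol0 ST).
  rewrite S0 qdet1 !S1 mxpair1 !mxpair_offmat !mxE /=; ring.
have a1 : a 1%N = 0 by have := E (delta_mx 1 1); rewrite !mxE /= => <-; ring.
have a2 : a 2%N = 0 by have := E (delta_mx 1 0); rewrite !mxE /= => <-; ring.
have a3 : a 3%N = 0 by have := E (delta_mx 0 1); rewrite !mxE /= => <-; ring.
have a4 : a 4%N = 0 by have := E (delta_mx 0 0); rewrite !mxE /= a1 => <-; ring.
move: a0; rewrite !big_ord_recl big_ord0 /= /bump /= !add1n a1 a2 a3 a4.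
rewrite !scale0r !addr0 => a00.
have a0 : a 0%N = 0.
  have [T [S [ST S0 S1]]] := symbol1_comb 0.
  by have := congr1 (S 0%N) a00; rewrite (symbolZ ST) (symbol1 ST) mulr1 (symbol0 ST).
by do 5 (case=> [//|]).
Qed.

Section Fixed.
Variables (C : 'M[K]_2) (y : 'rV[K]_3) (Cy : compatible C y).

Local Notation W N := (lspan (range (@wvec _ _ t C y N))).

Lemma W_wordprod N w : (wordwt w <= N)%N -> W N (wordprod t C y w).
Proof. by move=> wN; rewrite (wvec_span yl Cy); apply: mem_lspan; exists w. Qed.

Lemma wordwt_cons k w : wordwt (k :: w) = (wt k + wordwt w)%N.
Proof. by rewrite /wordwt big_cons. Qed.
Lemma wordwt_nil : wordwt [::] = 0%N.
Proof. by rewrite /wordwt big_nil. Qed.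

Lemma wordprod_cons k w : wordprod t C y (k :: w) = gen t C y k * wordprod t C y w.
Proof. by rewrite /wordprod big_cons. Qed.
Lemma wordprod_nil : wordprod t C y [::] = 1.
Proof. by rewrite /wordprod big_nil. Qed.

Lemma W_gen k : W (wt k) (gen t C y k).
Proof.
by have := @W_wordprod (wt k) [:: k]; rewrite wordwt_cons wordwt_nil addn0 wordprod_cons wordprod_nil mulr1; apply.
Qed.

Lemma W_1 N : W N 1.
Proof. by rewrite -wordprod_nil; apply: W_wordprod; rewrite wordwt_nil. Qed.

Lemma W1_q : W 1 q. Proof. by have := @W_gen 0. Qed.
Lemma W1_b : W 1 (b y). Proof. by have := @W_gen 1. Qed.
Lemma W2_C : W 2 (trc t C 2). Proof. by have := @W_gen 3. Qed.

Lemma W1_sub : W 1 `<=` lspan (range (@nth_fam 3 [:: 1; q; b y])).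
Proof.
rewrite (wvec_span yl Cy); apply: (lspan_min (lspan_subspace _)) => _ [w /= w1 <-].
case: w w1 => [_|k [|k' w]].
- by rewrite wordprod_nil; apply: (@mem_span_nth 3 [:: 1; q; b y] 0).
- rewrite wordwt_cons wordwt_nil addn0 wordprod_cons wordprod_nil mulr1.
  case: k => [|[|k]] // _; first exact: (@mem_span_nth 3 [:: 1; q; b y] 1).
  exact: (@mem_span_nth 3 [:: 1; q; b y] 2).
- by rewrite !wordwt_cons /wt !addSn !addnS.
Qed.

Lemma W2_sub : W 2 `<=` lspan (range (@nth_fam 8 (U7 y ++ [:: trc t C 2]))).
Proof.
rewrite (wvec_span yl Cy); apply: (lspan_min (lspan_subspace _)) => _ [w /= w1 <-].
pose s := U7 y ++ [:: trc t C 2].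
case: w w1 => [_|k [|k' [|k'' w]]].
- by rewrite wordprod_nil; apply: (@mem_span_nth 8 s 0).
- rewrite wordwt_cons wordwt_nil addn0 wordprod_cons wordprod_nil mulr1.
  case: k => [|[|[|[|k]]]] // _.
  + exact: (@mem_span_nth 8 s 1).
  + exact: (@mem_span_nth 8 s 2).
  + exact: (@mem_span_nth 8 s 6).
  + exact: (@mem_span_nth 8 s 7).
- rewrite !wordwt_cons wordwt_nil addn0 !wordprod_cons wordprod_nil mulr1.
  case: k => [|[|k]]; case: k' => [|[|k']] //; rewrite ?addnS // => _.
  + exact: (@mem_span_nth 8 s 3).
  + exact: (@mem_span_nth 8 s 4).
  + rewrite (gen_comm yl 1 0 Cy); exact: (@mem_span_nth 8 s 4).
  + exact: (@mem_span_nth 8 s 5).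
- by rewrite !wordwt_cons /wt !addSn !addnS.
Qed.

Lemma W1_line u : W 1 (b u) -> exists s, u = s *: y.
Proof.
move=> /W1_sub/span_nthP[a]; rewrite !big_ord_recl big_ord0 /= /bump /= !add1n => bu.
exists (a 2%N); have E (Q : 'M[K]_2) : mxpair (offmat u) Q =
    a 1%N * (Q 0 0 + Q 1 1) + a 2%N * mxpair (offmat y) Q.
  have [T [S [ST S0 S1]]] := symbol1_comb Q.
  have := congr1 (S 1%N) bu; rewrite !(symbolD ST) !(symbolZ ST) (symbol0 ST).
  by rewrite S0 qdet1 !S1 mxpair1 mulr0 add0r addr0.
(* [delta_mx 1 1] has trace 1 and pairs to 0 with every [offmat]. *)
have a1 : a 1%N = 0.
  by have := E (delta_mx 1 1); rewrite !mxpair_offmat !mxE /= !mulr0 !addr0 add0r mulr0 addr0 mulr1.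
apply/rowP => -[[|[|[|//]]] i3]; rewrite mxE.
- have := E (delta_mx 1 0); rewrite !mxpair_offmat !mxE /= a1 !mulr0 !mul0r !addr0 !add0r !mulr1.
  by move=> e; rewrite (_ : Ordinal i3 = 0) //; apply: val_inj.
- have := E (delta_mx 0 1); rewrite !mxpair_offmat !mxE /= a1 !mulr0 !mul0r !addr0 !add0r !mulr1.
  by move=> e; rewrite (_ : Ordinal i3 = 1) //; apply: val_inj.
- have := E (delta_mx 0 0); rewrite !mxpair_offmat !mxE /= a1 !mulr0 !mul0r !addr0 !add0r !mulr1.
  by move=> e; rewrite (_ : Ordinal i3 = 2) //; apply: val_inj.
Qed.

Lemma W2_line P : W 2 (trc t P 2) -> exists s, P = s *: C.
Proof.
have [y0 _] := Cy.
move=> /W2_sub/span_nthP[a Pa]; pose a' k := if (k < 8)%N then a k else 0.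
have {}Pa : trc t P 2 = \sum_(i < 9) a' i *: nth 0 (U7 y ++ [:: trc t C 2; trc t (offmat y) 2]) i.
  rewrite Pa [RHS]big_ord_recr /= /a' scale0r addr0; apply: eq_bigr => i _ /=.
  by rewrite ltn_ord; congr (_ *: _); case: i => -[|[|[|[|[|[|[|[|//]]]]]]]] ?.
have a8 : a' 8%N = 0 by [].
clearbody a'.
have E (M1 M2 : 'M[K]_2) : mxpair P M2 =
    a' 3%N * mxpair 1%:M M1 ^+ 2 + a' 4%N * (mxpair 1%:M M1 * mxpair (offmat y) M1)
    + a' 5%N * mxpair (offmat y) M1 ^+ 2 + a' 6%N * (M2 0 0 + M2 1 1 + bdet M1 M1)
    + a' 7%N * mxpair C M2 + a' 8%N * mxpair (offmat y) M2.
  by have [T [S [ST <- <-]]] := symbol2_comb M1 M2; rewrite -Pa.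
(* The same test matrix as in [M9_free] separates the determinant from the traces; afterwards only
   degree 2 is left to vary. *)
have a6 : a' 6%N = 0.
  have [Q [Q1 Q2 Q3 _]] := solve_det 0 0 1 y0.
  by have := E Q 0; rewrite !mxpair0 mxpair1 Q1 Q2 Q3 !mxE => /esym <-; ring.
exists (a' 7%N).
have {}E (M2 : 'M[K]_2) : mxpair P M2 = a' 7%N * mxpair C M2.
  by rewrite (E 0 M2) a6 a8 !mxpair0; ring.
apply/matrixP => i j; have := E (delta_mx j i); rewrite !mxpairE !mxE.
by elim/ord2_ind: i; elim/ord2_ind: j; rewrite /= !(mulr1, mulr0, addr0, add0r).
Qed.

End Fixed.

End LowDegree.

(** * Limits of Bethe subalgebras *)

(** The coordinates of the matrices extend to functionals on all of [V], obtained by separating each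
    [iota (delta_mx i j)] from the image of the matrices whose entry (i, j) is 0. *)
Lemma mx_left_inverse (K : fieldType) (V : lmodType K) m n
    (iota : {linear 'M[K]_(m, n) -> V}) : injective iota ->
  exists pi : {linear V -> 'M[K]_(m, n)}, forall u, pi (iota u) = u.
Proof.
move=> iota_inj.
have coord (p : 'I_m * 'I_n) : exists l : {scalar V}, forall u, l (iota u) = u p.1 p.2.
  pose S := [set iota u | u in [set u : 'M_(m, n) | u p.1 p.2 = 0]].
  have sS : subspace S.
    split; first by exists 0; rewrite /= ?mxE ?linear0.
    move=> a _ _ [u u0 <-] [v v0 <-]; exists (a *: u + v); last by rewrite linearP.
    by rewrite /= !mxE u0 v0 mulr0 addr0.
  have [|l [l1 l0]] := separating_functional (v := iota (delta_mx p.1 p.2)) sS.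
    by move=> [u + /iota_inj ue]; rewrite /= ue mxE !eqxx => /eqP; rewrite oner_eq0.
  exists l => u; have : l (iota (u - u p.1 p.2 *: delta_mx p.1 p.2)) = 0.
    by apply: l0; exists (u - u p.1 p.2 *: delta_mx p.1 p.2); rewrite //= !mxE !eqxx mulr1 subrr.
  by rewrite !linearB !linearZ /= l1 mulr1 => /eqP; rewrite subr_eq0 => /eqP.
have /choice[l lP] := coord.
have [pi piE] : exists pi : {linear V -> 'M[K]_(m, n)},
    forall x, pi x = \matrix_(i, j) l (i, j) x.
  by apply: ex_linear => a x y; apply/matrixP => i j; rewrite !mxE linearP.
by exists pi => u; rewrite piE; apply/matrixP => i j; rewrite mxE lP.
Qed.

Section ClosureSteps.
Variables (K : numClosedFieldType) (A : algType K) (t : 'I_2 -> 'I_2 -> nat -> A).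
Variable F : nat -> set A.
Hypothesis yl : yangian_like t F.
Implicit Types (C P : 'M[K]_2) (y u : 'rV[K]_3).

Local Notation W C y N := (lspan (range (@wvec K A t C y N))).
Local Notation q := (qdet t 1).
Local Notation b y := (trc t (offmat y) 1).
Local Notation dim N := (size (swords N)).

(** The point of the exceptional divisor in direction y, a convenient representative when only y is
    known. *)
Lemma compatible1 y : y != 0 -> compatible 1%:M y.
Proof.
by move=> y0; split=> //; exists 1, 0; rewrite oner_eq0 scale0r addr0.
Qed.

Lemma compatible_scale C y a c : compatible C y -> a != 0 -> c != 0 ->
  compatible (a *: C) (c *: y).
Proof.
move=> [y0 [k [l [kl ->]]]] a0 c0; split; first by rewrite scaler_eq0 negb_or c0.
exists (a * k), (a * l / c); rewrite !mulf_eq0 invr_eq0 (negPf a0) (negPf c0) !orbF /=.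
split=> //; rewrite offmatZ scalerA divfK // scalerDr scalerA; congr (_ + _).
by apply/matrixP => i j; rewrite !mxE mulrnAr.
Qed.

Lemma W_scale C y a c N : compatible C y -> a != 0 -> c != 0 ->
  W (a *: C) (c *: y) N = W C y N.
Proof.
move=> Cy a0 c0; rewrite -!(bbar_fil yl) //; last exact: compatible_scale.
by rewrite bbar_scale.
Qed.

Lemma mxpair_inj P : (forall Q, mxpair P Q = 0) -> P = 0.
Proof.
move=> P0; apply/matrixP => i j; have := P0 (delta_mx j i); rewrite mxpairE !mxE.
by elim/ord2_ind: i; elim/ord2_ind: j; rewrite /= !(mulr1, mulr0, addr0, add0r).
Qed.

Lemma offmat_inj u : offmat u = 0 -> u = 0.
Proof.
move=> u0; apply/eqP/negPn/negP => /row3_neq0[].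
- by have := congr1 (fun P : 'M_2 => P 0 1) u0; rewrite !mxE /= => ->; rewrite eqxx.
- by have := congr1 (fun P : 'M_2 => P 1 0) u0; rewrite !mxE /= => ->; rewrite eqxx.
- by have := congr1 (fun P : 'M_2 => P 0 0) u0; rewrite !mxE /= => ->; rewrite eqxx.
Qed.

Lemma compatible_neq0 C y : compatible C y -> C != 0.
Proof.
move=> [y0 [c [l [+ ->]]]]; rewrite -negb_and; apply: contra => /eqP CE.
have c0 : c = 0.
  have := congr1 (fun M : 'M_2 => M 1 1) CE.
  by rewrite !mxE /= mulr1n mulr0 addr0.
rewrite c0 eqxx /=; apply/negPn/negP => l0; case/eqP: y0; apply: offmat_inj.
rewrite -[offmat y](scalerK l0); apply/eqP; rewrite scaler_eq0 invr_eq0 (negPf l0) /=.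
rewrite c0 (_ : 0%:M = 0) ?add0r in CE; last exact: raddf0.
by apply/eqP.
Qed.

Lemma ex_iota1 : exists (iota : {linear 'rV[K]_3 -> A}) (pi : {linear A -> 'rV[K]_3}),
  (forall u, iota u = b u) /\ forall u, pi (iota u) = u.
Proof.
have [iota iE] : exists iota : {linear 'rV[K]_3 -> A}, forall u, iota u = b u.
  by apply: ex_linear => a u v; rewrite offmatZD trcZD.
have [|pi piK] := mx_left_inverse (iota := iota); last by exists iota, pi.
apply: raddf_inj => u u0; have {}u0 : b u = 0 by rewrite -iE.
apply/offmat_inj/mxpair_inj => Q.
by have [T [S [ST _ <-]]] := symbol1_comb yl Q; rewrite u0 (symbol0 ST).
Qed.

Lemma ex_iota2 : exists (iota : {linear 'M[K]_2 -> A}) (pi : {linear A -> 'M[K]_2}),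
  (forall P, iota P = trc t P 2) /\ forall P, pi (iota P) = P.
Proof.
have [iota iE] : exists iota : {linear 'M[K]_2 -> A}, forall P, iota P = trc t P 2.
  by apply: ex_linear => a P Q; rewrite trcZD.
have [|pi piK] := mx_left_inverse (iota := iota); last by exists iota, pi.
apply: raddf_inj => P P0; have {}P0 : trc t P 2 = 0 by rewrite -iE.
apply/mxpair_inj => Q.
by have [T [S [ST <- _]]] := symbol2_comb yl 0 Q; rewrite P0 (symbol0 ST).
Qed.

Lemma W1_lineP C y u : compatible C y -> W C y 1 (b u) <-> exists a, u = a *: y.
Proof.
move=> Cy; split=> [/(W1_line yl Cy)//|[a ->]].
by rewrite offmatZ trcZ; apply: (subspaceZ _ (lspan_subspace _)); exact: (W1_b yl Cy).
Qed.

Lemma W2_lineP C y P : compatible C y -> W C y 2 (trc t P 2) <-> exists a, P = a *: C.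
Proof.
move=> Cy; split=> [/(W2_line yl Cy)//|[a ->]].
by rewrite trcZ; apply: (subspaceZ _ (lspan_subspace _)); exact: (W2_C yl Cy).
Qed.

Lemma W_full C y N d (v : 'I_d -> A) (V : set A) : compatible C y -> d = dim N ->
  V = lspan (range v) -> W C y N `<=` V -> V = W C y N.
Proof.
move=> Cy dN; rewrite {}dN in v * => VE WV.
by apply: lspan_full_sub WV VE; case: (wvec_frame yl Cy N).
Qed.

(** The limit arguments use lower bounds on dimensions: a limit subspace cannot lie in the span of
    too few vectors. Free families provide them without an enumeration of [swords]. *)
Lemma dim1_ge3 : (3 <= dim 1)%N.
Proof.
have y0 : (delta_mx 0 0 : 'rV[K]_3) != 0.
  by apply/eqP => /rowP/(_ 0)/eqP; rewrite !mxE /= oner_eq0.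
have s3 := free_prefix (isT : (3 <= 9)%N) (erefl (take 3 (M9 t (delta_mx 0 0)))) (M9_free yl y0).
apply: free_span_le s3 (fun i => _) => i.
have Cy := compatible1 y0.
case: i => -[|[|[|//]]] ?; [exact: (W_1 yl Cy)|exact: (W1_q yl Cy)|exact: (W1_b yl Cy)].
Qed.

Lemma U7_word k : (k < 7)%N ->
  exists w, (wordwt w <= 2)%N /\ forall C y, nth 0 (U7 t y) k = wordprod t C y w.
Proof.
have pc := (wordprod_cons, wordprod_nil, mulr1).
case: k => [|[|[|[|[|[|[|//]]]]]]] _.
- by exists [::]; rewrite wordwt_nil; split=> // C y; rewrite pc.
- by exists [:: 0%N]; rewrite !wordwt_cons wordwt_nil; split=> // C y; rewrite !pc.
- by exists [:: 1%N]; rewrite !wordwt_cons wordwt_nil; split=> // C y; rewrite !pc.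
- by exists [:: 0%N; 0%N]; rewrite !wordwt_cons wordwt_nil; split=> // C y; rewrite !pc.
- by exists [:: 0%N; 1%N]; rewrite !wordwt_cons wordwt_nil; split=> // C y; rewrite !pc.
- by exists [:: 1%N; 1%N]; rewrite !wordwt_cons wordwt_nil; split=> // C y; rewrite !pc.
- by exists [:: 2%N]; rewrite !wordwt_cons wordwt_nil; split=> // C y; rewrite !pc.
Qed.

Lemma U7_W2 C y k : compatible C y -> (k < 7)%N -> W C y 2 (nth 0 (U7 t y) k).
Proof. by move=> Cy /U7_word[w [w2 /(_ C y) ->]]; exact: (W_wordprod yl Cy). Qed.

Lemma W1_indep C C' y : compatible C y -> compatible C' y -> W C y 1 = W C' y 1.
Proof.
move=> Cy Cy'; apply: (W_full Cy' erefl (erefl (W C y 1))).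
apply: subset_trans (W1_sub yl Cy') _; apply: (lspan_min (lspan_subspace _)) => _ [i _ <-].
by case: i => -[|[|[|//]]] ?; [exact: (W_1 yl Cy)|exact: (W1_q yl Cy)|exact: (W1_b yl Cy)].
Qed.

Lemma dim2_ge8 : (8 <= dim 2)%N.
Proof.
have y0 : (delta_mx 0 0 : 'rV[K]_3) != 0.
  by apply/eqP => /rowP/(_ 0)/eqP; rewrite !mxE /= oner_eq0.
have s8 : lindep_free (@nth_fam _ _ 8 (U7 t (delta_mx 0 0) ++ [:: trc t 1%:M 2])).
  by apply: free_prefix _ _ (M9_free yl y0).
apply: free_span_le s8 (fun i => _) => i.
have Cy := compatible1 y0.
exact: (nth_fam8 i (fun k => @U7_W2 _ _ k Cy) (W2_C yl Cy)).
Qed.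

Section Space.
Variables (X : kspace K) (gX : good X) (S : set X) (x0 : X).
Hypothesis clS : kclosure S x0.
Let sF := yl_subspace yl.

Lemma kreg_coord m n (U : set X) (v : X -> 'M[K]_(m, n)) i j : kopen U -> reg_vec U v ->
  kreg U (fun x => v x i j).
Proof.
move=> oU vU; have [l lE] : exists l : {scalar 'M[K]_(m, n)}, forall M, l M = M i j.
  by apply: ex_scalar => a M M'; rewrite !mxE.
by apply: (good_ext gX oU) (vU l) => x _; rewrite lE.
Qed.

Lemma reg_wordprod (U : set X) (C : X -> 'M[K]_2) (y : X -> 'rV[K]_3) w : kopen U ->
  reg_vec U C -> reg_vec U y -> reg_vec U (fun x => wordprod t (C x) (y x) w).
Proof.
move=> oU CU yU.
(* Finite sums of fixed vectors with regular coefficients: unlike [reg_vec], this form passes to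
   products at once. *)
pose R (v : X -> A) := exists (I : finType) (a : I -> X -> K) (e : I -> A),
  (forall i, kreg U (a i)) /\ forall x, v x = \sum_i a i x *: e i.
have Rcst e : R (fun=> e).
  exists 'I_1, (fun _ _ => 1), (fun=> e); split=> [_|x]; first exact: (good_cst gX).
  by rewrite big_ord1 scale1r.
have RM v v' : R v -> R v' -> R (fun x => v x * v' x).
  move=> [I [a [e [aU vE]]]] [I' [a' [e' [aU' vE']]]].
  exists (I * I')%type, (fun p x => a p.1 x * a' p.2 x), (fun p => e p.1 * e' p.2).
  split=> [p|x]; first exact: (good_mul gX).
  rewrite vE vE' mulr_suml -(pair_big xpredT xpredT
    (fun i j => (a i x * a' j x) *: (e i * e' j))) /=.
  apply: eq_bigr => i _; rewrite mulr_sumr; apply: eq_bigr => j _.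
  by rewrite -scalerAl -scalerAr scalerA.
have Rtrc (P : X -> 'M[K]_2) m : (forall i j, kreg U (fun x => P x i j)) ->
    R (fun x => trc t (P x) m).
  move=> PU; exists ('I_2 * 'I_2)%type, (fun p x => P x p.1 p.2), (fun p => t p.2 p.1 m).
  by split=> // x; rewrite /trc pair_big.
have Rgen k : R (fun x => gen t (C x) (y x) k).
  rewrite /gen; case: (odd k); last exact: Rcst.
  case: (k./2) => [|m]; apply: Rtrc => i j; last exact: kreg_coord.
  have E : (fun x => offmat (y x) i j) = (fun x => if i == 0 then
      (if j == 0 then y x 0 2 else y x 0 0) else if j == 0 then y x 0 1 else 0).
    by apply/funext => x; rewrite mxE.
  rewrite E; case: (i == 0); case: (j == 0); try exact: kreg_coord.
  exact: (good_cst gX).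
have [I [a [e [aU vE]]]] : R (fun x => wordprod t (C x) (y x) w).
  rewrite /wordprod; elim: w => [|k w IH].
    have -> : (fun x => \prod_(k <- [::]) gen t (C x) (y x) k) = fun=> 1 :> A.
      by apply/funext => x; rewrite big_nil.
    exact: Rcst.
  have -> : (fun x => \prod_(j <- k :: w) gen t (C x) (y x) j) =
      fun x => gen t (C x) (y x) k * \prod_(j <- w) gen t (C x) (y x) j.
    by apply/funext => x; rewrite big_cons.
  exact: RM.
apply: (reg_vec_ext gX oU (v := fun x => \sum_i a i x *: e i)) => [x _|].
  by rewrite vE.
apply: (@reg_vec_sum _ X gX A U _ _ _ (fun i x => a i x *: e i) oU) => i _; apply: (reg_vecZ gX oU) => //.
exact: (reg_vec_cst gX).
Qed.

Definition in_W N (f : X -> grass (F N) (dim N)) (x : X) C y := sval (f x) = W C y N.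

Variable f1 : X -> grass (F 1%N) (dim 1).
Hypothesis mf1 : kmorphism f1.

(** In the limit the subspace still contains 1 and q and lies in the span of [M5]. Its dimension is
    at least 3, so subtracting the components along 1 and q leaves tr E(u) T^(1) with u nonzero, and
    equal dimensions conclude. *)
Lemma closure_step1 :
  (forall x, S x -> exists C y, compatible C y /\ in_W f1 x C y) ->
  exists y, y != 0 /\ forall C, compatible C y -> in_W f1 x0 C y.
Proof.
move=> fS; have oT := good_openT gX.
have zq v : (forall C y, compatible C y -> W C y 1 v) -> sval (f1 x0) v.
  move=> Wv; apply: (kclosure_mem gX (sF 1) mf1 clS oT I (v := fun=> v)).
    exact: (reg_vec_cst gX).
  by move=> x /fS[C [y [Cy ->]]] _; apply: Wv.
have z1 : sval (f1 x0) 1 by apply: zq => C y Cy; exact: (W_1 yl Cy).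
have zqq : sval (f1 x0) q by apply: zq => C y Cy; exact: (W1_q yl Cy).
have zM : sval (f1 x0) `<=` lspan (range (@nth_fam _ _ 5 (M5 t))).
  apply: (kclosure_sub gX (m := fun i _ => nth_fam (M5 t) i) (sF 1) mf1 clS oT) => //.
  - by move=> i; apply: (reg_vec_cst gX).
  - exact: (M5_free yl).
  - move=> x /fS[C [y [Cy ->]]] _; apply: subset_trans (W1_sub yl Cy) _.
    apply: (lspan_min (lspan_subspace _)) => _ [i _ <-].
    case: i => -[|[|[|//]]] ? ; rewrite /nth_fam /=.
    + exact: (@mem_span_nth _ _ 5 (M5 t) 0).
    + exact: (@mem_span_nth _ _ 5 (M5 t) 1).
    + rewrite offmat_decomp; have sL := lspan_subspace (range (@nth_fam _ _ 5 (M5 t))).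
      apply: (subspaceD sL); first apply: (subspaceD sL); apply: (subspaceZ _ sL).
      * exact: (@mem_span_nth _ _ 5 (M5 t) 2).
      * exact: (@mem_span_nth _ _ 5 (M5 t) 3).
      * exact: (@mem_span_nth _ _ 5 (M5 t) 4).
have [v [_ vfree] vW] := grass_frame (f1 x0).
have sf : subspace (sval (f1 x0)) by rewrite vW; apply: lspan_subspace.
have [u un0 zu] : exists2 u, u != 0 & sval (f1 x0) (b u).
  apply: contrapT => nu; suff : (dim 1 <= 2)%N by rewrite leqNgt dim1_ge3.
  apply: (free_span_le (w := @nth_fam _ _ 2 [:: 1; q]) vfree) => i.
  have zv : sval (f1 x0) (v i) by rewrite vW; apply: mem_lspan_range.
  have /span_nthP[a av] := zM _ zv.
  move: av; rewrite !big_ord_recl big_ord0 /= /bump /= !add1n addr0 => av.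
  pose u : 'rV[K]_3 := \row_(k < 3) a k.+2.
  have bu : b u = a 2%N *: b (delta_mx 0 0) + (a 3%N *: b (delta_mx 0 1) + a 4%N *: b (delta_mx 0 2)).
    by rewrite offmat_decomp !mxE addrA.
  have vE : v i = a 0%N *: 1 + (a 1%N *: q + b u) by rewrite bu.
  have zbu : sval (f1 x0) (b u).
    have -> : b u = v i - (a 0%N *: 1 + a 1%N *: q).
      by rewrite vE addrA [X in X - _]addrC addrK.
    by apply: subspaceB => //; apply: subspaceD => //; apply: subspaceZ.
  have u0 : u = 0 by apply/eqP/negPn/negP => un0; apply: nu; exists u.
  apply/span_nthP; exists a; rewrite vE u0 !big_ord_recl big_ord0 /= /bump /= add1n.
  by rewrite (_ : b 0 = 0) // -(scale0r (0 : 'rV[K]_3)) offmatZ trcZ scale0r.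
exists u; split=> // C Cu; apply: (W_full Cu erefl vW).
apply: subset_trans (W1_sub yl Cu) _; apply: lspan_min => // _ [i _ <-].
by case: i => -[|[|[|//]]] ?.
Qed.

Variables (f2 : X -> grass (F 2%N) (dim 2)).
Hypothesis mf2 : kmorphism f2.

(** A regular lift of the line of y near the limit point, so that monomials in tr E(y) T^(1) can be
    followed into the limit. *)
Lemma closure_line1 y : y != 0 -> (forall C, compatible C y -> in_W f1 x0 C y) ->
  exists U (sg : X -> 'rV[K]_3), [/\ kopen U, U x0, reg_vec U sg, sg x0 = y &
    forall x C y', U x -> compatible C y' -> in_W f1 x C y' ->
      exists2 a, a != 0 & sg x = a *: y'].
Proof.
move=> y0 fy; have [iota [pi [iE piK]]] := ex_iota1.
have fy1 := fy _ (compatible1 y0).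
have [|U [sg [oU Ux0 sgreg sg0 sgP]]] := line_near mf1 (sF 1) piK y0 (x0 := x0).
  by move=> u; rewrite iE fy1; apply: W1_lineP; apply: compatible1.
exists U, sg; split=> // x C y' Ux Cy' fx.
have [y'0 _] := Cy'.
have [|sn0 + _] := sgP x Ux.
  by exists y' => //; rewrite iE fx; exact: (W1_b yl Cy').
rewrite iE fx => /(W1_lineP _ Cy')[a sE]; exists a => //.
by apply: contra sn0 => /eqP a0; rewrite sE a0 scale0r.
Qed.

(** Along the lift [sg], the family [U7] bounds the limit from below and [M9] from above. As its
    dimension is at least 8, the limit contains tr C T^(2) for a nonzero combination C of I and
    E(y), which is the compatibility of C and y. *)
Lemma closure_step2 :
  (forall x, S x -> exists C y, [/\ compatible C y, in_W f1 x C y & in_W f2 x C y]) ->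
  exists C y, [/\ compatible C y, in_W f1 x0 C y & in_W f2 x0 C y].
Proof.
move=> fS; have [|y [y0 fy]] := closure_step1.
  by move=> x /fS[C [y [Cy f1y _]]]; exists C, y.
have [U [sg [oU Ux0 sgreg sg0 sgP]]] := closure_line1 y0 fy.
have fS' x : S x -> U x -> exists C, compatible C (sg x) /\ in_W f2 x C (sg x).
  move=> /fS[C [y' [Cy' f1x f2x]]] Ux; have [a a0 ->] := sgP _ _ _ Ux Cy' f1x.
  have a1 := oner_neq0 K; exists C; rewrite -[C]scale1r; split.
    exact: compatible_scale.
  by rewrite /in_W W_scale.
have oreg : reg_vec U (fun x => offmat (sg x)).
  have [o oE] : exists o : {linear 'rV[K]_3 -> 'M[K]_2}, forall u, o u = offmat u.
    by apply: ex_linear => a u v; rewrite offmatZD.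
  by have -> : (fun x => offmat (sg x)) = o \o sg;
    [apply/funext => x; rewrite /= oE|apply: reg_vec_linear].
have c1reg : reg_vec U (fun=> 1%:M : 'M[K]_2) by apply: (reg_vec_cst gX).
have zU k : (k < 7)%N -> sval (f2 x0) (nth 0 (U7 t y) k).
  move=> k7; have [w [w2 wE]] := U7_word k7; rewrite -sg0 (wE 1%:M).
  apply: (kclosure_mem gX (sF 2) mf2 clS oU Ux0 (v := fun x => wordprod t 1%:M (sg x) w)).
    exact: reg_wordprod.
  move=> x Sx Ux; have [C [Cy ->]] := fS' x Sx Ux.
  by rewrite -(wE 1%:M) (wE C); exact: (W_wordprod yl Cy).
have zM : sval (f2 x0) `<=` lspan (range (@nth_fam _ _ 9 (M9 t y))).
  rewrite -sg0; apply: (kclosure_sub gX (m := fun i x => nth_fam (M9 t (sg x)) i)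
    (sF 2) mf2 clS oU) => //.
  - move=> i; rewrite /nth_fam /M9; have [i7|i7] := ltnP i 7.
      have [w [_ wE]] := U7_word i7.
      apply: (reg_vec_ext gX oU (v := fun x => wordprod t 1%:M (sg x) w)).
        by move=> x _; rewrite nth_cat i7 -(wE 1%:M).
      exact: reg_wordprod.
    apply: (reg_vec_ext gX oU (v := fun x => nth 0 [:: trc t 1%:M 2; trc t (offmat (sg x)) 2]
       (i - 7))).
      by move=> x _; rewrite nth_cat ltnNge i7.
    case: (i - 7)%N => [|[|k]] /=; last by rewrite nth_nil; apply: (reg_vec_cst gX).
      exact: (reg_vec_cst gX).
    apply: (reg_vec_ext gX oU (v := fun x => wordprod t (offmat (sg x)) (sg x) [:: 3%N])).
      by move=> x _; rewrite wordprod_cons wordprod_nil mulr1.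
    exact: reg_wordprod.
  - by apply: (M9_free yl); rewrite sg0.
  - move=> x Sx Ux; have [C [Cy ->]] := fS' x Sx Ux.
    apply: subset_trans (W2_sub yl Cy) _.
    have sL := lspan_subspace (range (@nth_fam _ _ 9 (M9 t (sg x)))).
    have UM k : (k < 7)%N -> lspan (range (@nth_fam _ _ 9 (M9 t (sg x)))) (nth 0 (U7 t (sg x)) k).
      move=> k7; have -> : nth 0 (U7 t (sg x)) k = nth 0 (M9 t (sg x)) k by rewrite nth_cat k7.
      by apply: mem_span_nth; apply: ltn_trans k7 _.
    apply: (lspan_min sL) => _ [i _ <-]; apply: (nth_fam8 i UM).
    have [_ [c [l [_ ->]]]] := Cy.
    rewrite -scalemx1 trcZD trcZ; apply: (subspaceD sL); apply: (subspaceZ _ sL).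
      exact: (@mem_span_nth _ _ 9 (M9 t (sg x)) 7).
    exact: (@mem_span_nth _ _ 9 (M9 t (sg x)) 8).
have [v [_ vfree] vW] := grass_frame (f2 x0).
have sf : subspace (sval (f2 x0)) by rewrite vW; apply: lspan_subspace.
have [C [Cy zC]] : exists C, compatible C y /\ sval (f2 x0) (trc t C 2).
  apply: contrapT => nC; suff : (dim 2 <= 7)%N by rewrite leqNgt dim2_ge8.
  apply: (free_span_le (w := @nth_fam _ _ 7 (U7 t y)) vfree) => i.
  have zv : sval (f2 x0) (v i) by rewrite vW; apply: mem_lspan_range.
  have /span_nthP[a av] := zM _ zv.
  pose u := \sum_(k < 7) a k *: nth 0 (U7 t y) k.
  have vE : v i = u + trc t ((a 7%N)%:M + a 8%N *: offmat y) 2.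
    rewrite av !big_ord_recr /= -(scalemx1 2 (a 7%N)) trcZD trcZ addrA; congr (_ + _ + _).
    by rewrite /u !big_ord_recr /= !big_ord0.
  have zu : sval (f2 x0) u.
    by apply: (subspace_sum _ sf) => k _; apply: (subspaceZ _ sf); apply: zU.
  have [/andP[/eqP a7 /eqP a8]|] := boolP ((a 7%N == 0) && (a 8%N == 0)).
    apply/span_nthP; exists a; rewrite vE a7 a8 scale0r addr0.
    by rewrite (_ : (0 : K)%:M = 0) ?trc0 ?addr0 //; apply: raddf0.
  rewrite negb_and => a78; case: nC; exists ((a 7%N)%:M + a 8%N *: offmat y); split.
    by split=> //; exists (a 7%N), (a 8%N).
  have -> : trc t ((a 7%N)%:M + a 8%N *: offmat y) 2 = v i - u.
    by rewrite vE addrAC subrr add0r.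
  exact: (subspaceB sf zv zu).
exists C, y; split=> //; first exact: fy.
apply: (W_full Cy erefl vW); apply: subset_trans (W2_sub yl Cy) _.
by apply: (lspan_min sf) => _ [i _ <-]; apply: (nth_fam8 i zU zC).
Qed.

Lemma closure_stepN N (f : X -> grass (F N) (dim N)) C y : kmorphism f ->
  (forall x, S x -> exists C y,
    [/\ compatible C y, in_W f1 x C y, in_W f2 x C y & in_W f x C y]) ->
  compatible C y -> in_W f1 x0 C y -> in_W f2 x0 C y -> in_W f x0 C y.
Proof.
move=> mf fS Cy f1x0 f2x0; have [y0 _] := Cy.
have C0 := compatible_neq0 Cy.
have [|U [sg [oU Ux0 sgreg sg0 sgP]]] := closure_line1 y0.
  by move=> C' Cy'; rewrite /in_W f1x0; apply: W1_indep.
have [iota [pi [iE piK]]] := ex_iota2.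
have [|U' [sg' [oU' Ux0' sgreg' sg0' sgP']]] := line_near mf2 (sF 2) piK C0 (x0 := x0).
  by move=> u; rewrite iE f2x0; apply: W2_lineP.
have oI := good_openI gX oU oU'.
have [v _ vW] := grass_frame (f x0).
apply: (W_full Cy erefl vW); rewrite (wvec_span yl Cy).
apply: lspan_min; first by rewrite vW; apply: lspan_subspace.
move=> _ [w /= wN <-]; rewrite -sg0 -sg0'.
apply: (kclosure_mem gX (sF N) mf clS oI (conj Ux0 Ux0')
  (v := fun x => wordprod t (sg' x) (sg x) w)).
  apply: reg_wordprod => //.
    by apply: (reg_vec_sub gX oU' oI _ sgreg') => x [].
  by apply: (reg_vec_sub gX oU oI _ sgreg) => x [].
move=> x /fS[C' [y' [Cy' f1x f2x fx]]] [Ux Ux'].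
have [a a0 sE] := sgP _ _ _ Ux Cy' f1x.
have [|s0 + _] := sgP' x Ux'.
  by exists C'; [apply: compatible_neq0 Cy'|rewrite iE f2x; exact: (W2_C yl Cy')].
rewrite iE f2x => /(W2_lineP _ Cy')[a' sE'].
have a'0 : a' != 0 by apply: contra s0 => /eqP a'0; rewrite sE' a'0 scale0r.
(* At points of [S] the two lifts are nonzero multiples of a pair that defines [f x], and such a
   rescaling does not change the span of the monomials. *)
rewrite fx sE sE' -(W_scale _ Cy' a'0 a0); exact: (W_wordprod yl (compatible_scale Cy' a'0 a0) wN).
Qed.

End Space.
End ClosureSteps.

(** * The blow-up *)

Section ProjectiveSpace.
Variables (K : fieldType) (V : lmodType K).
Implicit Types L : proj_space V.

Lemma proj_eq L L' v : v != 0 -> sval L v -> sval L' v -> L = L'.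
Proof.
by move=> v0 Lv L'v; apply: subspace_pt_inj; rewrite (proj_line v0 Lv) (proj_line v0 L'v).
Qed.

Lemma proj_exists v : v != 0 -> exists L, sval L = lspan [set v].
Proof.
move=> v0; unshelve eexists (exist _ (lspan [set v]) _ : proj_space V) => //.
exists (fun=> v); last first.
  by congr lspan; apply/seteqP; split=> x; [move=> ->; exists ord0|move=> [i _ <-]].
split=> // c; rewrite big_ord1 => /eqP; rewrite scaler_eq0 (negPf v0) orbF.
by move=> /eqP c0 i; rewrite (ord1 i).
Qed.

Definition proj_pt v (v0 : v != 0) : proj_space V := projT1 (cid (proj_exists v0)).

Lemma proj_ptE v (v0 : v != 0) : sval (proj_pt v0) = lspan [set v].
Proof. by rewrite /proj_pt; case: cid. Qed.

End ProjectiveSpace.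

Section Blowup.
Variables (K : numClosedFieldType) (A : algType K) (t : 'I_2 -> 'I_2 -> nat -> A).
Variable F : nat -> set A.
Hypothesis yl : yangian_like t F.
Implicit Types (C P : 'M[K]_2) (y u : 'rV[K]_3) (b : blowup K).

Local Notation W C y N := (lspan (range (@wvec K A t C y N))).
Local Notation dim N := (size (swords N)).

Lemma good_proj (V : lmodType K) : good (proj_space V).
Proof. exact: good_grass. Qed.

Lemma good_blowup : good (blowup K).
Proof. by apply/good_subspace/good_prodspace; apply: good_proj. Qed.

Lemma good_punctured : good (punctured K).
Proof. by apply/good_subspace/good_proj. Qed.

Definition on_blowup b C y := [/\ C != 0, y != 0, sval (sval b).1 C & sval (sval b).2 y].

Lemma on_blowup_exists b : exists C y, on_blowup b C y.
Proof.
have [C C0 CE] := proj_gen (sval b).1; have [y y0 yE] := proj_gen (sval b).2.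
by exists C, y; split=> //; rewrite ?CE ?yE; apply: mem_lspan.
Qed.

Lemma on_blowup_compatible b C y : on_blowup b C y -> compatible C y.
Proof.
move=> [C0 y0 bC by_]; split=> //; have eqs := svalP b C y bC by_.
(* Where a coordinate of y is nonzero, the equations of the blow-up say that [off_scalar C] is a
   multiple of y; the factor may be 0. *)
have [j yj] : exists j, y 0 j != 0 by case/row3_neq0: (y0) => yj; eexists; exact: yj.
exists (C 1 1), (off_scalar C 0 j / y 0 j).
have CE : C = (C 1 1)%:M + (off_scalar C 0 j / y 0 j) *: offmat y.
  rewrite {1}(offmat_off_scalar C) -offmatZ; congr (_ + offmat _).
  by apply/rowP => i; rewrite [RHS]mxE mulrAC -eqs mulfK.
split=> //; rewrite -negb_and; apply: contra C0 => /andP[/eqP c0 /eqP l0].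
by rewrite CE c0 l0 scale0r addr0 (_ : 0%:M = 0) //; apply: raddf0.
Qed.

Lemma compatible_on_blowup C y : compatible C y -> exists b, on_blowup b C y.
Proof.
move=> Cy; have C0 := compatible_neq0 Cy; have [y0 [c [l [_ CE]]]] := Cy.
unshelve eexists (exist _ (proj_pt C0, proj_pt y0) _ : blowup K).
  move=> C' y'; rewrite /= !proj_ptE => /lspan1P[a ->] /lspan1P[d ->] i j.
  rewrite CE -scalemx1 off_scalarZ off_scalarZD off_scalar1 scaler0 add0r off_scalarZ offmatK.
  by rewrite !mxE; ring.
by split=> //=; rewrite proj_ptE; apply: mem_lspan.
Qed.

Lemma blowup_eq b b' C y : on_blowup b C y -> on_blowup b' C y -> b = b'.
Proof.
case: b b' => -[L M] p [[L' M'] p'] [/= C0 y0 LC My] [_ _ /= L'C M'y].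
by apply: eq_exist; rewrite (proj_eq C0 LC L'C) (proj_eq y0 My M'y).
Qed.

(** Representatives picked by choice, with no regularity in b. The subalgebra does not depend on
    them ([balgE]), and regularity is proved with local lifts in [bpt_morphism]. *)
Definition bC b : 'M[K]_2 := projT1 (cid (on_blowup_exists b)).
Definition bY b : 'rV[K]_3 := projT1 (cid (projT2 (cid (on_blowup_exists b)))).

Lemma bCY b : on_blowup b (bC b) (bY b).
Proof. exact: (projT2 (cid (projT2 (cid (on_blowup_exists b))))). Qed.

Lemma bCY_compatible b : compatible (bC b) (bY b).
Proof. exact/on_blowup_compatible/bCY. Qed.

Definition balg b : set A := bbar t (bC b) (bY b).

Lemma balgE b C y : on_blowup b C y -> balg b = bbar t C y.
Proof.
move=> [C0 y0 bC_ by_]; have [C'0 y'0 bC' bY'] := bCY b.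
move: bC_ by_; rewrite (proj_line C'0 bC') (proj_line y'0 bY').
move=> /lspan1P[a CE] /lspan1P[c yE]; rewrite CE yE bbar_scale //.
  by apply: contra C0 => /eqP a0; rewrite CE a0 scale0r.
by apply: contra y0 => /eqP c0; rewrite yE c0 scale0r.
Qed.

Definition bpt N b : grass (F N) (dim N) :=
  exist _ (W (bC b) (bY b) N)
    (ex_intro2 _ _ _ (wvec_frame yl (bCY_compatible b) N) erefl).

Lemma bptE N b : sval (bpt N b) = balg b `&` F N.
Proof. by rewrite /balg (bbar_fil yl (bCY_compatible b)). Qed.

Lemma bpt_W N b C y : on_blowup b C y -> sval (bpt N b) = W C y N.
Proof.
by move=> bCy; rewrite bptE (balgE bCy) (bbar_fil yl (on_blowup_compatible bCy)).
Qed.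

Lemma blowup_val_morphism : kmorphism (fun b => sval b).
Proof. by apply/subspace_val_morphism/good_prodspace; apply: good_proj. Qed.

Lemma blowup_fst_morphism : kmorphism (fun b => (sval b).1).
Proof.
exact: (kmorphism_comp blowup_val_morphism (fst_morphism (good_proj _) (good_proj _))).
Qed.

Lemma blowup_snd_morphism : kmorphism (fun b => (sval b).2).
Proof.
exact: (kmorphism_comp blowup_val_morphism (snd_morphism (good_proj _) (good_proj _))).
Qed.

Lemma bpt_morphism N : kmorphism (bpt N).
Proof.
apply: (grass_lift_morphism good_blowup) => b0.
have [U1 [s1 [oU1 U1b s1reg s1P]]] := proj_lift b0 blowup_fst_morphism.
have [U2 [s2 [oU2 U2b s2reg s2P]]] := proj_lift b0 blowup_snd_morphism.
have oU := good_openI good_blowup oU1 oU2.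
exists (U1 `&` U2), (fun i b => wvec t (s1 b) (s2 b) i); split=> //.
  move=> b [/s1P[s10 s1E] /s2P[s20 s2E]].
  have bs : on_blowup b (s1 b) (s2 b).
    by split=> //; rewrite ?s1E ?s2E; apply: mem_lspan.
  split; first exact: (wvec_frame yl (on_blowup_compatible bs)).
  exact: bpt_W.
move=> i; apply: (reg_wordprod t good_blowup _ oU).
  exact: (reg_vec_sub good_blowup oU1 oU (@subIsetl _ _ _) s1reg).
exact: (reg_vec_sub good_blowup oU2 oU (@subIsetr _ _ _) s2reg).
Qed.

Definition bbar_family : subalg_family F (blowup K) :=
  Family (fun b => bbar_subalgebra t (bC b) (bY b)) bptE bpt_morphism.

Implicit Types x : punctured K.

Lemma punctured_off x C : sval (sval x) C -> C != 0 -> off_scalar C != 0.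
Proof.
move=> xC C0; apply/eqP => /off_scalar_eq0 CE; case: (svalP x).
have c0 : C 1 1 != 0.
  by apply: contra C0 => /eqP c0; rewrite CE c0 (_ : 0%:M = 0) //; apply: raddf0.
apply: proj_line; first exact: oner_neq0.
rewrite (proj_line C0 xC); apply/lspan1P; exists (C 1 1)^-1.
by rewrite CE scale_scalar_mx mxE eqxx mulVf.
Qed.

Lemma off_scalar_compatible C : off_scalar C != 0 -> compatible C (off_scalar C).
Proof.
move=> C0; split=> //; exists (C 1 1), 1; rewrite oner_eq0 orbT scale1r.
by split=> //; apply: offmat_off_scalar.
Qed.

Lemma incl_exists x : exists b, blowdown b = sval x /\
  forall C, sval (sval x) C -> C != 0 -> on_blowup b C (off_scalar C).
Proof.
have [C C0 CE] := proj_gen (sval x).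
have xC : sval (sval x) C by rewrite CE; apply: mem_lspan.
have [b bCy] := compatible_on_blowup (off_scalar_compatible (punctured_off xC C0)).
have [_ y0 bC_ by_] := bCy; exists b; split; first exact: proj_eq C0 bC_ xC.
move=> C'; rewrite CE => /lspan1P[a ->] aC; split=> //.
- apply: (@punctured_off x) => //; rewrite CE; apply/lspan1P; by exists a.
- by rewrite (proj_line C0 bC_); apply/lspan1P; exists a.
- by rewrite off_scalarZ (proj_line y0 by_); apply/lspan1P; exists a.
Qed.

Definition blowup_incl x : blowup K := projT1 (cid (incl_exists x)).

Lemma blowdown_incl x : blowdown (blowup_incl x) = sval x.
Proof. by case: (projT2 (cid (incl_exists x))). Qed.

Lemma incl_on x C : sval (sval x) C -> C != 0 -> on_blowup (blowup_incl x) C (off_scalar C).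
Proof. by case: (projT2 (cid (incl_exists x))) => _; apply. Qed.

(** Away from [I] the second line is forced, [off_scalar C] being a nonzero multiple of y. *)
Lemma blowdown_eq b x : blowdown b = sval x -> b = blowup_incl x.
Proof.
move=> bx; have [C0 y0 bC_ by_] := bCY b.
have xC : sval (sval x) (bC b) by rewrite -bx.
have ix := incl_on xC C0; have [_ oy0 _ _] := ix.
apply: blowup_eq ix; split=> //.
have [_ [c [l [_ CE]]]] := bCY_compatible b.
have oE : off_scalar (bC b) = l *: bY b.
  by rewrite CE -scalemx1 off_scalarZD off_scalar1 scaler0 add0r off_scalarZ offmatK.
by rewrite oE (proj_line y0 by_); apply/lspan1P; exists l.
Qed.

Lemma incl_morphism : kmorphism blowup_incl.
Proof.
apply: (subspace_morphism good_punctured); apply: (prod_morphism good_punctured).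
  have -> : (fun x => (sval (blowup_incl x)).1) = (fun x => sval x).
    by apply/funext => x; apply: blowdown_incl.
  exact/subspace_val_morphism/good_proj.
apply: (proj_lift_morphism good_punctured) => x0.
have mv : kmorphism (fun x => sval x) by apply/subspace_val_morphism/good_proj.
have [U [s [oU Ux0 sreg sP]]] := proj_lift x0 mv.
have [o oE] : exists o : {linear 'M[K]_2 -> 'rV[K]_3}, forall C, o C = off_scalar C.
  by apply: ex_linear => a C C'; apply: off_scalarZD.
exists U, (o \o s); split=> //; first exact: reg_vec_linear.
move=> x Ux; have [s0 sE] := sP x Ux.
have xs : sval (sval x) (s x) by rewrite sE; apply: mem_lspan.
have [_ o0 _ iy] := incl_on xs s0.
by rewrite /= oE; split=> //; apply: proj_line.
Qed.

Lemma incl_pt_morphism N : kmorphism (bpt N \o blowup_incl).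
Proof. exact: kmorphism_comp incl_morphism (@bpt_morphism N). Qed.

(** Obtained by restricting the family on the blow-up, from which it inherits constant dimensions
    and regularity; [bethe_familyE] identifies its members with the B(C). *)
Definition bethe_family : subalg_family F (punctured K) :=
  Family (fun x => bbar_subalgebra t (bC (blowup_incl x)) (bY (blowup_incl x)))
    (fun N x => bptE N (blowup_incl x)) incl_pt_morphism.

Lemma bethe_familyE x C : sval (sval x) C -> C != 0 ->
  fam_alg bethe_family x = bethe_alg t C.
Proof.
move=> xC C0; rewrite /= -/(balg _) (balgE (incl_on xC C0)); symmetry.
apply: (bethe_bbar yl (oner_neq0 K) (c := C 1 1)).
by rewrite scale1r; apply: offmat_off_scalar.
Qed.

End Blowup.

(** * The closure and its isomorphism with the blow-up *)

Section Closure.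
Variables (K : numClosedFieldType) (A : algType K) (t : 'I_2 -> 'I_2 -> nat -> A).
Variable F : nat -> set A.
Hypothesis yl : yangian_like t F.
Implicit Types (C P : 'M[K]_2) (y u : 'rV[K]_3) (b : blowup K) (x : punctured K).

Local Notation W C y N := (lspan (range (@wvec K A t C y N))).
Local Notation dim N := (size (swords N)).
Local Notation B := (bethe_family yl).
Let sF := yl_subspace yl.

Lemma good_trunc N : good (truncated_tower_space B N).
Proof. by apply: good_pi => i; apply: good_grass. Qed.

Lemma good_tower : good (tower_space B).
Proof. by apply: good_pi => i; apply: good_grass. Qed.

Lemma good_closure_space : good (closure_space B).
Proof. exact: good_subspace good_tower. Qed.

Lemma polyfun_id_poly (p : K -> K) : polyfun [set id] p ->
  exists q : {poly K}, forall e, p e = q.[e].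
Proof.
elim=> [_ ->|c|f g _ [q fq] _ [r gr]|f g _ [q fq] _ [r gr]].
- by exists 'X => e; rewrite hornerX.
- by exists c%:P => e; rewrite hornerC.
- by exists (q + r) => e; rewrite hornerD fq gr.
- by exists (q * r) => e; rewrite hornerM fq gr.
Qed.

Lemma incl_dense b : kclosure (range (@blowup_incl K)) b.
Proof.
have bCy := bCY b; have Cy := bCY_compatible b.
have [C0 y0 _ _] := bCy.
have sub_incl b' C y : on_blowup b' C y -> off_scalar C != 0 -> range (@blowup_incl K) b'.
  move=> bCy' oC; have [C'0 _ bC' _] := bCy'.
  have nx : sval (sval b').1 <> lspan [set 1%:M].
    move=> E; move: bC'; rewrite E => /lspan1P[a CE]; move: oC.
    by rewrite CE off_scalarZ off_scalar1 scaler0 eqxx.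
  exists (exist (fun L : proj_mat K => sval L <> lspan [set 1%:M]) (sval b').1 nx) => //.
  by symmetry; apply: blowdown_eq.
have [o0|o0] := eqVneq (off_scalar (bC b)) 0; last first.
  by move=> U oU Ub; exists b; split=> //; apply: sub_incl bCy o0.
(* The points [c I + e Y, y] of the proper transform of a line through [I]
   lie outside the exceptional divisor for e <> 0. *)
have CE := off_scalar_eq0 o0; set c := bC b 1 1 in CE.
have c0 : c != 0.
  by apply: contra C0 => /eqP c0; rewrite CE c0 (_ : 0%:M = 0) //; apply: raddf0.
pose s (e : K) := bC b + e *: offmat (bY b).
have sC e : compatible (s e) (bY b).
  by split=> //; exists c, e; rewrite c0 /s CE.
pose X := quasi_affine [set (id : K -> K)].
have gX : good X by apply: good_quasi_affine.
pose g (e : X) : blowup K := projT1 (cid (compatible_on_blowup (sC e))).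
have gE e : on_blowup (g e) (s e) (bY b) := projT2 (cid (compatible_on_blowup (sC e))).
have oT := good_openT gX.
have mg : kmorphism g.
  apply: (subspace_morphism gX); apply: (prod_morphism gX);
    apply: (proj_lift_morphism gX) => e0.
  - exists setT, s; split=> //.
      apply: (reg_vecD gX oT); first exact: (reg_vec_cst gX).
      apply: (reg_vecZ gX oT (a := id)); last exact: (reg_vec_cst gX).
      move=> e _; exists id, (fun=> 1); split.
      + exact: polyfun_gen.
      + exact: polyfun_cst.
      + exact: oner_neq0.
      + by move=> e' _ _; rewrite divr1.
    move=> e _; have [s0 _ gs _] := gE e; split=> //; exact: proj_line.
  - exists setT, (fun=> bY b); split=> //; first exact: (reg_vec_cst gX).
    by move=> e _; have [_ _ _ gy] := gE e; split=> //; exact: proj_line.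
have g0 : g 0 = b.
  by apply: (blowup_eq (gE 0)); rewrite /s scale0r addr0.
move=> U oU Ub; have [oV _] := mg _ oU.
have [|p [Gp p0 pU]] := oV 0; first by rewrite /= g0.
have [r pr] := polyfun_id_poly Gp.
have [e e0 pe] : exists2 e, e != 0 & p e != 0.
  apply: contrapT => ne.
  (* A polynomial vanishing at every e <> 0 gives one vanishing everywhere after multiplication by
     'X, whereas r is nonzero at 0. *)
  have : 'X * r = 0.
    apply: poly_fun0 => e; rewrite hornerM hornerX -pr; apply/eqP.
    rewrite mulf_eq0; have [//|e0] /= := eqVneq e 0.
    by apply/negPn/negP => pe; apply: ne; exists e.
  move/eqP; rewrite mulf_eq0 polyX_eq0 /= => /eqP r0.
  by move: p0; rewrite pr r0 horner0 eqxx.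
exists (g e); split; first exact: pU.
apply: (sub_incl _ _ _ (gE e)).
rewrite /s [bC b + _]addrC off_scalarZD o0 addr0 offmatK scaler_eq0 negb_or e0.
exact: y0.
Qed.

(** Every truncation of the tower is a morphism on the blow-up, and the points off the exceptional
    divisor are dense by [incl_dense]. *)
Lemma phi_closure b : [set z : tower_space B | forall N,
  closure_trunc (truncate_tower (N:=N) z)] (fun N => bpt yl N b).
Proof.
move=> N; pose h b : truncated_tower_space B N := fun i => bpt yl i b.
have mh : kmorphism h.
  by apply: (pi_morphism (good_blowup K)) => i; apply: bpt_morphism.
move=> U oU Ub; have [oV _] := mh _ oU.
have [b' [Ub' [x _ xb]]] := incl_dense oV Ub.
by exists (h b'); split=> //; exists x => //; rewrite -xb.
Qed.

Definition phi b : closure_space B := exist _ (fun N => bpt yl N b) (@phi_closure b).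

Lemma phi_morphism : kmorphism phi.
Proof.
apply: (subspace_morphism (good_blowup K)).
by apply: (pi_morphism (good_blowup K)) => N; apply: bpt_morphism.
Qed.

Lemma closure_point (z : closure_space B) :
  exists C y, compatible C y /\ forall N, sval (sval z N) = W C y N.
Proof.
(* Truncating at N + 2 makes the levels 1, 2 and N available together. The pair (C, y) is found
   once, from the truncation at 2, and then serves every N. *)
pose X N := truncated_tower_space B N.+2.
have i1 N : (1 < N.+3)%N by [].
have i2 N : (2 < N.+3)%N by [].
pose f1 N (w : X N) : grass (F 1) (dim 1) := w (Ordinal (i1 N)).
pose f2 N (w : X N) : grass (F 2) (dim 2) := w (Ordinal (i2 N)).
have iN N : (N < N.+3)%N by rewrite ltnW // ltnW.
pose fN N (w : X N) : grass (F N) (dim N) := w (Ordinal (iN N)).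
have gG N (i : 'I_N) : good (grass (F i) (dim i)) by apply: good_grass.
have mf1 N : kmorphism (f1 N) := 
  @pi_proj_morphism _ _ (fun i : 'I_N.+3 => grass (F i) (dim i)) (Ordinal (i1 N)) (gG N.+3).
have mf2 N : kmorphism (f2 N) := 
  @pi_proj_morphism _ _ (fun i : 'I_N.+3 => grass (F i) (dim i)) (Ordinal (i2 N)) (gG N.+3).
have mfN N : kmorphism (fN N) := 
  @pi_proj_morphism _ _ (fun i : 'I_N.+3 => grass (F i) (dim i)) (Ordinal (iN N)) (gG N.+3).
have fS N w : range (@truncate_tower _ _ _ _ B N.+2 \o fam_tower B) w ->
    exists C y, [/\ compatible C y, in_W t (f1 N) w C y, in_W t (f2 N) w C y &
                    in_W t (fN N) w C y].
  move=> [x _ <-]; exists (bC (blowup_incl x)), (bY (blowup_incl x)); split=> //.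
  exact: bCY_compatible.
have [|C [y [Cy z1 z2]]] := closure_step2 yl (good_trunc 2) (svalP z 2) (mf1 0) (mf2 0).
  by move=> w /fS[C [y [Cy w1 w2 _]]]; exists C, y.
exists C, y; split=> // N.
exact: (closure_stepN yl (good_trunc N.+2) (svalP z N.+2) (mf1 N) (mf2 N) (mfN N)
  (fS N) Cy z1 z2).
Qed.

Lemma phi_surj (z : closure_space B) : exists b, phi b = z.
Proof.
have [C [y [Cy zE]]] := closure_point z.
have [b bCy] := compatible_on_blowup Cy; exists b.
case: z zE => z zP /= zE; apply: eq_exist; apply: functional_extensionality_dep => N.
by apply: subspace_pt_inj; rewrite (bpt_W yl N bCy) zE.
Qed.

Lemma phi_fst b P : sval (sval b).1 P <-> sval (sval (phi b) 2%N) (trc t P 2).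
Proof.
have [C0 _ bC_ _] := bCY b.
by rewrite (proj_line C0 bC_) lspan1P -(W2_lineP yl P (bCY_compatible b)).
Qed.

Lemma phi_snd b u : sval (sval b).2 u <-> sval (sval (phi b) 1%N) (trc t (offmat u) 1).
Proof.
have [_ y0 _ bY_] := bCY b.
by rewrite (proj_line y0 bY_) lspan1P -(W1_lineP yl u (bCY_compatible b)).
Qed.

Lemma phi_inj : injective phi.
Proof.
move=> b b' bb'; have [C0 y0 bC_ bY_] := bCY b.
apply: (blowup_eq (bCY b)); split=> //.
  by apply/phi_fst; rewrite -bb'; apply/phi_fst.
by apply/phi_snd; rewrite -bb'; apply/phi_snd.
Qed.

(** The inverse reads the line of C in level 2 and that of y in level 1, both cut out by fixed
    subspaces; [line_morphism] makes it regular. *)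
Lemma phi_isomorphism : kisomorphism phi.
Proof.
split; first exact: phi_morphism.
pose psi z := projT1 (cid (phi_surj z)).
have psiK : cancel psi phi by move=> z; apply: (projT2 (cid (phi_surj z))).
exists psi; split=> //; last by move=> b; apply: phi_inj.
have mz N : kmorphism (fun z : closure_space B => sval z N).
  have mv : kmorphism (fun z : closure_space B => sval z).
    exact: subspace_val_morphism good_tower.
  have mp : kmorphism (fun z : tower_space B => z N).
    by apply: pi_proj_morphism => M; apply: good_grass.
  exact: kmorphism_comp mv mp.
apply: (subspace_morphism good_closure_space); apply: (prod_morphism good_closure_space).
  have [iota [pi [iE piK]]] := ex_iota2 yl.
  apply: (line_morphism good_closure_space (mz 2%N) (sF 2) piK) => z P.
  by rewrite iE phi_fst psiK.
have [iota [pi [iE piK]]] := ex_iota1 yl.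
apply: (line_morphism good_closure_space (mz 1%N) (sF 1) piK) => z u.
by rewrite iE phi_snd psiK.
Qed.

Lemma phi_alg b : balg t b = closure_alg (phi b).
Proof.
apply/seteqP; split=> a.
  move=> /bbar_span[N aN]; exists N => //=.
  by rewrite (wvec_span yl (bCY_compatible b)).
move=> [N _] zNa; have : sval (bpt yl N b) a by exact: zNa.
by rewrite bptE => -[].
Qed.

Theorem bethe_closure : exists B0 : subalg_family F (punctured K),
  (forall x C, sval (sval x) C -> C != 0 -> fam_alg B0 x = bethe_alg t C) /\
  exists (Bbar : subalg_family F (blowup K)) (phi0 : blowup K -> closure_space B0),
    [/\ kisomorphism phi0,
        forall b, fam_alg Bbar b = closure_alg (phi0 b) &
        forall b x, blowdown b = sval x -> sval (phi0 b) = fam_tower B0 x].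
Proof.
exists (bethe_family yl); split; first exact: bethe_familyE.
exists (bbar_family yl), phi; split.
- exact: phi_isomorphism.
- exact: phi_alg.
- by move=> b x /blowdown_eq ->.
Qed.

End Closure.

Lemma qdet_coefE (K : fieldType) m : qdet_coef K m = qdet (@yt K) m.
Proof. by rewrite /qdet_coef sumrB. Qed.

Lemma betheE (K : numClosedFieldType) (C : 'M[K]_2) : bethe C = bethe_alg (@yt K) C.
Proof.
have qE : @qdet_coef K = qdet (@yt K) by apply/funext => m; apply: qdet_coefE.
by rewrite /bethe qE.
Qed.
Theorem theorem1 (R : realType) :
  exists B : subalg_family (@yfil R[i]) (punctured R[i]),
    (forall (x : punctured R[i]) (C : 'M[R[i]]_2),
       sval (sval x) C -> C != 0 -> fam_alg B x = bethe C) /\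
    exists (Bbar : subalg_family (@yfil R[i]) (blowup R[i]))
           (phi : blowup R[i] -> closure_space B),
      [/\ kisomorphism phi,
          forall b, fam_alg Bbar b = closure_alg (phi b) &
          forall (b : blowup R[i]) (x : punctured R[i]),
            blowdown b = sval x -> sval (phi b) = fam_tower B x].
Proof.
have [B [BE [Bbar [phi phiP]]]] := bethe_closure (yangian_is_yangian_like R[i]).
exists B; split; last by exists Bbar, phi.
by move=> x C xC C0; rewrite (BE x C xC C0) betheE.
Qed.
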